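(* Let $w\in\{0,1\}^{\omega}$ be a recurrent infinite word over the binary alphabet $\{0,1\}$. Then $w$ is Sturmian if and only if each factor $u$ of $w$ has two or three abelian returns in $w$.
   Context: For a finite alphabet $\Sigma$, $\Sigma^{\omega}$ is the set of right-infinite words $w=w_1w_2\cdots$ over $\Sigma$. A factor of $w$ is a finite word occurring as a block of consecutive letters of $w$. An infinite word is recurrent if each of its factors occurs in it infinitely many times. A Sturmian word is an infinite word having exactly $n+1$ distinct factors of length $n$ for every $n\ge 0$ (so it is a binary word; its letters are denoted $0,1$). For a finite word $u$ and a letter $a$, $|u|$ is the length of $u$ and $|u|_a$ the number of occurrences of $a$ in $u$. Two finite words $u,v$ are abelian equivalent, $u\sim_{ab}v$, if $|u|_a=|v|_a$ for all letters $a$. Abelian returns: let $w$ be a recurrent infinite word, $u$ a factor of $w$, and let $n_1<n_2<n_3<\cdots$ be all the integers $n_i$ such that $w_{n_i}\cdots w_{n_i+|u|-1}\sim_{ab}u$. An abelian return to $u$ in $w$ is the abelian equivalence class of a word $w_{n_i}\cdots w_{n_{i+1}-1}$, $i\ge1$. The number of abelian returns to $u$ is the number of distinct such abelian classes. *)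

(* Defs.v *)
From mathcomp Require Import all_boot.
From mathcomp Require Import boolp classical_sets functions cardinality.

Set Implicit Arguments.
Unset Strict Implicit.
Unset Printing Implicit Defensive.

Local Open Scope classical_set_scope.
Local Open Scope card_scope.

(* The positions of an infinite word are numbered from 0. *)
Definition infword (A : finType) : Type := nat -> A.

Definition block (A : finType) (w : infword A) (i n : nat) : seq A :=
  [seq w k | k <- iota i n].

Definition occurs_at (A : finType) (w : infword A) (u : seq A) (i : nat) : Prop :=
  block w i (size u) = u.

Definition factor (A : finType) (w : infword A) (u : seq A) : Prop :=
  exists i : nat, occurs_at w u i.

Definition recurrent (A : finType) (w : infword A) : Prop :=
  forall u : seq A, factor w u -> infinite_set [set i : nat | occurs_at w u i].

(* [E #= `I_k] says that E is finite with exactly k elements. *)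
Definition sturmian (A : finType) (w : infword A) : Prop :=
  forall n : nat, [set u : seq A | factor w u /\ size u = n] #= `I_n.+1.

Definition abelian_eq (A : finType) (u v : seq A) : Prop :=
  forall a : A, count_mem a u = count_mem a v.

Definition abelian_class (A : finType) (u : seq A) : set (seq A) :=
  [set v : seq A | abelian_eq u v].

Definition abelian_occurs_at (A : finType) (w : infword A) (u : seq A)
    (i : nat) : Prop :=
  abelian_eq (block w i (size u)) u.

(* Two consecutive terms n_i < n_(i+1) of the increasing enumeration of all
   the positions of abelian occurrences of u in w. *)
Definition consecutive_abelian_occurrences (A : finType) (w : infword A)
    (u : seq A) (i j : nat) : Prop :=
  [/\ i < j, abelian_occurs_at w u i, abelian_occurs_at w u j &
      forall k : nat, i < k < j -> ~ abelian_occurs_at w u k].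

Definition abelian_returns (A : finType) (w : infword A) (u : seq A) :
    set (set (seq A)) :=
  [set C : set (seq A) | exists i j : nat,
    consecutive_abelian_occurrences w u i j /\
    C = abelian_class (block w i (j - i))].

(* Main.v *)
(* Write f_n(i) for the number of ones in the window of length n at position i.
   An abelian return is then the pair (length, number of ones) of the block
   between two consecutive elements of a level set {i | f_n(i) = c}, and the
   Sturmian words are those with exactly one right special word of each length.

   Sturmian words are balanced (f_n takes at most two consecutive values) and no
   f_n is constant for n > 0. In such a word the identity
   f_n(i) + f_r(i + n) = f_r(i) + f_n(i + r) yields a combinatorial three-gap
   theorem: the returns of a level set are the shortest one with a heavy block,
   the shortest one with a light block, and possibly their concatenation.

   Conversely, let every level set have two or three returns, and let n be the
   least length at which balance fails, so that there are windows 0p0 and 1p1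
   with the same p. If n > 2, one letter, say 1, is isolated. When p contains
   that letter, the windows of length n - 1 with one 1 more than p have four
   returns. When p is a power of 0, only two distances between consecutive ones
   occur, differing by more than one, and the word of their alternation would
   itself have just two returns for every extremal level set, which is
   impossible. If n = 2, both 00 and 11 occur; windows of length at most 3 force
   the run lengths to be {c, 2c} for 0 and {e, 2e} for 1, one may shrink to
   c = e = 1, and then the windows of length 3 with two ones leave a level set with a
   single return. Finally f_n is not constant: otherwise w is periodic, and
   the level set with the fewest elements per period has a single return. A
   balanced word with nonconstant f_n has one right special word of each length. *)

Require Import Defs.
From mathcomp Require Import all_boot zify finmap.
From mathcomp Require Import boolp classical_sets functions cardinality.

Set Implicit Arguments.
Unset Strict Implicit.
Unset Printing Implicit Defensive.

(** * Windows, returns and complementation *)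

(* Boolean hypotheses about letters make lia split cases; they are cleared
   when only the arithmetic of positions matters. *)
Ltac poslia :=
  repeat match goal with
  | H : is_true ?b |- _ =>
      lazymatch b with
      | leq _ _ => fail
      | andb (leq _ _) (leq _ _) => fail
      | eq_op _ _ => fail
      | negb (eq_op _ _) => fail
      | _ => clear H
      end
  | H : @eq bool _ _ |- _ => clear H
  | H : forall _, _ |- _ => clear H
  | H : and _ _ |- _ => clear H
  end; lia.

(** The hypothesis is contradicted in only two ways: by four returns to one class, or by a class
    with a single return from some position on, recurrence making the prefix harmless. The delicate
    case is that of two distances s + 1 and s + d + 1 between ones, because d = 1 does occur in
    Sturmian words. The assumption d > 1 enters through slack: a window may be one letter longer or
    shorter than an exact span between long gaps without admitting or losing another long gap. Its
    class then has two adjacent positions per span, which spends one of the three returns on (1, 0)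
    and leaves two for the derived word. Such exact spans are shortest or longest ones, hence the
    restriction to extremal classes. *)

Fixpoint ones (w : nat -> bool) (i n : nat) : nat :=
  if n is n'.+1 then w i + ones w i.+1 n' else 0.

Definition consecutive (w : nat -> bool) (n c i j : nat) : Prop :=
  [/\ i < j, ones w i n = c, ones w j n = c &
      forall k, i < k < j -> ones w k n <> c].

Definition return_type (w : nat -> bool) (n c l o : nat) : Prop :=
  exists i, consecutive w n c i (i + l) /\ ones w i l = o.

(** Plain recurrence, with the new occurrence pushed beyond any bound B; no bound on the distance
    between occurrences is meant. *)
Definition uniformly_recurring (w : nat -> bool) : Prop :=
  forall i L B, exists2 j, B <= j & forall t, t < L -> w (j + t) = w (i + t).

(** A bound on duplicate-free lists, so that the set of returns need not be known to be finite. *)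
Definition few_returns (w : nat -> bool) : Prop :=
  forall n c (s : seq (nat * nat)), uniq s ->
    (forall x, x \in s -> return_type w n c x.1 x.2) -> size s <= 3.

Definition several_returns (w : nat -> bool) : Prop :=
  forall n c i, ones w i n = c -> forall l o,
    exists l' o', return_type w n c l' o' /\ (l', o') <> (l, o).

Definition two_or_three (w : nat -> bool) : Prop :=
  [/\ uniformly_recurring w, few_returns w & several_returns w].

Lemma onesS w i n : ones w i n.+1 = w i + ones w i.+1 n.
Proof. by []. Qed.

Lemma ones_cat w i m n : ones w i (m + n) = ones w i m + ones w (i + m) n.
Proof.
by elim: m i => [|m IH] i; rewrite ?addn0 //= IH addnA addSnnS.
Qed.

Lemma onesSr w i n : ones w i n.+1 = ones w i n + w (i + n).
Proof. by rewrite -addn1 ones_cat /= addn0. Qed.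

Lemma ones_slide w i n : ones w i n + w (i + n) = w i + ones w i.+1 n.
Proof. by rewrite -onesSr. Qed.

Lemma ones_shift w i n d :
  ones w i n + ones w (i + n) d = ones w i d + ones w (i + d) n.
Proof. by rewrite -!ones_cat addnC. Qed.

Lemma ones_le w i n : ones w i n <= n.
Proof. by elim: n i => //= n IH i; have := IH i.+1; lia. Qed.

Lemma eq_ones v w i j n :
  (forall t, t < n -> v (i + t) = w (j + t)) -> ones v i n = ones w j n.
Proof.
elim: n i j => //= n IH i j h.
have := h 0; rewrite !addn0 => -> //; congr (_ + _).
by apply: IH => t ht; rewrite !addSnnS h.
Qed.

Lemma ones0P w i n : ones w i n = 0 <-> (forall t, t < n -> w (i + t) = false).
Proof.
split.
  elim: n i => //= n IH i h [|t] ht; first by rewrite addn0; lia.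
  by rewrite -addSnnS; apply: IH; lia.
move=> h; rewrite (@eq_ones _ (fun=> false) _ i) //.
by elim: n i {h} => //= n IH i; rewrite IH.
Qed.

Lemma ones_fullP w i n : ones w i n = n <-> (forall t, t < n -> w (i + t)).
Proof.
split.
  elim: n i => //= n IH i h [|t] ht; have := ones_le w i.+1 n.
    by rewrite addn0; lia.
  by rewrite -addSnnS => ?; apply: IH; lia.
move=> h; rewrite (@eq_ones _ (fun=> true) _ i) //.
by elim: n i {h} => //= n IH i; rewrite IH.
Qed.

Lemma last_one (w : nat -> bool) i j : w i -> i < j ->
  exists q, [/\ i <= q < j, w q & forall k, q < k < j -> w k = false].
Proof.
move=> wi; elim: j => // j IH; rewrite ltnS leq_eqVlt => /orP[/eqP <-|ij].
  by exists i; split=> // [|k]; lia.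
case: (boolP (w j)) => [wj|nwj]; first by exists j; split=> // [|k]; lia.
have [q [iq wq hq]] := IH ij; exists q; split=> // [|k kj]; first by lia.
have [->|kj'] := eqVneq k j; [exact: negbTE | apply: hq; lia].
Qed.

Definition negw (w : nat -> bool) (i : nat) : bool := ~~ w i.

Lemma ones_negw w i n : ones (negw w) i n + ones w i n = n.
Proof. by elim: n i => //= n IH i; have := IH i.+1; rewrite /negw; lia. Qed.

Lemma four_returns w n c l1 o1 l2 o2 l3 o3 l4 o4 : few_returns w ->
  return_type w n c l1 o1 -> return_type w n c l2 o2 ->
  return_type w n c l3 o3 -> return_type w n c l4 o4 ->
  [|| (l1 == l2) && (o1 == o2), (l1 == l3) && (o1 == o3),
      (l1 == l4) && (o1 == o4), (l2 == l3) && (o2 == o3),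
      (l2 == l4) && (o2 == o4) | (l3 == l4) && (o3 == o4)].
Proof.
move=> few r1 r2 r3 r4; apply: contraT => ne.
suff : 4 <= 3 by [].
apply: (few n c [:: (l1, o1); (l2, o2); (l3, o3); (l4, o4)]).
  by rewrite /= !in_cons !in_nil !xpair_eqE; move: ne; lia.
by move=> x; rewrite !inE => /or4P[] /eqP ->.
Qed.

Lemma return_typeI w n c i j : consecutive w n c i j ->
  return_type w n c (j - i) (ones w i (j - i)).
Proof. by move=> h; exists i; split=> //; case: h => ? *; rewrite subnKC // ltnW. Qed.

Lemma consecutiveI w n c i l : 0 < l -> ones w i n = c -> ones w (i + l) n = c ->
  (forall k, 0 < k < l -> ones w (i + k) n <> c) -> consecutive w n c i (i + l).
Proof.
move=> l0 hi hj hk; split=> //; first by lia.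
by move=> k hk'; rewrite -(@subnKC i k); [apply: hk|]; lia.
Qed.

Lemma consecutive_copy w n c i l j :
  (forall t, t < l + n -> w (j + t) = w (i + t)) ->
  consecutive w n c i (i + l) -> consecutive w n c j (j + l).
Proof.
move=> h [hl hi hj hk].
have E k : k <= l -> ones w (j + k) n = ones w (i + k) n.
  by move=> kl; apply: eq_ones => t tn; rewrite -!addnA h //; lia.
apply: consecutiveI; first by lia.
- by rewrite -hi -[j]addn0 E // addn0.
- by rewrite E.
by move=> k hk'; rewrite E; [apply: hk|]; lia.
Qed.

Lemma return_type_recurs w n c l o B : uniformly_recurring w ->
  return_type w n c l o ->
  exists2 i, B <= i & consecutive w n c i (i + l) /\ ones w i l = o.
Proof.
move=> rec [i [hc ho]]; have [j Bj hj] := rec i (l + n) B.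
exists j => //; split; first exact: consecutive_copy hc.
by rewrite -ho; apply: eq_ones => t ht; apply: hj; lia.
Qed.

Lemma consecutive_exists w n c i j : ones w i n = c -> i < j -> ones w j n = c ->
  exists2 k, k <= j & consecutive w n c i k.
Proof.
move=> hi ij hj.
have ex : exists k, (i < k) && (ones w k n == c) by exists j; rewrite ij hj eqxx.
case: (ex_minnP ex) => k /andP[ik /eqP hk] kmin; exists k.
  by apply: kmin; rewrite ij hj eqxx.
split=> // k' hk' e; have := kmin k'; rewrite e eqxx; lia.
Qed.

Lemma consecutive_inj w n c i j j' :
  consecutive w n c i j -> consecutive w n c i j' -> j = j'.
Proof.
move=> [ij _ hj h] [ij' _ hj' h']; case: (ltngtP j j') => // lt.
  by case: (h' j); rewrite // ij.
by case: (h j'); rewrite // ij'.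
Qed.

(** By recurrence every return reappears beyond B, so it is enough to inspect the returns from B
    on. *)
Lemma not_single_return w n c i B l o : two_or_three w -> ones w i n = c ->
  (forall i j, B <= i -> consecutive w n c i j -> j - i = l /\ ones w i (j - i) = o) ->
  False.
Proof.
move=> [rec _ sev] hi single.
have [l' [o' [r ne]]] := sev n c i hi l o.
have [k Bk [hc ho]] := return_type_recurs B rec r.
have := single _ _ Bk hc; rewrite addKn ho => -[e1 e2].
by apply: ne; rewrite e1 e2.
Qed.

Lemma consecutive_negw w n c i j : c <= n ->
  consecutive (negw w) n (n - c) i j <-> consecutive w n c i j.
Proof.
move=> cn; have E k := ones_negw w k n; have L k := ones_le w k n.
split=> -[ij hi hj hk]; split=> //; try by move: (E i) (E j) (L i) (L j); lia.
  by move=> k kij; have := hk k kij; move: (E k) (L k); lia.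
by move=> k kij; have := hk k kij; move: (E k) (L k); lia.
Qed.

Lemma negwK w : negw (negw w) =1 w.
Proof. by move=> i; rewrite /negw negbK. Qed.

Lemma return_type_negw w n c l o : c <= n -> o <= l ->
  return_type (negw w) n c l o -> return_type w n (n - c) l (l - o).
Proof.
move=> cn ol [i [hc ho]]; exists i; split.
  by apply/consecutive_negw; rewrite ?leq_subr // subKn.
by move: (ones_negw w i l); lia.
Qed.

Lemma return_type_le w n c l o : return_type w n c l o -> c <= n /\ o <= l.
Proof. by case=> i [[_ <- _ _] <-]; split; apply: ones_le. Qed.

Lemma two_or_three_negw w : two_or_three w -> two_or_three (negw w).
Proof.
move=> [rec few sev]; split.
- move=> i L B; have [j Bj h] := rec i L B; exists j => // t tL.
  by rewrite /negw h.
- move=> n c s us hs.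
  (* Complementation turns the return (l, o) into (l, l - o), injectively because o <= l. *)
  rewrite -(size_map (fun x => (x.1, x.1 - x.2))).
  apply: (few n (n - c)).
    rewrite map_inj_in_uniq // => -[a b] [a' b'] /hs/return_type_le /= [_ h].
    move=> /hs/return_type_le /= [_ h'] [e1 e2]; congr (_, _); lia.
  move=> _ /mapP[x xs ->] /=.
  by have r := hs x xs; have [??] := return_type_le r; apply: return_type_negw.
- move=> n c i hi l o.
  have ci : c <= n by rewrite -hi ones_le.
  have hi' : ones w i n = n - c by have := ones_negw w i n; lia.
  have [l' [o' [r ne]]] := sev n _ i hi' l (l - o).
  have [_ ol'] := return_type_le r.
  exists l', (l' - o'); split.
    case: r => k [hc ho]; exists k; split.
      by rewrite -{1}(subKn ci); apply/consecutive_negw; first exact: leq_subr.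
    by move: (ones_negw w k l'); lia.
  by case=> e1 e2; apply: ne; congr (_, _); lia.
Qed.

(** * Words with two returns to every extremal class *)

Definition extremal (v : nat -> bool) (m c : nat) : Prop :=
  (forall k, ones v k m <= c) \/ (forall k, c <= ones v k m).

(* Only classes of extremal weight transfer from w to the word coding the
   numbers of ones between its long gaps, whence this weak form of
   [two_or_three], in which such a class has exactly two return types. *)
Definition two_extremal_returns (v : nat -> bool) : Prop :=
  forall m c, 0 < m -> extremal v m c ->
    (forall l1 o1 l2 o2 l3 o3, return_type v m c l1 o1 ->
       return_type v m c l2 o2 -> return_type v m c l3 o3 ->
       [|| (l1 == l2) && (o1 == o2), (l1 == l3) && (o1 == o3)
         | (l2 == l3) && (o2 == o3)]) /\
    (forall i B l o, ones v i m = c -> exists i j,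
       [/\ B <= i, consecutive v m c i j & (j - i, ones v i (j - i)) <> (l, o)]).

Lemma two_extremal_returns_negw v :
  two_extremal_returns v -> two_extremal_returns (negw v).
Proof.
move=> H m c m0 ext.
have E k := ones_negw v k m.
have cm : (exists i, ones (negw v) i m = c) -> c <= m by case=> i <-; apply: ones_le.
have ext' : extremal v m (m - c).
  by case: ext => ext; [right|left] => k; have := ext k; have := E k; lia.
have [few sev] := H m (m - c) m0 ext'; split.
  move=> l1 o1 l2 o2 l3 o3 r1 r2 r3.
  have [c1 ?] := return_type_le r1; have [_ ?] := return_type_le r2.
  have [_ ?] := return_type_le r3.
  have := few _ _ _ _ _ _ (return_type_negw c1 _ r1) (return_type_negw c1 _ r2)
    (return_type_negw c1 _ r3).
  by lia.
move=> i B l o hi; have {}cm : c <= m by apply: cm; exists i.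
have [|i' [j [Bi hc ne]]] := sev i B l (l - o); first by have := E i; lia.
exists i', j; split=> //.
  by rewrite -(subKn cm); apply/consecutive_negw; first exact: leq_subr.
have := ones_negw v i' (j - i'); have := ones_le v i' (j - i').
by move=> h1 h2 [e1 e2]; apply: ne; congr (_, _); lia.
Qed.

Lemma ones1 w i : ones w i 1 = w i.
Proof. by rewrite /= addn0. Qed.

Lemma consecutive_letterP v i j : consecutive v 1 1 i j <->
  [/\ i < j, v i, v j & forall k, i < k < j -> v k = false].
Proof.
split=> -[ij hi hj h]; split=> //; rewrite ?ones1.
- by move: hi; rewrite ones1; case: (v i).
- by move: hj; rewrite ones1; case: (v j).
- by move=> k kij; have := h k kij; rewrite ones1; case: (v k).
- by rewrite hi.
- by rewrite hj.
- by move=> k kij; rewrite ones1 h.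
Qed.

Lemma consecutive_letter_ones v i j : consecutive v 1 1 i j -> ones v i (j - i) = 1.
Proof.
move=> /consecutive_letterP[ij vi _ h]; case E : (j - i) => [|d]; first by lia.
rewrite onesS vi; suff -> : ones v i.+1 d = 0 by [].
by apply/ones0P => t td; apply: h; lia.
Qed.

Lemma extremal_letter (v : nat -> bool) : extremal v 1 1.
Proof. by left=> k; rewrite ones1; lia. Qed.

(** The letter 1 has two distances g, and each yields the return (g - 1, 1) from 10 to the next 01.
    With the return (1, 0) from 01 to 10, the class of 01 and 10, extremal since 11 does not occur,
    has three. *)
Lemma isolated_absurd v : two_extremal_returns v ->
  (exists i, v i) -> (forall B, exists2 i, B <= i & v i = false) ->
  (forall i, v i -> v i.+1 = false) -> False.
Proof.
move=> H [i0 vi0] inf0 iso.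
have [_ sev1] := H 1 1 isT (@extremal_letter v).
have hi0 : ones v i0 1 = 1 by rewrite ones1 vi0.
have [i1 [j1 [_ c1 _]]] := sev1 _ 0 0 0 hi0.
have [i2 [j2 [_ c2 ne]]] := sev1 _ 0 (j1 - i1) 1 hi0.
have max2 k : ones v k 2 <= 1.
  by rewrite /= addn0; have := @iso k; lia.
have [few _] := H 2 1 isT (or_introl max2).
have gap i j : consecutive v 1 1 i j ->
    1 < j - i /\ return_type v 2 1 (j - i).-1 1.
  move=> c; have := c => /consecutive_letterP[ij vi vj h].
  have ij2 : i.+1 < j.
    by rewrite ltn_neqAle ij andbT; apply: contraTneq vj => <-; rewrite iso.
  split; first by lia.
  have vj1 : v j.-1 = false by apply: h; lia.
  have e := consecutive_letter_ones c.
  exists i; split; last first.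
    case El : (j - i) e => [|l] /=; first by poslia.
    by rewrite -onesS onesSr (_ : i + l = j.-1) ?vj1 ?addn0 //; poslia.
  apply: consecutiveI; first by lia.
  - by rewrite /= vi iso.
  - have -> : i + (j - i).-1 = j.-1 by poslia.
    by rewrite /= vj1 prednK ?vj //; lia.
  - by move=> k hk; rewrite /= !h //; lia.
have [l1 r1] := gap _ _ c1; have [l2 r2] := gap _ _ c2.
have ne12 : j1 - i1 <> j2 - i2.
  by move=> e; apply: ne; rewrite (consecutive_letter_ones c2) e.
have r0 : return_type v 2 1 1 0.
  have [i c _] := (inf0 0).
  have := c1 => /consecutive_letterP[ij vi vj h].
  have vj1 : v j1.-1 = false by apply: h; lia.
  have ej : j1 = j1.-1.+1 by lia.
  exists j1.-1; split; last by rewrite ones1 vj1.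
  apply: consecutiveI => //.
  - by rewrite /= vj1 -ej vj.
  - by rewrite addn1 -ej /= vj iso.
  - by move=> k; lia.
by have := few _ _ _ _ _ _ r0 r1 r2; lia.
Qed.

(** If 00 and 11 both occur, distance 1 is one of the two distances for either letter. The other
    ones, J and I, then fix the runs: J - 1 zeros and I - 1 ones. So (I + J - 2, I - 1) is the only
    return to the full window of length I - 1. *)
Lemma two_extremal_returns_absurd v : two_extremal_returns v ->
  (forall B, exists2 i, B <= i & v i) ->
  (forall B, exists2 i, B <= i & v i = false) -> False.
Proof.
move=> H inf1 inf0.
have [iD _ viD] := inf1 0; have [i0 _ vi0] := inf0 0.
have [noDD|] := pselect (forall i, v i -> v i.+1 = false).
  by apply: (isolated_absurd H) => //; exists iD.
move=> /existsNP[d /not_implyP[vd /eqP]]; rewrite eqbF_neg negbK => vd1.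
have [noCC|] := pselect (forall i, v i = false -> v i.+1).
  apply: (isolated_absurd (two_extremal_returns_negw H)).
  - by exists i0; rewrite /negw vi0.
  - by move=> B; have [i Bi vi] := inf1 B; exists i; rewrite // /negw vi.
  - by move=> i; rewrite /negw => /negbTE /noCC ->.
move=> /existsNP[c /not_implyP[vc /negP/negbTE vc1]].
have gaps u : two_extremal_returns u -> (exists i, u i /\ u i.+1) ->
    exists2 J, 1 < J & forall i j, consecutive u 1 1 i j -> j - i = 1 \/ j - i = J.
  move=> Hu [i [ui ui1]]; have [few sev] := Hu 1 1 isT (@extremal_letter u).
  have hi : ones u i 1 = 1 by rewrite ones1 ui.
  have [i' [j' [_ c' ne]]] := sev i 0 1 1 hi.
  have cl : consecutive u 1 1 i i.+1.
    by apply/consecutive_letterP; split=> //; move=> k; poslia.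
  have o1 := consecutive_letter_ones cl; have o2 := consecutive_letter_ones c'.
  have ne1 : j' - i' <> 1 by move=> e; case: ne; rewrite o2 e.
  exists (j' - i'); first by have [? _ _ _] := c'; poslia.
  move=> a b cab; have o3 := consecutive_letter_ones cab.
  have := few _ _ _ _ _ _ (return_typeI cl) (return_typeI c') (return_typeI cab).
  rewrite o1 o2 o3 !andbT subSnn; clear -ne1.
  by case/or3P=> /eqP e; [case: ne1 | left | right].
have [J J1 hJ] := gaps v H (ex_intro _ d (conj vd vd1)).
have [|I I1 hI] := gaps _ (two_extremal_returns_negw H).
  by exists c; rewrite /negw vc vc1.
(* From a zero followed by a one, the next I-1 letters are ones followed by zero. *)
have inf0' B : exists2 i, B < i & ~~ v i.
  by have [i ? vi] := inf0 B.+1; exists i; rewrite ?vi.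
have inf1' B : exists2 i, B < i & v i by have [i ? ?] := inf1 B.+1; exists i.
have next0 i : negw v i -> exists2 j, consecutive (negw v) 1 1 i j & True.
  move=> vi; have [j ij vj] := inf0' i.
  have [||k _ ck] := @consecutive_exists (negw v) 1 1 i j _ ij.
  - by rewrite ones1 vi.
  - by rewrite ones1 [negw v j]vj.
  by exists k.
have next1 i : v i -> exists2 j, consecutive v 1 1 i j & True.
  move=> vi; have [j ij vj] := inf1' i.
  have [||k _ ck] := @consecutive_exists v 1 1 i j _ ij.
  - by rewrite ones1 vi.
  - by rewrite ones1 vj.
  by exists k.
have blockD i : v i = false -> v i.+1 ->
    (forall t, 0 < t < I -> v (i + t)) /\ v (i + I) = false.
  move=> vi vi1; have [|j cj _] := next0 i; first by rewrite /negw vi.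
  have := cj => /consecutive_letterP[ij _ vj h].
  have ej : j - i = I.
    case: (hI _ _ cj) => // e; have ej : j = i.+1 by poslia.
    by move: vj; rewrite ej /negw vi1.
  rewrite -ej subnKC ?(ltnW ij) //; split; last by apply: negbTE.
  by move=> t ht; have := h (i + t) _; rewrite /negw => /(_ _)/negbFE; apply; poslia.
have blockC i : v i -> v i.+1 = false ->
    (forall t, 0 < t < J -> v (i + t) = false) /\ v (i + J).
  move=> vi vi1; have [|j cj _] := next1 i; first by [].
  have := cj => /consecutive_letterP[ij _ vj h].
  have ej : j - i = J.
    case: (hJ _ _ cj) => // e; have ej : j = i.+1 by poslia.
    by move: vj; rewrite ej vi1.
  rewrite -ej subnKC ?(ltnW ij) //; split=> // t ht; apply: h; poslia.
have ext : extremal v I.-1 I.-1 by left=> k; apply: ones_le.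
have I0 : 0 < I.-1 by poslia.
have [_ sev] := H _ _ I0 ext.
have full k : ones v k I.-1 = I.-1 <-> forall t, t < I.-1 -> v (k + t).
  exact: ones_fullP.
have ones_run i : v i = false -> v i.+1 -> ones v i.+1 I.-1 = I.-1.
  move=> vi vi1; have [h _] := blockD i vi vi1.
  by apply/full => t tI; rewrite addSnnS h //; poslia.
have [s vs vs1] : exists2 i, v i = false & v i.+1.
  have [j ij vj] := inf1' i0.
  have [|q [iq vq h]] := @last_one (negw v) i0 j _ ij; first by rewrite /negw vi0.
  exists q; first exact: negbTE.
  have [->//|ne] := eqVneq q.+1 j.
  by have := h q.+1; rewrite /negw => /(_ _)/negbFE; apply; poslia.
have [i' [j' [Bi c' ne]]] := sev s.+1 s.+1 (I + J - 2) I.-1 (ones_run s vs vs1).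
apply: ne.
have [ij hi hj h] := c'; have {}hi := proj1 (full _) hi.
have vi' : v i' by rewrite -[i']addn0 hi.
have [e0 ei' v0'] : exists2 e, i' = e.+1 & v e = false.
  have [|q [iq vq h']] := @last_one (negw v) s i' _ Bi; first by rewrite /negw vs.
  have vq1 : v q.+1.
    have [->//|ne] := eqVneq q.+1 i'.
    by have := h' q.+1; rewrite /negw => /(_ _)/negbFE; apply; poslia.
  have [_ vI] := blockD q (negbTE vq) vq1.
  exists q; last exact: negbTE.
  apply/eqP; rewrite eqn_leq; apply/andP; split; last by poslia.
  rewrite leqNgt; apply/negP => lt.
  have [lt2|ge2] := ltnP (q + I) i'.
    by have := h' (q + I); rewrite /negw vI => H'; have := H' _; poslia.
  have := hi (q + I - i'); rewrite subnKC // vI => H'; have := H' _; poslia.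
subst i'.
have [hD vI] := blockD _ v0' vi'.
have vl : v (e0 + I.-1) by apply: hD; poslia.
have [|hC vJ] := blockC (e0 + I.-1) vl.
  by have -> : (e0 + I.-1).+1 = e0 + I by poslia.
have {hC} hC k : e0 + I.-1 < k < e0 + I.-1 + J -> v k = false.
  by move=> hk; have := hC (k - (e0 + I.-1)); rewrite subnKC; [apply|]; poslia.
pose s2 := e0 + I.-1 + J.
have v2 : v s2.-1 = false by apply: hC; rewrite /s2; poslia.
have es2 : s2 = s2.-1.+1 by rewrite /s2; poslia.
have h2 : ones v s2 I.-1 = I.-1 by rewrite es2; apply: ones_run; rewrite // -es2.
have ej : j' = s2.
  apply/eqP; rewrite eqn_leq; apply/andP; split.
    rewrite leqNgt; apply/negP => lt; apply: (h s2) h2; rewrite lt andbT /s2; poslia.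
  rewrite leqNgt; apply/negP => lt; have {}hj := proj1 (full _) hj.
  have vj : v j' by rewrite -[j']addn0 hj.
  have [lt1|ge1] := ltnP j' (e0 + I).
    have := hj (e0 + I - j'); rewrite subnKC ?vI; last by poslia.
    by move=> H'; have := H' _; poslia.
  by rewrite hC in vj => //; rewrite /s2 in lt; poslia.
rewrite ej (_ : s2 - e0.+1 = I.-1 + J.-1); last by rewrite /s2; poslia.
congr (_, _); first by poslia.
rewrite ones_cat (proj2 (full _) hi) (proj2 (ones0P _ _ _)) ?addn0 //.
by move=> t ht; apply: hC; poslia.
Qed.

(** * Balance: the first imbalance *)

Definition balanced_at (w : nat -> bool) (n : nat) : Prop :=
  forall i j, ones w i n <= (ones w j n).+1.

(** Cut both windows after l letters: the total difference 2 is the sum of two differences that are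
    at most 1 by minimality. Each is therefore 1 for every l, which determines the end letters and
    equates the inner ones. *)
Lemma imbalance_inner w m a b :
  (forall k, k < m.+2 -> balanced_at w k) ->
  ones w b m.+2 + 2 <= ones w a m.+2 ->
  [/\ w a, w (a + m.+1), w b = false, w (b + m.+1) = false &
      forall t, t < m -> w (a.+1 + t) = w (b.+1 + t)].
Proof.
move=> bal im.
have E l : 0 < l < m.+2 -> ones w a l = (ones w b l).+1.
  move=> hl; have := bal l _ a b; have := bal (m.+2 - l) _ (a + l) (b + l).
  have := ones_cat w a l (m.+2 - l); have := ones_cat w b l (m.+2 - l).
  have -> : l + (m.+2 - l) = m.+2 by lia.
  lia.
have e1 := E 1 isT; have em := E m.+1; move: im.
rewrite !(onesSr _ _ m.+1) em; last by lia.
rewrite /= in e1; move=> im; split; try by move: im e1; lia.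
move=> t tm; have := E t.+1; have := E t.+2; rewrite !(onesSr _ _ t.+1) !addSnnS; lia.
Qed.

Section Bispecial.

Variables (w : nat -> bool) (m a b : nat).
Hypothesis (hw : two_or_three w) (no11 : forall i, w i -> w i.+1 = false).
Hypothesis bal : forall k, k < m.+2 -> balanced_at w k.
Hypothesis imb : ones w b m.+2 + 2 <= ones w a m.+2.

Let p t := w (b.+1 + t).
Let k := ones w b.+1 m.
Let light q := ones w q m.+2 == k.
Let heavy q := ones w q m.+2 == k.+2.

Hypothesis p_has_one : exists2 t, t < m & p t.

Let kb : ones w b m.+2 = k.
Proof.
have [_ _ hb hb' _] := imbalance_inner bal imb.
by rewrite onesS hb onesSr addSnnS hb' addn0.
Qed.

Let ka : ones w a m.+2 = k.+2.
Proof.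
have [ha ha' _ _ h] := imbalance_inner bal imb.
rewrite onesS ha onesSr addSnnS ha' (@eq_ones w w a.+1 b.+1) //.
by rewrite -/k; lia.
Qed.

Let lightP q : light q ->
  [/\ w q = false, w (q + m.+1) = false & forall t, t < m -> w (q.+1 + t) = p t].
Proof.
move=> /eqP h; have im : ones w q m.+2 + 2 <= ones w a m.+2 by rewrite h ka; lia.
have [_ _ ? ? h1] := imbalance_inner bal im.
have [_ _ _ _ h2] := imbalance_inner bal imb.
by split=> // t tm; rewrite /p -h1 ?h2.
Qed.

Let heavyP q : heavy q ->
  [/\ w q, w (q + m.+1) & forall t, t < m -> w (q.+1 + t) = p t].
Proof.
move=> /eqP h; have im : ones w b m.+2 + 2 <= ones w q m.+2 by rewrite h kb; lia.
by have [? ? _ _ ?] := imbalance_inner bal im; split.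
Qed.

Let mid_range q : k <= ones w q m.+1 <= k.+1.
Proof.
have := bal (ltnSn m.+1) q b; have := bal (ltnSn m.+1) a q.
have := kb; have := ka; rewrite !(onesSr _ _ m.+1).
have [_ -> _ -> _] := imbalance_inner bal imb; lia.
Qed.

(** The window of length m + 2 at q adds only the letter at q, and by [mid_range] the shorter window
    has k or k + 1 ones. So membership of q + 1 can be read off at q. *)
Let classP q : (ones w q.+1 m.+1 == k.+1) = if w q then heavy q else ~~ light q.
Proof.
have := mid_range q.+1; rewrite /heavy /light (onesS w q m.+1).
by case: (w q); lia.
Qed.

Let p0 : p 0 = false.
Proof.
have h : heavy a by rewrite /heavy ka.
have [t tm _] := p_has_one.
have [ha _ hp] := heavyP h; rewrite -(hp 0); last by lia.
by rewrite addn0 no11.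
Qed.

(** Otherwise p would agree with its own shift and be constant, equal to its first letter 0. *)
Let no_shift q : (light q || heavy q) -> (light q.+1 || heavy q.+1) -> False.
Proof.
move=> h1 h2.
have e1 t : t < m -> w (q.+1 + t) = p t.
  by case/orP: h1 => [/lightP|/heavyP] [_ _]; apply.
have e2 t : t < m -> w (q.+2 + t) = p t.
  by case/orP: h2 => [/lightP|/heavyP] [_ _]; apply.
have [t tm pt] := p_has_one.
have : p t = false.
  elim: t tm {pt} => [|t IH] tm; first exact: p0.
  by rewrite -e1 // -addSnnS e2 ?IH //; lia.
by rewrite pt.
Qed.

Let recurs_heavy B : exists2 q, B <= q & heavy q.
Proof.
have [rec _ _] := hw; have [q Bq h] := rec a m.+2 B.
by exists q => //; rewrite /heavy -ka; apply/eqP/eq_ones.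
Qed.

Let recurs_light B : exists2 q, B <= q & light q.
Proof.
have [rec _ _] := hw; have [q Bq h] := rec b m.+2 B.
by exists q => //; rewrite /light -kb; apply/eqP/eq_ones.
Qed.

(* If every one at q satisfied heavy q or light q.+1, then p determines which
   alternative holds at the next one: passing from heavy to light forces
   p (2z+1) = 0 and passing from light to heavy forces p (2z+1) = 1, where z
   is the number of leading zeros of p; both passages have to occur. *)
Let ordinary_one : exists2 q, 0 < q & [/\ w q, ~~ heavy q & ~~ light q.+1].
Proof.
apply: contrapT => no.
have alt q : 0 < q -> w q -> heavy q || light q.+1.
  move=> q0 wq; apply: contraT; rewrite negb_or => /andP[h1 h2].
  by case: no; exists q.
have ex : exists t, (t < m) && p t by have [t ? ?] := p_has_one; exists t; apply/andP.
case: (ex_minnP ex) => z /andP[zm pz] zmin.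
have z0 : 0 < z by rewrite lt0n; apply: contraTneq pz => ->; rewrite p0.
have pz0 t : t < z -> p t = false.
  by move=> tz; apply: contraTF (tz) => pt; rewrite -leqNgt zmin // pt andbT; lia.
have next_heavy q : heavy q ->
  (forall t, t < z -> w (q.+1 + t) = false) /\ w (q.+1 + z).
  move=> /heavyP[_ _ h]; split=> [t tz|]; last by rewrite h.
  by rewrite h ?pz0 //; lia.
have next_light q : light q.+1 ->
  (forall t, t < z.+1 -> w (q.+1 + t) = false) /\ w (q.+2 + z).
  move=> /lightP[h0 _ h]; split=> [[|t] tz|]; first by rewrite addn0.
    by rewrite -addSnnS h ?pz0 //; lia.
  by rewrite h.
have LH q : light q.+1 -> heavy (q.+2 + z) -> z.*2.+1 < m -> p z.*2.+1.
  move=> lq hq lt; have [_ _ h] := lightP lq.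
  have [_ h'] := next_heavy _ hq.
  rewrite -h //; move: h'.
  by have -> : (q.+2 + z).+1 + z = q.+2 + z.*2.+1 by poslia.
have HL q : 0 < q -> heavy q -> light (q.+1 + z).+1 -> False.
  move=> q0 hq lq; have [_ hm h] := heavyP hq.
  have [h' wn] := next_light _ lq.
  have [lt pf] : z.*2.+1 < m /\ p z.*2.+1 = false.
    have [lt|ge] := ltnP z.*2.+1 m.
      split=> //; rewrite -h //.
      have -> : q.+1 + z.*2.+1 = (q.+1 + z).+1 + z by poslia.
      by apply: h'.
    suff : w (q + m.+1) = false by rewrite hm.
    have -> : q + m.+1 = (q.+1 + z).+1 + (m - z.+1) by poslia.
    by apply: h'; poslia.
  have stay r : q.+1 + z <= r -> w r -> light r.+1.
    elim/ltn_ind: r => r IH rge wr.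
    have [->//|rne] := eqVneq r (q.+1 + z).
    have [_ wq] := next_heavy _ hq.
    have [|q' [q'r wq' zq']] := last_one wq (_ : q.+1 + z < r); first by poslia.
    have lq' : light q'.+1 by apply: IH => //; poslia.
    have [zz wn'] := next_light _ lq'.
    have er : r = q'.+2 + z.
      have [lt1|ge1] := ltnP (q'.+2 + z) r.
        by rewrite zq' in wn' => //; poslia.
      have [lt2|ge2] := ltnP r (q'.+2 + z); last by poslia.
      have := zz (r - q'.+1); rewrite subnKC ?wr; last by poslia.
      by move=> H; have := H _; poslia.
    have := alt r; rewrite wr => H; have := H _ isT; case/(_ _)/orP => //; first by poslia.
    by rewrite er => hr; have := LH _ lq' hr lt; rewrite pf.
  have [q2 q2gt hq2] := recurs_heavy (q.+1 + z).
  have [wq2 _ _] := heavyP hq2.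
  by apply: (@no_shift q2); rewrite ?hq2 ?orbT // stay.
have [q1 q1gt hq1] := recurs_heavy 1.
have [wq1 _ _] := heavyP hq1.
have stay r : q1 <= r -> w r -> heavy r.
  elim/ltn_ind: r => r IH rge wr.
  have [->//|rne] := eqVneq r q1.
  have [|q' [q'r wq' zq']] := last_one wq1 (_ : q1 < r); first by poslia.
  have hq' : heavy q' by apply: IH => //; poslia.
  have [zz wn'] := next_heavy _ hq'.
  have er : r = q'.+1 + z.
    have [lt1|ge1] := ltnP (q'.+1 + z) r.
      by rewrite zq' in wn' => //; poslia.
    have [lt2|ge2] := ltnP r (q'.+1 + z); last by poslia.
    have := zz (r - q'.+1); rewrite subnKC ?wr; last by poslia.
    by move=> H; have := H _; poslia.
  have := alt r; rewrite wr => H; have := H _ isT; case/(_ _)/orP => //; first by poslia.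
  by rewrite er => lr; case: (HL q') => //; poslia.
have [t tgt lt] := recurs_light q1.
have [wt _ _] := lightP lt.
have [|q' [q't wq' zq']] := last_one wq1 (_ : q1 < t).
  by rewrite ltn_neqAle tgt andbT; apply: contraTneq wq1 => ->; rewrite wt.
have hq' : heavy q' by apply: stay => //; poslia.
have [zz wn'] := next_heavy _ hq'.
have [_ _ hp] := lightP lt.
have [lt1|ge1] := ltnP (q'.+1 + z) t.
  by rewrite zq' in wn' => //; poslia.
have [e|ne] := eqVneq (q'.+1 + z) t; first by rewrite e wt in wn'.
have := hp (q'.+1 + z - t.+1); by rewrite subnKC ?wn' ?pz0; poslia.
Qed.

(** By [classP] position q + 1 is missing from the class exactly when q is light or carries a one
    that is not heavy. A heavy one gives the returns (1, 1) and (1, 0), an ordinary one gives (2,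
    1), and a light position gives (3, 1) or (2, 0) according to the letter before it. *)
Lemma bispecial_absurd : False.
Proof.
have [rec few _] := hw.
have inP q : (if w q then heavy q else ~~ light q) -> ones w q.+1 m.+1 = k.+1.
  by rewrite -classP => /eqP.
have outP q : (if w q then heavy q else ~~ light q) = false -> ones w q.+1 m.+1 <> k.+1.
  by rewrite -classP => /eqP.
have light0 q : light q -> w q = false /\ w q.+1 = false.
  move=> /lightP[? _ h]; split=> //; rewrite -[q.+1]addn0 h ?p0 //.
  by have [t] := p_has_one; poslia.
have heavy1 q : heavy q -> w q /\ w q.+1 = false.
  by move=> /heavyP[h _ _]; rewrite no11.
have r11 : return_type w m.+1 k.+1 1 1.
  have [[//|q] _ hq] := recurs_heavy 1.
  have [wq _] := heavy1 _ hq.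
  exists q.+1; split; last by rewrite /= wq.
  apply: consecutiveI; rewrite ?addn1 //; last by move=> ?; poslia.
  - apply: inP; have -> : w q = false by apply: contraTF wq => /no11 ->.
    by apply/negP => /light0[_]; rewrite wq.
  - by apply: inP; rewrite wq.
have r10 : return_type w m.+1 k.+1 1 0.
  have [q _ hq] := recurs_heavy 1.
  have [wq wq'] := heavy1 _ hq.
  exists q.+1; split; last by rewrite /= wq'.
  apply: consecutiveI; rewrite ?addn1 //; last by move=> ?; poslia.
  - by apply: inP; rewrite wq.
  - apply: inP; rewrite wq'; apply/negP => lq'.
    by apply: (@no_shift q); rewrite ?hq ?lq' ?orbT.
have r21 : return_type w m.+1 k.+1 2 1.
  have [[//|q] _ [wq nh nl]] := ordinary_one.
  have wq' := no11 wq.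
  exists q.+1; split; last by rewrite /= wq wq'.
  apply: consecutiveI; rewrite ?addn2 //.
  - apply: inP; have -> : w q = false by apply: contraTF wq => /no11 ->.
    by apply/negP => /light0[_]; rewrite wq.
  - by apply: inP; rewrite wq'.
  - case=> [|[|?]] ?; rewrite ?addn1; try poslia.
    by apply: outP; rewrite wq; apply: negbTE.
have [[|[|q]]// _ lq] := recurs_light 2.
have [wq wq'] := light0 _ lq.
have nl : ~~ light q.+3.
  by apply/negP => h; apply: (@no_shift q.+2); rewrite ?lq ?h.
case: (boolP (w q.+1)) => wq1.
- have r31 : return_type w m.+1 k.+1 3 1.
    exists q.+1; split; last by rewrite /= wq1 wq wq'.
    apply: consecutiveI; rewrite ?addn3 //.
    + apply: inP; have -> : w q = false by apply: contraTF wq1 => /no11 ->.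
      by apply/negP => /light0[_]; rewrite wq1.
    + by apply: inP; rewrite wq'.
    + case=> [|[|[|?]]] ?; rewrite ?addn1 ?addn2; try poslia.
        apply: outP; rewrite wq1; apply/negP => h.
        by apply: (@no_shift q.+1); rewrite ?lq ?h ?orbT.
      by apply: outP; rewrite wq lq.
  by have := four_returns few r11 r10 r21 r31.
- have r20 : return_type w m.+1 k.+1 2 0.
    exists q.+2; split; last by rewrite /= wq wq'.
    apply: consecutiveI; rewrite ?addn2 //.
    + apply: inP; rewrite (negbTE wq1); apply/negP => h.
      by apply: (@no_shift q.+1); rewrite ?lq ?h.
    + by apply: inP; rewrite wq'.
    + case=> [|[|?]] ?; rewrite ?addn1; try poslia.
      by apply: outP; rewrite wq lq.
  by have := four_returns few r11 r10 r21 r20.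
Qed.

End Bispecial.

(** * Balance: two distances between ones *)

Lemma ones_split (w : nat -> bool) i j : i <= j ->
  ones w 0 j = ones w 0 i + ones w i (j - i).
Proof. by move=> ij; rewrite -{1}(subnKC ij) ones_cat. Qed.

Lemma ones_mono w i j : i <= j -> ones w 0 i <= ones w 0 j.
Proof. by move=> ij; rewrite (ones_split w ij) leq_addr. Qed.

(* [pos q] is the position of the one with exactly q ones before it. *)
Lemma nth_one (w : nat -> bool) : (forall B, exists2 i, B <= i & w i) ->
  exists pos, forall q j, (pos q < j) = (q < ones w 0 j).
Proof.
move=> inf.
have unb q : exists j, q < ones w 0 j.
  elim: q => [|q [j qj]]; first by have [i _ wi] := inf 0; exists i.+1; rewrite onesSr wi; lia.
  by have [i ij wi] := inf j; exists i.+1; rewrite onesSr wi; have := ones_mono w ij; lia.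
have H q : exists p, forall j, (p < j) = (q < ones w 0 j).
  case: (ex_minnP (unb q)) => -[|p] hp hmin; first by [].
  exists p => j; apply/idP/idP => h; last exact: hmin.
  exact: leq_trans hp (ones_mono w h).
by have [pos hpos] := choice H; exists pos => q j.
Qed.

Lemma nth_oneP w pos : (forall q j, (pos q < j) = (q < ones w 0 j)) ->
  forall q, [/\ ones w 0 (pos q) = q, w (pos q), pos q < pos q.+1 &
    forall j, pos q < j < pos q.+1 -> w j = false].
Proof.
move=> h q.
have h1 : ones w 0 (pos q) <= q by rewrite leqNgt -h ltnn.
have h2 : q < ones w 0 (pos q) + w (pos q) by rewrite -onesSr -h.
have wp : w (pos q) by move: h1 h2; case: (w (pos q)) => //; rewrite addn0; lia.
have op : ones w 0 (pos q) = q by move: h2; rewrite wp; lia.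
split=> //.
  by rewrite ltnNge -ltnS h onesSr op wp; lia.
move=> j /andP[hj1 hj2]; move: hj1; rewrite h => hj1.
move: hj2; rewrite ltnNge -ltnS h onesSr -leqNgt => hj2.
by move: hj1 hj2; case: (w j) => //=; lia.
Qed.

Lemma two_or_three_shift w a : two_or_three w -> two_or_three (fun i => w (a + i)).
Proof.
move=> [rec few sev].
have E i n : ones (fun i => w (a + i)) i n = ones w (a + i) n.
  by apply: eq_ones => t _; rewrite /= addnA.
have C n c i j : consecutive (fun i => w (a + i)) n c i j <->
    consecutive w n c (a + i) (a + j).
  rewrite /consecutive !E ltn_add2l; split=> -[ij hi hj h]; split=> // k hk.
    by rewrite -(@subnKC a k) -?E; [apply: h|]; lia.
  by rewrite E; apply: h; lia.
split.
- move=> i L B; have [j Bj h] := rec (a + i) L (a + B).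
  by exists (j - a); [lia|move=> t tL; rewrite !addnA -h // subnKC //; lia].
- move=> n c s us hs; apply: (few n c s us) => x /hs [i [hc ho]].
  by exists (a + i); rewrite -addnA; split; [apply/C | rewrite -ho E].
- move=> n c i; rewrite E => hi l o.
  have [l' [o' [r ne]]] := sev n c _ hi l o; exists l', o'; split=> //.
  have [k ak [hc ho]] := return_type_recurs a rec r.
  exists (k - a); split; last by rewrite E subnKC.
  by apply/C; rewrite addnA subnKC.
Qed.

(** A slack of one letter does not make room for a further long gap. *)
Lemma mul_le_add1 d a b : 1 < d -> d * a <= d * b + 1 -> a <= b.
Proof.
move=> d1 h; rewrite leqNgt; apply/negP => ba.
have : d * b.+1 <= d * a by rewrite leq_mul2l ba orbT.
by rewrite mulnS; lia.
Qed.

(* Consecutive ones are s + 1 or s + d + 1 apart; h marks the long gaps, which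
   are those of index T k - 1 for k > 0. Windows reaching as exactly as possible
   from one long gap to another turn the extremal classes of the sequence of
   differences T (k + 1) - T k into classes of w with the additional return of
   length 1, so that the differences have one return type less. *)
Section TwoGaps.

Variables (w h : nat -> bool) (s d : nat) (pos T : nat -> nat).
Hypothesis hw : two_or_three w.
Hypothesis d_gt1 : 1 < d.
Hypothesis posP : forall q j, (pos q < j) = (q < ones w 0 j).
Hypothesis pos_eq : forall q, pos q = s + d + q * s.+1 + d * ones h 0 q.
Hypothesis TP : forall k q, (T k <= q) = (k <= ones h 0 q).

Let K q := ones h 0 q.

Let T0 : T 0 = 0.
Proof. by apply/eqP; rewrite -leqn0 TP. Qed.

Let KT k : K (T k) = k.
Proof.
have h1 : k <= K (T k) by rewrite -TP.
apply/eqP; rewrite eqn_leq h1 andbT leqNgt; apply/negP => lt.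
case E : (T k) => [|t]; first by move: lt; rewrite E.
have : ~~ (T k <= t) by rewrite E ltnn.
by rewrite TP; move: lt; rewrite E /K onesSr; case: (h t) => /=; lia.
Qed.

Let Tlt k : T k < T k.+1.
Proof. by rewrite ltnNge TP -/(K _) KT ltnn. Qed.

Let Tmono k k' : k <= k' -> T k <= T k'.
Proof. by move=> kk; rewrite TP -/(K _) KT. Qed.

Let P k := pos (T k).

Let PE k : P k = s + d + T k * s.+1 + d * k.
Proof. by rewrite /P pos_eq -/(K _) KT. Qed.

(** The gap that ends at P k is long, being the one of index T k - 1. *)
Let before q k : q < T k -> pos q + s.+1 + d <= P k.
Proof.
move=> qT; have : K q < k by rewrite ltnNge /K -TP -ltnNge.
rewrite PE pos_eq -/(K q) => Kk.
have : d * (K q).+1 <= d * k by rewrite leq_mul2l Kk orbT.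
have : q.+1 * s.+1 <= T k * s.+1 by rewrite leq_mul2r qT orbT.
by rewrite mulSn mulnS; lia.
Qed.

(** The s + d letters before P k are zeros: those of a long gap or, for k = 0, those that open the
    word. *)
Let ones_at k i : P k <= i + s + d -> i <= P k -> ones w 0 i = T k.
Proof.
move=> h1 h2; apply/eqP; rewrite eqn_leq; apply/andP; split.
  by rewrite leqNgt -posP -leqNgt.
case E : (T k) => [|t] //; rewrite -posP.
by have := @before t k; rewrite E ltnSn => /(_ isT); lia.
Qed.

Definition block_consecutive (Q : nat -> Prop) (k k' : nat) : Prop :=
  [/\ k < k', Q k, Q k' & forall t, k < t < k' -> ~ Q t].

(* For e = 0 the class consists of one position per k in Q, for e = 1 of two
   adjacent positions, the letter between which is 0. *)
Let blocks (Q : nat -> Prop) := forall e, e <= 1 -> exists n c a,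
  e <= a <= s + d /\ forall i, ones w i n = c <-> exists2 k, Q k & P k <= i + a <= P k + e.

Let Pgap k k' : k < k' -> P k + s.+1 + d <= P k'.
Proof. by move=> kk; apply: before; apply: leq_trans (Tlt k) (Tmono kk). Qed.

Let blocks_step Q e n c a k k' : e <= 1 -> e <= a <= s + d ->
  (forall i, ones w i n = c <-> exists2 k, Q k & P k <= i + a <= P k + e) ->
  block_consecutive Q k k' ->
  consecutive w n c (P k + e - a) (P k' - a) /\
  ones w (P k + e - a) (P k' - a - (P k + e - a)) = T k' - T k.
Proof.
move=> e1 ha H [kk hk hk' none].
have := Pgap kk; have := PE k => PEk hg.
have hP : s + d <= P k by rewrite PEk; lia.
split.
  split; first by lia.
  - by apply/H; exists k => //; lia.
  - by apply/H; exists k' => //; lia.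
  - move=> i hi /H[t Qt ht]; apply: (none t) => //.
    have t1 : k < t.
      rewrite ltnNge leq_eqVlt; apply/negP => /orP[/eqP tk|tk]; first by subst t; lia.
      by have := Pgap tk; lia.
    have t2 : t < k'.
      rewrite ltnNge leq_eqVlt; apply/negP => /orP[/eqP tk|tk]; first by subst t; lia.
      by have := Pgap tk; lia.
    by rewrite t1.
have le : P k + e - a <= P k' - a by lia.
have := ones_split w le; rewrite (@ones_at k (P k + e - a)) ?(@ones_at k' (P k' - a)); lia.
Qed.

Let blocks_few Q k1 k1' k2 k2' k3 k3' : blocks Q ->
  block_consecutive Q k1 k1' -> block_consecutive Q k2 k2' ->
  block_consecutive Q k3 k3' ->
  [|| (k1' - k1 == k2' - k2) && (T k1' - T k1 == T k2' - T k2),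
      (k1' - k1 == k3' - k3) && (T k1' - T k1 == T k3' - T k3)
    | (k2' - k2 == k3' - k3) && (T k2' - T k2 == T k3' - T k3)].
Proof.
move=> /(_ 1 isT)[n [c [a [ha H]]]] b1 b2 b3.
have [_ few _] := hw.
have r0 : return_type w n c 1 0.
  have [_ Qk _ _] := b1; have hP : s + d <= P k1 by rewrite PE; lia.
  exists (P k1 - a); split.
    apply: consecutiveI => //; try by (apply/H; exists k1 => //; lia).
    by move=> t; lia.
  have := ones_split w (leqnSn (P k1 - a)); rewrite subSnn.
  by rewrite (@ones_at k1 (P k1 - a)) ?(@ones_at k1 (P k1 - a).+1); lia.
have [c1 o1] := @blocks_step Q 1 n c a _ _ isT ha H b1.
have [c2 o2] := @blocks_step Q 1 n c a _ _ isT ha H b2.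
have [c3 o3] := @blocks_step Q 1 n c a _ _ isT ha H b3.
have := four_returns few r0 (return_typeI c1) (return_typeI c2) (return_typeI c3).
rewrite o1 o2 o3.
(* Once the number T k' - T k of ones is known, the length of the return determines k' - k. *)
have G k k' : block_consecutive Q k k' ->
    [/\ P k' - a - (P k + 1 - a) = (T k' - T k) * s.+1 + d * (k' - k) - 1,
        0 < T k' - T k & 0 < d * (k' - k)].
  case=> kk _ _ _; have := Pgap kk; have := PE k; have := PE k'.
  have Tk := Tmono (ltnW kk); rewrite mulnBl mulnBr => -> ->.
  have : T k < T k' by apply: leq_trans (Tlt k) (Tmono kk).
  have : T k * s.+1 <= T k' * s.+1 by rewrite leq_mul2r Tk orbT.
  have : d * k < d * k' by rewrite ltn_mul2l kk andbT; lia.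
  by split; lia.
have D x y : d * x = d * y -> x = y by move=> /eqP; rewrite eqn_mul2l => /orP[/eqP|/eqP //]; lia.
have [-> t1 d1] := G _ _ b1; have [-> t2 d2] := G _ _ b2; have [-> t3 d3] := G _ _ b3.
move: (T k1' - T k1) (T k2' - T k2) (T k3' - T k3) t1 t2 t3 => u1 u2 u3 u1p u2p u3p.
move: (k1' - k1) (k2' - k2) (k3' - k3) d1 d2 d3 => v1 v2 v3 v1p v2p v3p.
have D' x y u v : 0 < d * x -> 0 < d * y ->
    (u * s.+1 + d * x - 1 == v * s.+1 + d * y - 1) && (u == v) -> (x == y) && (u == v).
  move=> hx hy /andP[/eqP e /eqP eu]; rewrite eu eqxx andbT; apply/eqP/D.
  by move: e; rewrite eu; lia.
by case/or4P=> [/andP[_ /eqP]|/andP[_ /eqP]|/andP[_ /eqP]|/or3P[]/D' ee];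
  first [by rewrite ee // ?orbT | poslia].
Qed.

(** For e = 0 the class has one position per element of Q, so a single pair (l, o) for Q would make
    (o * (s + 1) + d * l, o) the single return in w. *)
Let blocks_several Q k B l o : blocks Q -> Q k ->
  exists i j, [/\ B <= i, block_consecutive Q i j & (j - i, T j - T i) <> (l, o)].
Proof.
move=> /(_ 0 isT)[n [c [a [ha H]]]] Qk.
apply: contrapT => no.
have hk : ones w (P k - a) n = c.
  by apply/H; exists k => //; have := PE k; lia.
apply: (@not_single_return w n c _ (P B) (o * s.+1 + d * l) o hw hk) => i j Bi cij.
have [ij /H[k1 Q1 h1] /H[k2 Q2 h2] hn] := cij.
have k12 : k1 < k2.
  by rewrite ltnNge; apply/negP => kk; have := Tmono kk; rewrite leq_eqVlt; 
     move: kk; rewrite leq_eqVlt => /orP[/eqP e|/Pgap]; [subst k2|]; lia.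
have bc : block_consecutive Q k1 k2.
  split=> // t /andP[t1 t2] Qt; apply: (hn (P t - a)).
    by have := Pgap t1; have := Pgap t2; have := PE k1; lia.
  by apply/H; exists t => //; have := PE t; lia.
have B1 : B <= k1.
  by rewrite leqNgt; apply/negP => /Pgap; lia.
have [e1 e2] : k2 - k1 = l /\ T k2 - T k1 = o.
  by apply: contrapT => ne; apply: no; exists k1, k2; split=> // -[? ?]; apply: ne.
have [_] := @blocks_step Q 0 n c a _ _ isT ha H bc.
rewrite !addn0 (_ : P k1 - a = i); last by lia.
rewrite (_ : P k2 - a = j); last by lia.
move=> ->; split=> //; rewrite -e1 -e2.
have Tk := Tmono (ltnW k12).
have : T k1 * s.+1 <= T k2 * s.+1 by rewrite leq_mul2r Tk orbT.
have : d * k1 <= d * k2 by rewrite leq_mul2l (ltnW k12) orbT.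
by rewrite mulnBl mulnBr; have := PE k1; have := PE k2; lia.
Qed.

(** The ones of index T k to T k + M - 1 lie between two long gaps and enclose m - 1 others. As T (k
    + m) - T k never exceeds M, any M successive ones enclose at least m - 1 long gaps, so these
    spans are the shortest. A window with e letters to spare still holds M ones only around such a
    span, because e < d. *)
Let dense m M : 0 < m -> (forall k, T (k + m) <= T k + M) ->
  blocks (fun k => T (k + m) = T k + M).
Proof.
move=> m0 max e e1.
have mM : m <= M.
  have Tm : m <= T m by elim: (m) => // m' IH; have := Tlt m'; poslia.
  by have := max 0; rewrite T0 !add0n; apply: leq_trans.
exists (M.-1 * s.+1 + 1 + d * m.-1 + e), M, e; split; first by lia.
move=> i; split.
  move=> hM; set N := _ + e in hM; pose q := ones w 0 i.
  have hq : ones w 0 (i + N) = q + M by rewrite ones_cat hM.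
  have p1 : i <= pos q by rewrite leqNgt posP ltnn.
  have p2 : pos (q + M.-1) < i + N by rewrite posP hq; lia.
  have Kle : K (q + M.-1) <= K q + m.-1.
    apply: (@mul_le_add1 d) => //; move: p1 p2; rewrite !pos_eq -/(K _) -/(K _) /N mulnDr mulnDl.
    by lia.
  have K1 : T (K q) <= q by rewrite TP.
  have K2 : q + M.-1 < T (K q + m).
    by rewrite ltnNge TP -ltnNge -/(K _); move: Kle m0; clear; lia.
  have K3 := max (K q).
  have eq : T (K q) = q by move: K1 K2 K3 mM m0; clear; lia.
  exists (K q); first by move: K1 K2 K3 mM m0; clear; lia.
  have Kge : K q + m.-1 <= K (q + M.-1).
    have := Tlt (K q + m.-1); rewrite -addnS prednK // -TP.
    by move: K3 mM m0 eq; clear; lia.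
  move: p1 p2; rewrite /P eq !pos_eq -/(K _) -/(K _) /N.
  have : d * (K q + m.-1) <= d * K (q + M.-1) by rewrite leq_mul2l Kge orbT.
  by rewrite mulnDr mulnDl; clear; lia.
case=> k hk /andP[hi1 hi2]; set N := _ + e.
have h1 : ones w 0 i = T k by apply: ones_at; lia.
suff : ones w 0 (i + N) = T k + M by rewrite ones_cat h1 add0n => /addnI.
apply/eqP; rewrite eqn_leq; apply/andP; split.
  rewrite -hk leqNgt -posP -leqNgt -/(P _) PE hk mulnDl mulnDr.
  have := PE k; move: hi1 hi2 e1 d_gt1 mM m0; rewrite /N; case: (M) (m) => [|M'] [|m'] //=.
  by rewrite !mulnS !mulSn; clear; lia.
rewrite -[M in T k + M]prednK ?addnS; last exact: leq_trans m0 mM.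
rewrite -posP.
have Kle : K (T k + M.-1) <= k + m.-1.
  have : T k + M.-1 < T (k + m) by rewrite hk; move: mM m0; clear; lia.
  by rewrite ltnNge TP -ltnNge -/(K _); move: m0; clear; lia.
have : d * K (T k + M.-1) <= d * (k + m.-1) by rewrite leq_mul2l Kle orbT.
rewrite pos_eq -/(K _) mulnDr mulnDl.
by move: hi1 hi2 (PE k) e1; rewrite /N; clear; lia.
Qed.

(** Dual to [dense]: here the M + 1 gaps around M successive ones include at most m + 1 long gaps,
    so the stretches that begin and end with a long gap are the longest ones containing M ones. The
    window is e letters shorter than such a stretch. *)
Let sparse m M : (forall k, T k + M <= T (k + m)) ->
  blocks (fun k => T (k + m) = T k + M).
Proof.
move=> min e e1.
exists (M.+1 * s.+1 + d * m.+1 - 1 - e), M, (s + d); split; first by lia.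
move=> i; split.
  move=> hM; set N := _ - e in hM; pose q := ones w 0 i.
  have hq : ones w 0 (i + N) = q + M by rewrite ones_cat hM.
  have p1 : i + N <= pos (q + M) by rewrite leqNgt posP -hq ltnn.
  have [k [k1 k2 k3]] : exists k, [/\ q <= T k, k + m <= K (q + M) &
      q * s.+1 + d * k <= i].
    (* If q = 0, no one precedes the window, and the zeros that open the word stand in for a long
       gap. *)
    case Eq : q => [|q'].
      exists 0; rewrite T0 add0n muln0 mul0n; split=> //.
      apply: (@mul_le_add1 d) => //; move: p1; rewrite Eq add0n pos_eq -/(K _) /N mulSn mulnS.
      by clear -e1 d_gt1; lia.
    have p0 : pos q' < i by rewrite posP -/q Eq.
    have Kg : K q' + m.+1 <= K (q + M).
      apply: (@mul_le_add1 d) => //; move: p0 p1; rewrite !pos_eq -/(K _) -/(K _) Eq /N.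
      by rewrite !mulnDr mulnDl !mulSn !mulnS; clear -e1 d_gt1; lia.
    exists (K q').+1; split.
    - by rewrite ltnNge TP ltnn.
    - by rewrite -Eq addSnnS.
    - by move: p0; rewrite pos_eq -/(K _) mulSn mulnS; clear; lia.
  have K2 : T (k + m) <= q + M by rewrite TP.
  have K3 := min k.
  have eq : T k = q by move: k1 K2 K3; clear; lia.
  exists k; first by move: k1 K2 K3; clear; lia.
  have Kle : K (q + M) <= k + m.
    rewrite leqNgt; apply/negP; rewrite -TP => lt.
    by have := Tlt (k + m); move: lt K3 eq; rewrite -addnS; clear; lia.
  have KE : K (q + M) = k + m by apply/eqP; rewrite eqn_leq Kle.
  move: k3 p1; rewrite pos_eq -/(K _) KE PE -eq /N.
  rewrite mulnDl mulnDr mulSn mulnS; clear -e1 d_gt1; lia.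
case=> k hk /andP[hi1 hi2]; set N := _ - e.
have h1 : ones w 0 i = T k by apply: ones_at; lia.
have eiN : i + N + (s + d) = i + (s + d) + (M * s.+1 + d * m + s + d - e).
  by rewrite /N mulSn mulnS; move: e1 d_gt1; clear; lia.
have Pkm : P (k + m) = P k + M * s.+1 + d * m.
  by rewrite !PE hk mulnDl mulnDr; clear; lia.
suff : ones w 0 (i + N) = T k + M by rewrite ones_cat h1 add0n => /addnI.
apply/eqP; rewrite eqn_leq; apply/andP; split.
  rewrite -hk leqNgt -posP -leqNgt -/(P _) Pkm.
  by move: eiN hi2 e1 d_gt1; clear; lia.
case E : (T k + M) => [|q] //; rewrite -posP.
have := @before q (k + m); rewrite hk E ltnSn Pkm => /(_ isT).
by move: eiN hi1 e1 d_gt1; clear; lia.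
Qed.

Lemma run_lengths_few m M k1 k1' k2 k2' k3 k3' :
  (0 < m /\ forall k, T (k + m) <= T k + M) \/ (forall k, T k + M <= T (k + m)) ->
  let Q k := T (k + m) = T k + M in
  block_consecutive Q k1 k1' -> block_consecutive Q k2 k2' ->
  block_consecutive Q k3 k3' ->
  [|| (k1' - k1 == k2' - k2) && (T k1' - T k1 == T k2' - T k2),
      (k1' - k1 == k3' - k3) && (T k1' - T k1 == T k3' - T k3)
    | (k2' - k2 == k3' - k3) && (T k2' - T k2 == T k3' - T k3)].
Proof. by case=> [[m0 /(dense m0)]|/sparse] hb Q; apply: blocks_few. Qed.

Lemma run_lengths_several m M k B l o :
  (0 < m /\ forall k, T (k + m) <= T k + M) \/ (forall k, T k + M <= T (k + m)) ->
  let Q k := T (k + m) = T k + M in Q k ->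
  exists i j, [/\ B <= i, block_consecutive Q i j & (j - i, T j - T i) <> (l, o)].
Proof. by case=> [[m0 /(dense m0)]|/sparse] hb Q; apply: blocks_several. Qed.

(** With m = 0 every k is in Q, so the differences x k take exactly two values, which v records. By
    [Tv] the sum of m differences is affine in the number of ones of v, so extremal sums are
    extremal classes of v, to which [two_extremal_returns_absurd] applies. *)
Lemma two_gaps_absurd : False.
Proof.
have ext0 : (0 < 0 /\ forall k, T (k + 0) <= T k + 0) \/ (forall k, T k + 0 <= T (k + 0)).
  by right=> k; rewrite !addn0.
have bc k : block_consecutive (fun k => T (k + 0) = T k + 0) k k.+1.
  by split; rewrite ?addn0 // => t; lia.
have Q0 k : T (k + 0) = T k + 0 by rewrite !addn0.
pose x k := T k.+1 - T k.
have E k k' : block_consecutive (fun k => T (k + 0) = T k + 0) k k' -> k' = k.+1.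
  move=> [kk _ _ hn]; apply/eqP; rewrite eqn_leq kk andbT leqNgt; apply/negP => lt.
  by apply: (hn k.+1); rewrite ?addn0 // leqnn.
have other B a : exists2 k, B <= k & x k <> a.
  have [i [j [Bi b ne]]] := @run_lengths_several 0 0 0 B 1 a ext0 (Q0 0).
  exists i => // xi; apply: ne; rewrite (E _ _ b) subSnn; congr (_, _); exact: xi.
have few2 a b c : [|| x a == x b, x a == x c | x b == x c].
  have := @run_lengths_few 0 0 _ _ _ _ _ _ ext0 (bc a) (bc b) (bc c).
  by rewrite !subSnn.
have [k0 _ ne0] := other 0 (x 0).
wlog [ka [kb [lt hx]]] : / exists ka, exists kb, x ka < x kb /\ forall k, x k = x ka \/ x k = x kb.
  apply; case: (ltngtP (x 0) (x k0)) => [lt|lt|e]; last by case: ne0.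
    exists 0, k0; split=> // k.
    by have := few2 0 k0 k; case/or3P=> /eqP e; [case: ne0|left|right].
  exists k0, 0; split=> // k.
  by have := few2 0 k0 k; case/or3P=> /eqP e; [case: ne0|right|left].
pose v k := x k == x kb.
pose g := x kb - x ka.
have Tv k m : T (k + m) = T k + m * x ka + g * ones v k m.
  elim: m => [|m IH]; first by rewrite addn0 muln0 mul0n !addn0.
  have Tx : T (k + m).+1 = T (k + m) + x (k + m) by rewrite /x subnKC // ltnW.
  rewrite addnS Tx IH onesSr mulSn mulnDr; have := hx (k + m).
  rewrite /v; case: eqP => [->|ne] [e|e] //=; rewrite ?e /g; lia.
have g0 : 0 < g by rewrite subn_gt0.
have Qv m c k : (T (k + m) = T k + (m * x ka + g * c)) <-> ones v k m = c.
  rewrite Tv -addnA; split=> [/addnI/addnI/eqP|->] //.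
  by rewrite eqn_mul2l eqn0Ngt g0 => /eqP.
have bcv m c i j : block_consecutive (fun k => T (k + m) = T k + (m * x ka + g * c)) i j <->
    consecutive v m c i j.
  split=> -[ij hi hj hn]; split=> //; try exact/Qv.
    by move=> k /hn ne /Qv.
  by move=> k /hn ne /Qv.
apply: (@two_extremal_returns_absurd v).
- move=> m c m0 ext.
  have ext' : (0 < m /\ forall k, T (k + m) <= T k + (m * x ka + g * c)) \/
      (forall k, T k + (m * x ka + g * c) <= T (k + m)).
    by case: ext => ext; [left; split=> //|right] => k;
      rewrite Tv -addnA !leq_add2l leq_mul2l ext orbT.
  have TT i l : T (i + l) - T i = l * x ka + g * ones v i l by rewrite Tv -addnA addKn.
  split.
    move=> l1 o1 l2 o2 l3 o3 [i1 [/bcv b1 <-]] [i2 [/bcv b2 <-]] [i3 [/bcv b3 <-]].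
    have := run_lengths_few ext' b1 b2 b3; rewrite !addKn !TT.
    have D l l' a b : (l == l') && (l * x ka + g * a == l' * x ka + g * b) -> (l == l') && (a == b).
      by move=> /andP[/eqP ->]; rewrite eqxx eqn_add2l eqn_mul2l eqn0Ngt g0.
    by case/or3P=> /D ->; rewrite ?orbT.
  move=> i B l o hi.
  have [i' [j [Bi /bcv b ne]]] := run_lengths_several B l (l * x ka + g * o) ext' (proj2 (Qv m c i) hi).
  exists i', j; split=> // -[e1 e2]; apply: ne; congr (_, _) => //.
  have [ij _ _ _] := b; have := TT i' (j - i'); rewrite subnKC ?(ltnW ij) // => ->.
  by rewrite e1 in e2 *; rewrite e2.
- by move=> B; have [k Bk ne] := other B (x ka); exists k => //; rewrite /v; case: (hx k) => [/ne|->].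
- by move=> B; have [k Bk ne] := other B (x kb); exists k; rewrite // /v; apply/eqP.
Qed.

End TwoGaps.

Lemma gap_lengths_absurd w s d : two_or_three w -> 1 < d ->
  (forall i, w i -> consecutive w 1 1 i (i + s.+1) \/ consecutive w 1 1 i (i + (s + d).+1)) ->
  (exists i, consecutive w 1 1 i (i + (s + d).+1)) -> False.
Proof.
move=> hw0 d1 gap0 [i2 c2].
have [rec0 _ _] := hw0.
(* Starting just after a one that opens a long gap makes u begin with exactly s + d zeros, as
   [pos_eq] demands. *)
pose u i := w (i2.+1 + i).
have hw : two_or_three u by apply: two_or_three_shift.
have E i n : ones u i n = ones w (i2.+1 + i) n.
  by apply: eq_ones => t _; rewrite /u addnA.
have C i j : consecutive w 1 1 (i2.+1 + i) (i2.+1 + j) -> consecutive u 1 1 i j.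
  by rewrite !consecutive_letterP ltn_add2l => -[ij hi hj h]; split=> // k hk; apply: h; lia.
have gap i : u i -> consecutive u 1 1 i (i + s.+1) \/ consecutive u 1 1 i (i + (s + d).+1).
  by move=> /gap0; rewrite -!addnA => -[/C|/C]; [left|right].
have inf_long B : exists2 i, B <= i & consecutive u 1 1 i (i + (s + d).+1).
  have [j Bj h] := rec0 i2 ((s + d).+1 + 1) (i2.+1 + B).
  exists (j - i2.+1); first by lia.
  by apply: C; rewrite addnA subnKC; [apply: consecutive_copy c2 | lia].
have inf1 B : exists2 i, B <= i & u i.
  by have [i Bi /consecutive_letterP[_ ui _ _]] := inf_long B; exists i.
have [pos posP] := nth_one inf1.
have pos0 : pos 0 = s + d.
  have /consecutive_letterP[_ _ h1 h0] := c2.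
  apply/eqP; rewrite eqn_leq -ltnS posP onesSr /u addSnnS h1 addn1 /= leqNgt posP.
  rewrite (proj2 (ones0P _ _ _)) // => t ht.
  by apply: h0; lia.
pose h q := pos q.+1 != pos q + s.+1.
have cpos q : consecutive u 1 1 (pos q) (pos q.+1).
  have [_ h1 h2 h3] := nth_oneP posP q; have [_ h4 _ _] := nth_oneP posP q.+1.
  exact/consecutive_letterP.
have pos_eq q : pos q = s + d + q * s.+1 + d * ones h 0 q.
  elim: q => [|q IH]; first by rewrite pos0 mul0n muln0 !addn0.
  have [_ h1 _ _] := nth_oneP posP q.
  rewrite onesSr add0n mulSn mulnDr; case: (gap _ h1) => /(consecutive_inj (cpos q)) e.
    have -> : h q = false by rewrite /h e eqxx.
    by rewrite e muln0 IH; poslia.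
  have -> : h q by rewrite /h e eqn_add2l; poslia.
  by rewrite e muln1 IH; poslia.
have inf_h B : exists2 i, B <= i & h i.
  have [i Bi ci] := inf_long (pos B).
  have /consecutive_letterP[_ ui _ _] := ci.
  have ei : pos (ones u 0 i) = i.
    by apply/eqP; rewrite eqn_leq -ltnS posP onesSr ui addn1 ltnSn leqNgt posP ltnn.
  exists (ones u 0 i).
    by have [<- _ _ _] := nth_oneP posP B; apply: ones_mono.
  move: ci; rewrite -{1 2}ei => /(consecutive_inj (cpos _)) e.
  by rewrite /h e eqn_add2l; poslia.
have [T' T'P] := nth_one inf_h.
(* The successor passes from the index of a long gap to the index of the one that closes it. *)
pose T k := if k is k'.+1 then (T' k').+1 else 0.
apply: (@two_gaps_absurd u h s d pos T) => //.
by case=> [|k] q //=.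
Qed.

(** * Balance: run lengths *)

Definition run_gap (w : nat -> bool) (l : nat) : Prop :=
  exists i, consecutive w 1 1 i (i + l).

Lemma run_gap_return w l : run_gap w l -> return_type w 1 1 l 1.
Proof.
by move=> [i c]; exists i; split=> //; have := consecutive_letter_ones c; rewrite addKn.
Qed.

Lemma run_gap_recurs w l B : uniformly_recurring w -> run_gap w l ->
  exists2 i, B <= i & consecutive w 1 1 i (i + l).
Proof.
by move=> rec /run_gap_return /(return_type_recurs B rec) [i Bi [c _]]; exists i.
Qed.

Lemma run_gapP w i l : consecutive w 1 1 i (i + l) <->
  [/\ 0 < l, w i, w (i + l) & forall k, 0 < k < l -> w (i + k) = false].
Proof.
rewrite consecutive_letterP; split=> -[l0 hi hj h]; split=> //; try by poslia.
  by move=> k hk; apply: h; poslia.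
by move=> k hk; rewrite -(@subnKC i k); [apply: h|]; poslia.
Qed.

Lemma run_gap2 w l : run_gap w l.+2 -> return_type w 2 1 l.+1 1.
Proof.
move=> [i /run_gapP[_ wi wj h]]; exists i.
have h1 : w i.+1 = false by rewrite -addn1 h.
have hl : w (i + l.+1) = false by apply: h; poslia.
split; last first.
  by rewrite onesS wi (proj2 (ones0P _ _ _)) // => t tl; rewrite addSnnS h //; poslia.
apply: consecutiveI => //.
- by rewrite /= wi h1.
- by rewrite /= hl -addnS wj.
- by move=> k hk; rewrite /= -addnS !h //; poslia.
Qed.

Lemma run_gap2_neg w l : run_gap (negw w) l.+2 -> return_type w 2 1 l.+1 l.
Proof.
by move=> /run_gap2 r; have := return_type_negw (isT : 1 <= 2) (ltn0Sn l) r; rewrite !subn1.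
Qed.

(* Witnessed by 0 1^R 0. *)
Lemma ones_run_return w R : 1 < R -> run_gap (negw w) R.+1 ->
  return_type w 3 2 R.-1 R.-2.
Proof.
move=> R1 [i /run_gapP[_ wi wj h]]; exists i.
have {}wi : w i = false by exact: negbTE.
have {}wj : w (i + R.+1) = false by exact: negbTE.
have {}h k : 0 < k < R.+1 -> w (i + k) by move=> /h/negbFE.
case: R R1 wj h => [|[|R]] // _ wj h.
change (consecutive w 3 2 i (i + R.+1) /\ ones w i R.+1 = R).
split; last first.
  rewrite onesS wi (proj2 (ones_fullP _ _ _)) // => t tl; rewrite addSnnS h //; poslia.
have E k : k < R.+2 -> ones w (i + k) 3 = w (i + k) + 1 + w (i + k.+2).
  by move=> kR; rewrite /= -!addnS (h k.+1) ?addn0 ?addnA //; poslia.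
apply: consecutiveI => //.
- by rewrite -[i in ones w i]addn0 E // addn0 wi h.
- by rewrite E // wj h //; poslia.
- by move=> k hk; rewrite E ?h //; poslia.
Qed.

(* Witnessed by 1 1 0^R 1 1. *)
Lemma zeros_run_return w R i : 1 < R -> consecutive w 1 1 i.+1 (i.+1 + R.+1) ->
  w i -> w (i.+1 + R.+2) -> return_type w 3 2 R.+1 2.
Proof.
move=> R1 /run_gapP[_ wi wj h] w0 w1; exists i.
have hz k : 1 < k < R.+2 -> w (i + k) = false.
  by case: k => // k hk; rewrite -addSnnS h; poslia.
rewrite addSnnS in wj; rewrite addSnnS in w1.
have E k : ones w (i + k) 3 = w (i + k) + w (i + k.+1) + w (i + k.+2).
  by rewrite /= -!addnS addn0 addnA.
split; last first.
  have -> : R.+1 = R.-1.+2 by poslia.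
  rewrite !onesS w0 wi (proj2 (ones0P _ _ _)) // => t tl.
  by rewrite -[i.+2]addn2 -addnA hz //; poslia.
apply: consecutiveI => //.
- by rewrite -[i in ones w i]addn0 E addn0 addn1 w0 wi hz //; poslia.
- by rewrite E wj w1 hz //; poslia.
- move=> k hk; rewrite E; have [ek|nk] := eqVneq k 1.
    by rewrite ek addn1 wi !hz //; poslia.
  by rewrite (hz k) 1?(hz k.+1); [case: (w _) | poslia | poslia].
Qed.

(** A run of a zeros is a gap of a + 1; the gap 1 between adjacent ones is the empty run and is
    always allowed. *)
Definition zero_runs_in (w : nat -> bool) (a b : nat) : Prop :=
  [/\ run_gap w a.+1, run_gap w b.+1 &
      forall i l, consecutive w 1 1 i (i + l) -> [|| l == 1, l == a.+1 | l == b.+1]].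

Lemma zero_runs_inC w a b : zero_runs_in w a b -> zero_runs_in w b a.
Proof. by move=> [ha hb h]; split=> // i l /h /or3P[] ->; rewrite ?orbT. Qed.

Lemma zeros_gap w j L : uniformly_recurring w -> (exists i, w i) ->
  (forall t, t < L -> w (j + t) = false) -> exists2 l, L < l & run_gap w l.
Proof.
move=> rec [i0 wi0] hj.
have [i1 _ h1] := rec i0 1 0; have {h1} wi1 : w i1 by have := h1 0 isT; rewrite !addn0 wi0.
have [k ik hk] := rec j L i1.+1.
have [k' kk' hk'] := rec i0 1 (k + L); have {hk'} wk' : w k' by have := hk' 0 isT; rewrite !addn0 wi0.
have [|q [iq wq hq]] := last_one wi1 (_ : i1 < k); first by poslia.
have [|||r rk c] := @consecutive_exists w 1 1 q k'.
- by rewrite ones1 wq.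
- by poslia.
- by rewrite ones1 wk'.
have := c => /consecutive_letterP[qr _ wr _].
exists (r - q); last by exists q; rewrite subnKC // ltnW.
have rk2 : k + L <= r.
  rewrite leqNgt; apply/negP => lt.
  have [lt2|ge2] := ltnP r k; first by rewrite hq // in wr; poslia.
  by have := hk (r - k); rewrite subnKC // wr hj; poslia.
by poslia.
Qed.

(** Besides (1, 0), the class of 01 and 10 has a return (g - 1, 1) for each gap g, so s + 1 and l0
    are the only gaps; they differ by more than one. *)
Lemma isolated_ones_absurd w s : two_or_three w ->
  (forall i, w i -> w i.+1 = false) -> 0 < s -> run_gap w s.+1 ->
  (forall i l, consecutive w 1 1 i (i + l) -> s < l) ->
  (exists2 l, s.+2 < l & run_gap w l) -> False.
Proof.
move=> hw iso s0 gs min [l0 sl0 gl].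
have [rec few _] := hw.
have r0 : return_type w 2 1 1 0.
  have [[//|i] _ /run_gapP[_ wi _ _]] := run_gap_recurs 1 rec gs.
  have w0 : w i = false by apply: contraTF wi => /iso ->.
  exists i; split; last by rewrite ones1 w0.
  by apply: consecutiveI => //; rewrite ?addn1 /= ?(iso _ wi) ?w0 ?wi // => k; poslia.
have R l : 1 < l -> run_gap w l -> return_type w 2 1 l.-1 1.
  by case: l => [|[|l]] // _; apply: run_gap2.
apply: (@gap_lengths_absurd w s (l0 - s.+1)) => //; first by poslia.
- move=> i wi.
  have [j ij wj] : exists2 j, i < j & w j.
    by have [j ? /run_gapP[_ ? _ _]] := run_gap_recurs i.+1 rec gs; exists j.
  have [|||k _ c] := @consecutive_exists w 1 1 i j; rewrite ?ones1 ?wi ?wj //.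
  have [ik _ _ _] := c; move: c; rewrite -(subnKC (ltnW ik)) => c.
  have sl := min _ _ c.
  have g : run_gap w (k - i) by exists i.
  have := four_returns few r0 (R _ _ g) (R _ _ gs) (R _ _ gl).
  rewrite /= !andbT andbF /= => H.
  have {H} : (k - i == s.+1) || (k - i == l0) by move: H; poslia.
  have e0 : (s + (l0 - s.+1)).+1 = l0 by poslia.
  by case/orP=> /eqP e; rewrite e in c; [left | right; rewrite e0].
- have [i c] := gl; exists i.
  by rewrite (_ : (s + _).+1 = l0) //; poslia.
Qed.

(** Gaps are the lengths of the returns to the letter 1, so there are at most three of them. The
    gaps 1 and l0 cannot be all, since [gap_lengths_absurd] with s = 0 excludes this. *)
Lemma two_zero_runs w l0 : two_or_three w -> run_gap w 1 -> 2 < l0 -> run_gap w l0 ->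
  exists a b, [/\ 0 < a, 0 < b, a != b & zero_runs_in w a b].
Proof.
move=> hw g1 l0gt g0; have [rec few _] := hw.
have [one|] := pselect (forall i l, consecutive w 1 1 i (i + l) -> l = 1 \/ l = l0).
  case: (@gap_lengths_absurd w 0 l0.-1 hw); first by poslia.
    move=> i wi.
    have [j ij wj] : exists2 j, i < j & w j.
      by have [j ? /run_gapP[_ ? _ _]] := run_gap_recurs i.+1 rec g1; exists j.
    have [|||k _ c] := @consecutive_exists w 1 1 i j; rewrite ?ones1 ?wi ?wj //.
    have [ik _ _ _] := c; move: c; rewrite -(subnKC (ltnW ik)) => c.
    rewrite add0n prednK; last by poslia.
    by case: (one _ _ c) => e; rewrite e in c; [left | right].
  by have [i c] := g0; exists i; rewrite add0n prednK //; poslia.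
move=> /existsNP[i /existsNP[l /not_implyP[c /not_orP[l1 l2]]]].
have l0' : 0 < l by have [? _ _ _] := c; poslia.
exists l0.-1, l.-1; split; try by poslia.
split; rewrite ?prednK //; try by poslia.
  by exists i.
move=> j k ck.
have [->//|k1] := eqVneq k 1.
have gl : run_gap w l by exists i.
have gk : run_gap w k by exists j.
have := four_returns few (run_gap_return g1) (run_gap_return g0) (run_gap_return gl) (run_gap_return gk).
by rewrite !andbT; poslia.
Qed.

(** In the class of windows of length 3 with two ones, the runs of ones give (1, 0) and (x - 1, x -
    2), the run of two zeros gives (3, 2), and the run of y zeros gives (1, 1) or (y + 1, 2). A
    coincidence is forced and only x = 4 permits it. All runs of ones have length at least 2, so 11
    stands on both sides of every zero run. *)
Lemma long_ones_run w x y : two_or_three w -> 2 < x -> 0 < y -> y != 2 ->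
  zero_runs_in (negw w) 2 x -> run_gap w 3 -> run_gap w y.+1 -> x = 4.
Proof.
move=> hw x2 y0 y2 [g2 gx runs] h2 hy; have [rec few _] := hw.
have r1 := ones_run_return (isT : 1 < 2) g2.
have r2 := ones_run_return (ltnW x2) gx.
have noiso i : negw w i -> w i.+1 -> negw w i.+2 -> False.
  move=> n0 w1 n2; have : consecutive (negw w) 1 1 i (i + 2).
    apply/run_gapP; rewrite addn2; split=> // -[|[|k]] //= _.
    by rewrite addn1 /negw w1.
  by move=> /runs /=; poslia.
have nb l : 0 < l -> run_gap w l.+1 -> exists i,
    [/\ consecutive w 1 1 i.+1 (i.+1 + l.+1), w i & w (i.+1 + l.+2)].
  move=> l0 /(run_gap_recurs 1 rec) [[//|i] _ c]; exists i.
  have /run_gapP[_ wi wj h] := c.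
  split=> //.
    apply: contraT => n0; case: (noiso i) => //.
    by rewrite /negw -[i.+2]addn1 h.
  apply: contraT => n0; case: (noiso (i.+1 + l)); rewrite -?addnS //.
  by rewrite /negw h // l0 /=.
have [i [ci wi wj]] := nb 2 isT h2.
have r3 := zeros_run_return (isT : 1 < 2) ci wi wj.
have [k [ck wk wk']] := nb y y0 hy.
have [ey|ny] := eqVneq y 1.
  have r4 : return_type w 3 2 1 1.
    have /run_gapP[_ w1 w3 h] := ck; rewrite ey in w3 h.
    have w2 : w k.+2 = false by rewrite -[k.+2]addn1 h.
    have {}w3 : w k.+3 by rewrite -[k.+3]addn2.
    exists k; split; last by rewrite ones1 wk.
    by apply: consecutiveI; rewrite ?addn1 //= ?wk ?w1 ?w2 ?w3 // => t; poslia.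
  by have := four_returns few r1 r2 r3 r4; poslia.
have r4 := zeros_run_return (_ : 1 < y) ck wk wk'.
by have := four_returns few r1 r2 r3 (r4 _); poslia.
Qed.

(** * Balance: merging double runs *)

Lemma euclid_inj e p q x y : x < e -> y < e -> e * p + x = e * q + y -> p = q /\ x = y.
Proof.
move=> xe ye h; case: (ltngtP p q) => pq; last by subst q; split=> //; lia.
- have : e * p.+1 <= e * q by rewrite leq_mul2l pq orbT.
  by rewrite mulnS; lia.
- have : e * q.+1 <= e * p by rewrite leq_mul2l pq orbT.
  by rewrite mulnS; lia.
Qed.

(* Cuts w, from position a + 1 on, into blocks 0^c and 1^e. *)
Fixpoint block_start (w : nat -> bool) (c e a i : nat) : nat :=
  if i is i'.+1 then
    let j := block_start w c e a i' in j + (if w j then e else c)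
  else a.+1.

Section Halving.

Variables (w : nat -> bool) (c e : nat).
Hypothesis hw : two_or_three w.
Hypotheses (c_gt0 : 0 < c) (e_gt0 : 0 < e).
Hypothesis runs0 : zero_runs_in w c c.*2.
Hypothesis runs1 : zero_runs_in (negw w) e e.*2.

Let len (b : bool) := if b then e else c.

Let len_gt0 b : 0 < len b.
Proof. by case: b. Qed.

Let block (j : nat) (k : nat) :=
  (forall t, t < k -> w (j + t) = w j) /\ w (j + k) = ~~ w j.

(** What is left of the run at j consists of one or two whole blocks. *)
Let aligned j := block j (len (w j)) \/ block j (len (w j)).*2.

Let run_aux (u : nat -> bool) x y i : uniformly_recurring u -> 0 < x -> 0 < y ->
  zero_runs_in u x y -> u i -> u i.+1 = false ->
  exists k, [/\ k = x \/ k = y, forall t, t < k -> u (i.+1 + t) = false & u (i.+1 + k)].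
Proof.
move=> rec x0 y0 [gx _ gaps] ui ui1.
have [j ij /run_gapP[_ uj _ _]] := run_gap_recurs i.+1 rec gx.
have [|||k' _ ck] := @consecutive_exists u 1 1 i j; rewrite ?ones1 ?ui ?uj //.
have [ik _ _ _] := ck; move: ck; rewrite -(subnKC (ltnW ik)); set l := k' - i => ck.
have := gaps _ _ ck; have /run_gapP[l0 _ ul h] := ck.
have [l1|_] := eqVneq l 1; first by move: ul; rewrite l1 addn1 ui1.
move=> /= hl; exists l.-1; split.
- by case/orP: hl => /eqP ->; [left|right].
- by move=> t tl; rewrite addSnnS h //; poslia.
- by rewrite addSnnS prednK.
Qed.

Let run_start j : w j.+1 = ~~ w j -> aligned j.+1.
Proof.
have [rec _ _] := hw; have [rec' _ _] := two_or_three_negw hw.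
case E : (w j) => /= w1.
- have [||k [hk h1 h2]] := run_aux rec _ _ runs0 E w1; rewrite ?double_gt0 //.
  rewrite /aligned w1 /=; have B : block j.+1 k.
    by rewrite /block w1 h2; split=> // t /h1.
  by case: hk => <-; [left|right].
- have [||||k [hk h1 h2]] := run_aux rec' _ _ runs1 (_ : negw w j) _; rewrite ?double_gt0 //.
  + by rewrite /negw E.
  + by rewrite /negw w1.
  rewrite /aligned w1 /=; have B : block j.+1 k.
    by rewrite /block w1; split=> [t /h1 /negbFE ->//|]; apply: negbTE.
  by case: hk => <-; [left|right].
Qed.

Variable a : nat.
Hypothesis ha : w a.+1 = ~~ w a.

Let mu i := block_start w c e a i.
Let v i := w (mu i).

Let muS i : mu i.+1 = mu i + len (v i).
Proof. by []. Qed.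

Let mu_aligned i : aligned (mu i).
Proof.
elim: i => [|i [[h1 h2]|[h1 h2]]]; rewrite ?muS /v; first exact: run_start.
- rewrite -(prednK (len_gt0 (w (mu i)))) addnS; apply: run_start.
  by rewrite -addnS prednK // h2 h1 // prednK.
- have E : w (mu i + len (w (mu i))) = w (mu i).
    by apply: h1; rewrite -addnn -addn1 leq_add2l.
  left; rewrite /block E; split=> [t tl|].
    by rewrite -addnA h1 // -addnn ltn_add2l.
  by rewrite -addnA addnn h2.
Qed.

Let mu_const i t : t < len (v i) -> w (mu i + t) = v i.
Proof.
by move=> tl; have [[h _]|[h _]] := mu_aligned i; apply: h; rewrite // -/(v i); lia.
Qed.

Let size_of i n := c * ones (negw v) i n + e * ones v i n.

Let mu_add i n : mu (i + n) = mu i + size_of i n.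
Proof.
elim: n => [|n IH]; first by rewrite /size_of /= !muln0 !addn0.
rewrite addnS muS IH /size_of !onesSr /negw !mulnDr.
by case: (v (i + n)); rewrite /= ?muln1 ?muln0; lia.
Qed.

Let ones_block i r : r <= len (v i) -> ones w (mu i) r = r * v i.
Proof.
move=> rl; case E : (v i); rewrite ?muln1 ?muln0.
  by apply/ones_fullP => t tr; rewrite (mu_const (leq_trans tr rl)).
by apply/ones0P => t tr; rewrite (mu_const (leq_trans tr rl)).
Qed.

Let ones_mu i n : ones w (mu i) (size_of i n) = e * ones v i n.
Proof.
elim: n => [|n IH]; first by rewrite /size_of /= !muln0.
have -> : size_of i n.+1 = size_of i n + len (v (i + n)).
  by rewrite /size_of !onesSr /negw !mulnDr; case: (v (i + n)); rewrite /= ?muln1 ?muln0; lia.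
rewrite ones_cat IH -mu_add ones_block // onesSr mulnDr.
by case: (v (i + n)); rewrite /= ?muln1 ?muln0.
Qed.

Let mu_mono i j : i <= j -> mu i <= mu j.
Proof. by move=> ij; rewrite -(subnKC ij) mu_add leq_addr. Qed.

Let mu_lt i j : i < j -> mu i < mu j.
Proof. by move=> ij; apply: leq_trans (mu_mono ij); rewrite muS -addn1 leq_add2l. Qed.

Let mu_cover j : mu 0 <= j -> exists t r, j = mu t + r /\ r < len (v t).
Proof.
elim: j => [|j IH] // ; rewrite leq_eqVlt ltnS => /orP[/eqP <-|/IH[t [r [-> rl]]]].
  by exists 0, 0; rewrite addn0; split.
have [lt|ge] := ltnP r.+1 (len (v t)); first by exists t, r.+1; rewrite addnS.
by exists t.+1, 0; rewrite muS addn0 -addnS; split=> //; congr (_ + _); lia.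
Qed.

Let class_iff n k t : k <= n -> ones v t n = k ->
  ones w (mu t) (c * (n - k) + e * k) = e * k /\ mu t + (c * (n - k) + e * k) = mu (t + n).
Proof.
move=> kn h; have E : size_of t n = c * (n - k) + e * k.
  by rewrite /size_of h -{1}(addnK k (ones _ t n)) -{1}h ones_negw.
by rewrite mu_add -E ones_mu h; split.
Qed.

(** Counting ones modulo e and zeros modulo c shows that a window starting r letters into block t
    ends r letters into block t + n, and that the two blocks carry the same letter if r > 0.
    Replacing block t by block t + n then keeps the class in v. *)
Let class_only n k t r : k <= n -> r < len (v t) ->
  ones w (mu t + r) (c * (n - k) + e * k) = e * k ->
  ones v t n = k /\ (0 < r -> ones v t.+1 n = k).
Proof.
move=> kn rl; set N := _ + e * k => h.
have [|t' [r' [E' rl']]] := @mu_cover (mu t + r + N).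
  by rewrite -addnA; apply: leq_trans (leq_addr _ _); apply: mu_mono.
have tt : t <= t'.
  by rewrite leqNgt; apply/negP => /mu_mono; rewrite muS; lia.
move: E' rl'; rewrite -(subnKC tt); set m := t' - t; rewrite mu_add => E' rl'.
have EN : size_of t m + r' = r + N by lia.
have o1 : e * ones v t m + r' * v (t + m) = r * v t + e * k.
  rewrite -h -(ones_block (ltnW rl)) -ones_cat -EN ones_cat ones_mu -mu_add.
  by rewrite ones_block // ltnW.
have zo := ones_negw v t m.
have o0 : c * ones (negw v) t m + r' * ~~ v (t + m) = r * ~~ v t + c * (n - k).
  by move: EN o1; rewrite /size_of /N; case: (v t); case: (v (t + m)); rewrite /= ?muln1 ?muln0; lia.
have [ek r1] : ones v t m = k /\ r' * v (t + m) = r * v t.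
  apply: (@euclid_inj e); rewrite ?o1; try by lia.
    by move: rl'; case: (v (t + m)); rewrite /= ?muln1 ?muln0.
  by move: rl; case: (v t); rewrite /= ?muln1 ?muln0.
have [zk r0] : ones (negw v) t m = n - k /\ r' * ~~ v (t + m) = r * ~~ v t.
  apply: (@euclid_inj c); rewrite ?o0; try by lia.
    by move: rl'; case: (v (t + m)); rewrite /= ?muln1 ?muln0.
  by move: rl; case: (v t); rewrite /= ?muln1 ?muln0.
have mn : m = n by lia.
rewrite -mn; split=> // rgt.
have := ones_slide v t m; rewrite ek.
by move: r0 r1; case: (v t); case: (v (t + m)); rewrite /= ?muln1 ?muln0; lia.
Qed.

(** The return of w that comes from a return of v. If t and t + 1 are both in the class, the window
    of w may already slide by one letter inside the block, so length 1 stays 1. *)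
Let stretch (x : nat * nat) := if x.1 == 1 then x else (c * (x.1 - x.2) + e * x.2, e * x.2).

Let stretch_inj x y : 0 < x.1 -> x.2 <= x.1 -> 0 < y.1 -> y.2 <= y.1 ->
  stretch x = stretch y -> x = y.
Proof.
case: x y => [l o] [l' o'] /= l0 ol l0' ol'; rewrite /stretch /=.
have big k m : m <= k -> k != 1 -> 0 < k -> 1 < c * (k - m) + e * m.
  move=> mk k1 k0; have h1 : k - m <= c * (k - m) by rewrite leq_pmull.
  have h2 : m <= e * m by rewrite leq_pmull.
  by lia.
case: (eqVneq l 1) => l1; case: (eqVneq l' 1) => l1' // [e1 e2].
- by have := big l' o' ol' l1' l0'; rewrite -e1; poslia.
- by have := big l o ol l1 l0; rewrite e1; poslia.
have eo : o = o' by move/eqP: e2; rewrite eqn_mul2l eqn0Ngt e_gt0 => /eqP.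
move: e1; rewrite eo => /addIn/eqP; rewrite eqn_mul2l eqn0Ngt c_gt0 => /eqP eq.
by congr (_, _); lia.
Qed.

Let step_return n k i j : k <= n -> consecutive v n k i j -> i.+1 < j ->
  consecutive w (c * (n - k) + e * k) (e * k) (mu i) (mu j).
Proof.
move=> kn [ij hi hj h] ij1; split.
- exact: mu_lt.
- by have [] := class_iff kn hi.
- by have [] := class_iff kn hj.
move=> p /andP[p1 p2]; have [|t [r [ep rl]]] := @mu_cover p.
  by apply: leq_trans (ltnW p1); apply: mu_mono.
rewrite ep => /(class_only kn rl)[h1 h2].
have it : i <= t by rewrite leqNgt; apply/negP => /mu_mono; rewrite muS; lia.
have tj : t < j by rewrite ltnNge; apply/negP => /mu_mono; lia.
have [eit|ne] := eqVneq i t; last by apply: (h t) => //; lia.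
by apply: (h t.+1); [lia | apply: h2; move: p1; rewrite ep eit; lia].
Qed.

Let size_of_step i j : i <= j -> mu j - mu i =
  c * (j - i - ones v i (j - i)) + e * ones v i (j - i) /\
  ones w (mu i) (mu j - mu i) = e * ones v i (j - i).
Proof.
move=> ij; have E := mu_add i (j - i); rewrite subnKC // in E.
rewrite E addKn ones_mu; split=> //; rewrite /size_of.
by rewrite -{1}(addnK (ones v i (j - i)) (ones _ i (j - i))) ones_negw.
Qed.

Let few_halved : few_returns v.
Proof.
have [_ few _] := hw.
move=> n k s us hs; have [->//|[x0 xs]] : s = [::] \/ exists x, x \in s.
  by case: (s) => [|x s']; [left | right; exists x; rewrite mem_head].
have kn : k <= n by have [? _] := return_type_le (hs _ xs).
have pos x : x \in s -> 0 < x.1 /\ x.2 <= x.1.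
  move=> /hs r; have [_ ?] := return_type_le r; split=> //.
  by case: r => i [[? _ _ _] _]; lia.
rewrite -(size_map stretch); apply: (few (c * (n - k) + e * k) (e * k)).
  rewrite map_inj_in_uniq // => x y /pos[? ?] /pos[? ?]; exact: stretch_inj.
move=> _ /mapP[[l o] /[dup] /pos /= [l0 ol] /hs /= [i [ci <-]] ->]; rewrite /stretch /=.
have [l1|l1] := eqVneq l 1.
  subst l; have [_ hi hj _] := ci; have := ones_slide v i n; rewrite hi -[i.+1]addn1 hj => sl.
  change (return_type w (c * (n - k) + e * k) (e * k) 1 (ones v i 1)).
  exists (mu i); split; last by rewrite !ones1.
  have [h1 h2] := class_iff kn hi.
  apply: consecutiveI => //; last by move=> ?; poslia.
  have := ones_slide w (mu i) (c * (n - k) + e * k); rewrite h1 h2 addn1.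
  by move: sl; rewrite /v; poslia.
have [e1 e2] := size_of_step (leq_addr l i); rewrite !addKn in e1 e2.
exists (mu i); split=> /=.
  rewrite -e1 subnKC; last by apply: mu_mono; rewrite leq_addr.
  by apply: step_return => //; lia.
by rewrite -e1.
Qed.

Let inf_w b B : exists2 j, B <= j & w j = b.
Proof.
have [rec _ _] := hw; have [g _ _] := runs0.
have [j Bj /run_gapP[_ wj _ h]] := run_gap_recurs B rec g.
case: b; first by exists j.
by exists (j + 1); rewrite ?h //; lia.
Qed.

Let not_constant t : (forall t', t <= t' -> v t' = v t) -> False.
Proof.
move=> const; have [j Bj wj] := inf_w (~~ v t) (mu t).
have [|t' [r [ej rl]]] := @mu_cover j; first by apply: leq_trans Bj; apply: mu_mono.
have tt : t <= t' by rewrite leqNgt; apply/negP => /mu_mono; rewrite muS; lia.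
by move: wj; rewrite ej mu_const // const //; case: (v t).
Qed.

(** A single return of length 1 would make v eventually constant. With any other length the class of
    w would contain block starts only, and its return would be single as well. *)
Let several_halved : several_returns v.
Proof.
move=> n k i hi l o; apply: contrapT => no.
have kn : k <= n by rewrite -hi ones_le.
have single i' j : consecutive v n k i' j -> (j - i', ones v i' (j - i')) = (l, o).
  move=> ci; apply: contrapT => ne; apply: no.
  by exists (j - i'), (ones v i' (j - i')); split=> //; apply: return_typeI.
have [h1 h2] := class_iff kn hi.
have [rec _ _] := hw.
have next t : ones v t n = k -> exists j, consecutive v n k t j.
  move=> ht; have [g1 g2] := class_iff kn ht.
  have [p pB hp] := rec (mu t) (c * (n - k) + e * k) (mu t.+1).
  have [|t' [r [ep rl]]] := @mu_cover p; first by apply: leq_trans pB; apply: mu_mono.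
  have tt : t < t'.
    rewrite ltnNge; apply/negP => le; have := mu_mono (le : t'.+1 <= t.+1).
    by move: rl pB; rewrite ep (muS t'); poslia.
  have [|hc _] := @class_only n k t' r kn rl.
    by rewrite -ep; apply: etrans g1; apply: eq_ones.
  by have [q _ cq] := consecutive_exists ht tt hc; exists q.
have [l1|l1] := eqVneq l 1.
  have cl t : ones v (i + t) n = k.
    elim: t => [|t /next[j cj]]; first by rewrite addn0.
    have [e1 _] := single _ _ cj; have [_ _ <- _] := cj.
    by congr (ones v _ n); poslia.
  have vo t : v (i + t) = o :> nat.
    have [j cj] := next _ (cl t); have [e1 <-] := single _ _ cj.
    by rewrite e1 l1 ones1.
  apply: (@not_constant i) => t it.
  have := vo 0; have := vo (t - i); rewrite subnKC // addn0 => <-.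
  by case: (v i); case: (v t).
apply: (@not_single_return w _ _ _ (mu 0) (c * (l - o) + e * o) (e * o) hw h1).
have at_start j : mu 0 <= j -> ones w j (c * (n - k) + e * k) = e * k ->
    exists2 t, j = mu t & ones v t n = k.
  move=> Bj hj; have [t [r [ej rl]]] := mu_cover Bj.
  move: hj; rewrite ej => /(class_only kn rl)[ht ht'].
  case: r ej rl ht' => [|r] ej rl ht'; first by exists t; rewrite ?addn0.
  have ct : consecutive v n k t t.+1.
    by split; rewrite ?ht' // => t'; poslia.
  by have [] := single _ _ ct; rewrite subSnn => e1; case/eqP: l1.
move=> j j' Bj [jj hj hj' h].
have [t ej ht] := at_start j Bj hj.
have [t' ej' ht'] := at_start j' (leq_trans Bj (ltnW jj)) hj'.
have tt : t < t' by rewrite ltnNge; apply/negP => /mu_mono; poslia.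
have ct : consecutive v n k t t'.
  split=> // u /andP[u1 u2] hu; apply: (h (mu u)).
    by rewrite ej ej' !mu_lt.
  by have [] := class_iff kn hu.
have [e1 e2] := single _ _ ct.
have := size_of_step (ltnW tt); rewrite e2 e1 -ej -ej' => -[s1 s2].
by rewrite s2 s1.
Qed.

Let recurs_halved : uniformly_recurring v.
Proof.
have [rec _ _] := hw.
move=> i L B; have [p Bp hp] := rec a (mu (i + L)).+1 (mu B).
have mu0 : 0 < mu (i + L) by apply: leq_trans (mu_mono (leq0n _)).
have change_p : w p.+1 = ~~ w p.
  by have := hp 0; have := hp 1; rewrite !addn0 !addn1 ha => -> // ->.
have [|t [r [ep rl]]] := @mu_cover p.+1.
  by apply: leq_trans (mu_mono (leq0n B)) _; apply: leqW.
have r0 : r = 0.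
  case: r ep rl => // r ep rl; move: change_p; rewrite ep mu_const //.
  have -> : p = mu t + r by poslia.
  by rewrite mu_const 1?ltnW //; case: (v t).
rewrite r0 addn0 in ep.
have copy u : u <= i + L -> mu (t + u) + a = p + mu u /\ v (t + u) = v u.
  elim: u => [|u IH] uL.
    have E : mu (t + 0) + a = p + mu 0.
      by rewrite addn0 -ep (_ : mu 0 = a.+1) //; poslia.
    by split=> //; rewrite /v addn0 -ep change_p ha; have := hp 0; rewrite !addn0 => ->.
  have [|E1 E2] := IH; first by poslia.
  have E : mu (t + u.+1) + a = p + mu u.+1 by rewrite addnS !muS E2; poslia.
  split=> //; rewrite /v; have a_le : a <= mu u.+1.
    exact: leq_trans (leqnSn a) (mu_mono (leq0n _)).
  have -> : mu (t + u.+1) = p + (mu u.+1 - a) by poslia.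
  rewrite hp ?subnKC //.
  by have := mu_mono uL; poslia.
exists (t + i).
  rewrite -(leq_add2r 0) !addn0; apply: leq_trans (leq_addr _ _).
  by rewrite leqNgt; apply/negP => /mu_lt; poslia.
move=> u uL; have [|_] := copy (i + u); first by poslia.
by rewrite addnA.
Qed.

Let mu_change j : w j.+1 = ~~ w j -> mu 0 <= j -> exists2 t, 0 < t & j.+1 = mu t.
Proof.
move=> cj Bj; have [|u [r [ep rl]]] := @mu_cover j.+1; first by apply: leqW.
have r0 : r = 0.
  case: r ep rl => // r ep rl; move: cj; rewrite ep mu_const //.
  have -> : j = mu u + r by poslia.
  by rewrite mu_const 1?ltnW //; case: (v u).
exists u; last by rewrite ep r0 addn0.
by rewrite lt0n; apply/negP => /eqP u0; move: Bj; rewrite -(leq_add2r 1) !addn1 ep u0; poslia.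
Qed.

Lemma halved_runs : zero_runs_in v 1 2.
Proof.
have [rec _ _] := hw; have [g1 g2 gaps] := runs0.
have start l : run_gap w l.+2 -> exists t,
    [/\ v t, v t.+1 = false & w (mu t.+1 + l.+1) /\ forall k, k < l.+1 -> w (mu t.+1 + k) = false].
  move=> /(run_gap_recurs (mu 0) rec)[j Bj /run_gapP[_ wj wl h]].
  have w1 : w j.+1 = false by rewrite -addn1 h.
  have [|[//|t] _ ej] := @mu_change j _ Bj; first by rewrite w1 wj.
  exists t; rewrite /v -ej w1; split=> //; last first.
    by rewrite addSnnS; split=> // k kl; rewrite addSnnS h.
  have ej' : j = mu t + (len (v t)).-1.
    by move: ej (len_gt0 (v t)); rewrite muS; poslia.
  by rewrite -/(v t) -(@mu_const t (len (v t)).-1) ?prednK // -ej'.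
have v2 t : v t.+1 = false -> v t.+2 = w (mu t.+1 + c) by move=> E; rewrite /v muS E.
split.
- have [] := start c.-1; first by rewrite prednK.
  move=> t [vt vt1 [h1 _]]; exists t; apply/run_gapP; rewrite addn2 v2 // -(prednK c_gt0).
  by split=> // -[|[|k]] // _; rewrite addn1.
- have E : c.*2.+1 = c.*2.-1.+2 by rewrite prednK ?double_gt0.
  have [] := start c.*2.-1; first by rewrite -E.
  move=> t [vt vt1 [h1 h0]].
  have vt2 : v t.+2 = false by rewrite v2 // h0 // prednK ?double_gt0 // -addnn; lia.
  exists t; apply/run_gapP; rewrite addn3; split=> //.
    rewrite v2 // muS vt1 -addnA -[c + c]/(c + c) addnn.
    by rewrite -(@prednK c.*2) ?double_gt0.
  by case=> [|[|[|k]]] // _; rewrite ?addn1 ?addn2.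
- move=> i [|[|[|l]]] ci //; first by case: ci; rewrite addn0 ltnn.
  have /run_gapP[_ vi vl h] := ci.
  have v1 : v i.+1 = false by rewrite -addn1 h.
  have [[_ h1]|[h0 h1]] := mu_aligned i.+1; rewrite -/(v i.+1) v1 /= in h1.
    have := v2 i v1; rewrite h1 => e2; case: l ci vl h => // l _ _ h.
    by have := h 2 isT; rewrite addn2 e2.
  have e2 : v i.+2 = false.
    by rewrite v2 // h0 -/(v i.+1) v1 //= -addnn; lia.
  case: l ci vl h => // l _ _ h; have := h 3 isT; rewrite addn3 v2 // muS v1.
  by rewrite -addnA addnn h1.
Qed.

Lemma halved : two_or_three v.
Proof. by split. Qed.

End Halving.

Lemma block_start_negw w c e a i :
  block_start (negw w) e c a i = block_start w c e a i.
Proof. by elim: i => //= i ->; rewrite /negw; case: (w _). Qed.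

Lemma halving w c e : two_or_three w -> 0 < c -> 0 < e ->
  zero_runs_in w c c.*2 -> zero_runs_in (negw w) e e.*2 ->
  exists v, [/\ two_or_three v, zero_runs_in v 1 2 & zero_runs_in (negw v) 1 2].
Proof.
move=> hw c0 e0 r0 r1; have [[a /run_gapP[_ wa _ h]] _ _] := r0.
have ha : w a.+1 = ~~ w a by rewrite wa -addn1 h //; lia.
exists (fun i => w (block_start w c e a i)); split.
- exact: (halved hw c0 e0 r0 r1 ha).
- exact: (halved_runs hw c0 e0 r0 r1 ha).
have ha' : negw w a.+1 = ~~ negw w a by rewrite /negw ha.
have r0' : zero_runs_in (negw (negw w)) c c.*2 by rewrite (funext (@negwK w)).
have := halved_runs (two_or_three_negw hw) e0 c0 r1 r0' ha'.
by congr zero_runs_in; apply/funext => i; rewrite block_start_negw.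
Qed.

(** * Balance: runs of length one and two *)

Definition short_runs (w : nat -> bool) : Prop :=
  zero_runs_in w 1 2 /\ zero_runs_in (negw w) 1 2.

Lemma short_runs_negw w : short_runs w -> short_runs (negw w).
Proof. by move=> [h1 h2]; split=> //; rewrite (funext (@negwK w)). Qed.

Lemma no_triple w i : two_or_three w -> short_runs w ->
  ~~ [&& w i == w i.+1 & w i.+1 == w i.+2].
Proof.
wlog : w / w i = false.
  move=> H hw hs; case E : (w i); last by rewrite -E; apply: H.
  have := H (negw w) _ (two_or_three_negw hw) (short_runs_negw hs).
  rewrite /negw E => /(_ erefl); case: (w i.+1) => //=.
  by case: (w i.+2).
move=> wi hw [[[j /run_gapP[_ wj _ _]] _ gaps] _]; rewrite wi; apply/negP => /andP[/eqP w1 /eqP w2].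
have [rec _ _] := hw.
have [||l l3 [k ck]] := @zeros_gap w i 3 rec; first by exists j.
  by case=> [|[|[|t]]] //; rewrite ?addn0 ?addn1 ?addn2 -?w2 -?w1.
by have := gaps _ _ ck; lia.
Qed.

Lemma ones3 w i : ones w i 3 = w i + w i.+1 + w i.+2.
Proof. by rewrite /= addn0 addnA. Qed.

Lemma mixed_return w i : two_or_three w -> short_runs w ->
  w i -> w i.+3 -> w i.+1 != w i.+2 -> return_type w 3 2 1 1.
Proof.
move=> hw hs wi w3 ne; exists i; split; last by rewrite ones1 wi.
apply: consecutiveI; rewrite ?addn1 ?ones3 ?wi ?w3 //; last by move=> k; lia.
- by move: ne; case: (w i.+1); case: (w i.+2).
- by move: ne; case: (w i.+1); case: (w i.+2).
Qed.

Lemma ones_run2_return w : zero_runs_in (negw w) 1 2 -> return_type w 3 2 1 0.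
Proof. by case=> _ /(@ones_run_return w 2 isT). Qed.

(** If 0xy0 with x != y never occurred, 010 would extend to 10101 and 1001 to 110011, giving the
    returns (2, 1) and (3, 2). These would join (1, 0) from 0110 and (1, 1) from 1xy1. *)
Lemma mixed_zeros w : two_or_three w -> short_runs w ->
  exists i, [/\ w i = false, w i.+3 = false & w i.+1 != w i.+2].
Proof.
move=> hw hs; apply: contrapT => no.
have {}no i : w i = false -> w i.+3 = false -> w i.+1 = w i.+2.
  by move=> h1 h2; apply/eqP; apply: contraT => ne; case: no; exists i.
have [rec few _] := hw; have [rec' _ _] := two_or_three_negw hw.
have tri i := no_triple i hw hs.
have [[g01 g02 _] [g11 g12 _]] := hs.
have [i [wi w3 ne]] : exists i, [/\ w i, w i.+3 & w i.+1 != w i.+2].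
  apply: contrapT => no'.
  have {}no' i : w i -> w i.+3 -> w i.+1 = w i.+2.
    by move=> h1 h2; apply/eqP; apply: contraT => ne; case: no'; exists i.
  have [i /run_gapP[_ _ _ h]] := g02.
  (* Without 0xy0 and 1xy1 for x != y, the word splits into pairs of equal letters from an
     occurrence of 00 on, which an isolated 0 refutes. *)
  have pair k : w (i.+1 + k.*2) = w (i.+1 + k.*2).+1.
    elim: k => [|k IH]; first by have := h 1 isT; have := h 2 isT; rewrite addn1 addn2 /= addn0 => -> ->.
    rewrite doubleS !addnS; have := tri (i.+1 + k.*2); have := tri (i.+1 + k.*2).+1.
    have := @no (i.+1 + k.*2); have := @no' (i.+1 + k.*2); rewrite -IH.
    case: (w (i.+1 + k.*2)); case: (w (i.+1 + k.*2).+2); case: (w (i.+1 + k.*2).+3) => //= ; move=> a b; by [have := a isT isT | have := b erefl erefl].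
  have [j ij /run_gapP[_ wj wj2 hj]] := run_gap_recurs i.+1 rec g01.
  have w1 : w j.+1 = false by rewrite -addn1 hj.
  rewrite addn2 in wj2.
  case: (boolP (odd (j - i.+1))) => od.
    have := pair (j - i.+1).+1./2; rewrite halfK /= od /= subn0 addnS subnKC // wj2 w1 => ?.
    by [].
  by have := pair (j - i.+1)./2; rewrite halfK (negbTE od) subn0 subnKC // wj w1.
have r11 := mixed_return hw hs wi w3 ne.
have r10 := ones_run2_return (proj2 hs).
have r21 : return_type w 3 2 2 1.
  have [[//|j] _ /run_gapP[_ wj wj2 hj]] := run_gap_recurs 1 rec' g11.
  have w1 : w j.+1 = false by exact: negbTE.
  have w2 : w j.+2 by have := hj 1 isT; rewrite addn1 => /negbFE.
  have {}w3 : w j.+3 = false by move: wj2; rewrite addn2 => /negbTE.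
  have w0 : w j.
    by apply: contraT => /negbTE w0; have := no _ w0 w3; rewrite w1 w2.
  have w4 : w j.+4.
    by apply: contraT => /negbTE w4; have := no _ w1 w4; rewrite w3 w2.
  exists j; split; last by rewrite /= w0 w1.
  apply: consecutiveI; rewrite ?addn2 ?ones3 ?w0 ?w1 ?w2 ?w3 ?w4 //.
  by case=> [|[|k]] // _; rewrite addn1 ones3 w1 w2 w3.
have r32 : return_type w 3 2 3 2.
  have [[//|j] _ /run_gapP[_ w1 w4 hj]] := run_gap_recurs 1 rec g02.
  have w2 : w j.+2 = false by have := hj 1 isT; rewrite addn1.
  have {}w3 : w j.+3 = false by have := hj 2 isT; rewrite addn2.
  rewrite addn3 in w4.
  have w0 : w j.
    by apply: contraT => /negbTE w0; have := no _ w0 w3; rewrite w1 w2.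
  have w5 : w j.+4.+1.
    by apply: contraT => /negbTE w5; have := no _ w2 w5; rewrite w3 w4.
  exists j; split; last by rewrite /= w0 w1 w2.
  apply: consecutiveI; rewrite ?addn3 ?ones3 ?w0 ?w1 ?w2 ?w3 ?w4 ?w5 //.
  by case=> [|[|[|k]]] // _; rewrite ?addn1 ?addn2 ones3 ?w1 w2 w3 ?w4.
by have := four_returns few r11 r10 r21 r32.
Qed.

(** Both (1, 1) and (1, 0) are returns, which leaves room for one longer return only. *)
Lemma unique_jump w : two_or_three w -> short_runs w -> exists L O, 1 < L /\
  forall i j, consecutive w 3 2 i j ->
    j = i.+1 \/ (j - i = L /\ ones w i (j - i) = O).
Proof.
move=> hw hs; have [rec few _] := hw.
have [i [wi w3 ne]] := mixed_zeros (two_or_three_negw hw) (short_runs_negw hs).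
have r11 : return_type w 3 2 1 1.
  by apply: (mixed_return (i := i)) => //; [exact: negbFE | exact: negbFE |
     move: ne; rewrite /negw; case: (w i.+1); case: (w i.+2)].
have r10 := ones_run2_return (proj2 hs).
have [p [q [cpq pq]]] : exists p q, consecutive w 3 2 p q /\ p.+1 < q.
  have [p _ [cp _]] := return_type_recurs 0 rec r11.
  have [_ hp _ _] := cp.
  have [_ g _] := (proj1 hs).
  have [j pj /run_gapP[_ wj wj3 hj]] := run_gap_recurs p.+1 rec g.
  have w1 : w j.+1 = false by rewrite -addn1 hj.
  have w2 : w j.+2 = false by rewrite -addn2 hj.
  have nj : ones w j.+1 3 = 1 by rewrite ones3 w1 w2; move: wj3; rewrite addn3 => ->.
  pose K k := ones w k 3 == 2.
  have Kp : K p by rewrite /K hp.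
  have [|q [pq Kq hq]] := @last_one K p j.+1 Kp; first by poslia.
  have [r jr [cr _]] := return_type_recurs j.+2 rec r11; have [_ hr _ _] := cr.
  have [|k _ ck] := consecutive_exists (eqP Kq) (_ : q < r) hr; first by poslia.
  exists q, k; split=> //; have [qk _ hk _] := ck.
  rewrite ltnNge leq_eqVlt ltnS leqNgt qk orbF; apply/eqP => ek.
  have [e|e] := eqVneq k j.+1; first by rewrite e nj in hk.
  have : K k by rewrite /K hk.
  by rewrite hq //; poslia.
exists (q - p), (ones w p (q - p)); split; first by lia.
move=> a b cab; have [ab _ _ _] := cab.
have [->|ne1] := eqVneq b a.+1; [by left | right].
have := four_returns few r11 r10 (return_typeI cpq) (return_typeI cab).
have -> : (1 == q - p) = false by lia.
have -> : (1 == b - a) = false by lia.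
by move=> /= /andP[/eqP <- /eqP <-].
Qed.

(** The sum of the windows of length 3 counts each letter three times, up to corrections at the two
    ends. *)
Lemma ones3_sum w c i n : (forall t, t < n -> ones w (i + t) 3 = c) ->
  c * n + 2 * w i + w i.+1 = 3 * ones w i n + 2 * w (i + n) + w (i + n).+1.
Proof.
elim: n => [|n IH] h; first by rewrite /= !addn0 !muln0.
have := h n (ltnSn n); rewrite ones3 onesSr mulnS mulnDr !addnS => e.
by have := IH (fun t tn => h t (ltnW tn)); lia.
Qed.

Section Majority.

Variable w : nat -> bool.
Hypotheses (hw : two_or_three w) (hs : short_runs w).
Variables (L O alpha B : nat).
Hypothesis L_gt1 : 1 < L.
Hypothesis jumps : forall i j, consecutive w 3 2 i j ->
  j = i.+1 \/ (j - i = L /\ ones w i (j - i) = O).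
Hypothesis intervals : forall i j, consecutive w 3 1 i j -> j = i.+1 \/ j = i + alpha.+1.

(** Since no letter occurs three times in a row, a window of length 3 has one or two ones; K marks a
    majority of ones. *)
Let K i := ones w i 3 == 2.

Let nK i : K i = false -> ones w i 3 = 1.
Proof.
have := no_triple i hw hs; rewrite /K ones3.
by case: (w i); case: (w i.+1); case: (w i.+2).
Qed.

Hypothesis (B_out : K B = false).

Let inf_K b n : exists2 i, n <= i & K i = b.
Proof.
have [rec _ _] := hw; have [[_ g _] [_ g' _]] := hs; case: b.
- have [rec' _ _] := two_or_three_negw hw.
  have [j nj /run_gapP[_ wj _ h]] := run_gap_recurs n rec' g'.
  exists j => //; have := h 1 isT; have := h 2 isT; rewrite addn1 addn2 /K ones3.
  by move: wj; rewrite /negw; case: (w j); case: (w j.+1); case: (w j.+2).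
have [j nj /run_gapP[_ wj _ h]] := run_gap_recurs n rec g.
exists j => //; have := h 1 isT; have := h 2 isT; rewrite addn1 addn2 /K ones3 wj.
by move=> -> ->.
Qed.

(** First position of a maximal interval of K. All such intervals have length alpha, by the returns
    to the complementary class, and are L - 1 positions apart, by the returns to K. *)
Let enter j := (0 < j) && ~~ K j.-1 && K j.
Let leave l := K l && ~~ K l.+1.

Let enterP j : enter j -> [/\ w j + w j.+1 = 1, w j.+2 & forall t, t < alpha -> K (j + t)] /\
  0 < alpha /\ leave (j + alpha.-1).
Proof.
case/andP=> /andP[j0 /negbTE n1] k1.
have o1 := nK n1; have /eqP o2 := k1.
have [i Bi ki] := inf_K false j.+1.
have [|||m _ cm] := @consecutive_exists w 3 1 j.-1 i => //; try by [exact: nK | poslia].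
have [|em] := intervals cm.
  by have [_ _ hm _] := cm; move=> em; rewrite em prednK // o2 in hm.
have {}em : m = j + alpha by poslia.
have [jm _ hm hn] := cm.
have ka t : t < alpha -> K (j + t).
  move=> ta; apply: contraT => /negbTE/nK e; case: (hn (j + t)) => //; poslia.
have a0 : 0 < alpha.
  by rewrite lt0n; apply/eqP => a0; move: hm; rewrite em a0 addn0 o2.
split; last first.
  split=> //; rewrite /leave ka; last by poslia.
  by rewrite -addnS prednK // /K -em hm.
split=> //; have := ones_slide w j.-1 3; rewrite prednK // o1 o2 !addnS !addn0 prednK //.
  by move: o1 o2; rewrite !ones3 prednK //; case: (w j.-1); case: (w j.+2); case: (w j); case: (w j.+1).
by move: o1 o2; rewrite !ones3 prednK //; case: (w j.-1); case: (w j.+2); case: (w j); case: (w j.+1).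
Qed.

Let leaveP l : leave l -> [/\ w l, w l.+1 + w l.+2 = 1,
  forall t, 0 < t < L -> K (l + t) = false, enter (l + L) & ones w l L = O].
Proof.
case/andP=> k1 /negbTE n1.
have o1 := nK n1; have /eqP o2 := k1.
have [i Bi /eqP ki] := inf_K true l.+1.
have [m _ cm] := consecutive_exists o2 Bi ki.
have [jm _ hm hn] := cm.
have [em|[em eO]] := jumps cm; first by rewrite em o1 in hm.
have {}em : m = l + L by poslia.
have kn t : 0 < t < L -> K (l + t) = false.
  by move=> tL; apply/eqP; apply: hn; poslia.
split=> //.
- by move: o1 o2; rewrite !ones3; case: (w l); case: (w l.+1); case: (w l.+2); case: (w l.+3).
- by move: o1 o2; rewrite !ones3; case: (w l); case: (w l.+1); case: (w l.+2); case: (w l.+3).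
- rewrite /enter {2}/K -em hm eqxx andbT; apply/andP; split; first by poslia.
  have -> : m.-1 = l + L.-1 by poslia.
  by rewrite kn //; poslia.
- by rewrite -eO em addKn.
Qed.

(** At either boundary of an interval two adjacent letters sum to 1, so one letter per end is all
    that enters the corrections in [ones3_sum]. *)
Let zs j : nat := w j.
Let ze j : nat := ~~ w (j + alpha).

Let interval_sum j : enter j -> 2 * alpha + (ze j + zs j) = 3 * ones w j alpha + 1.
Proof.
move=> ej; have [[h1 h2 hK] [a0 lv]] := enterP ej.
have [_ h3 _ _ _] := leaveP lv.
have e1 : (j + alpha.-1).+1 = j + alpha by poslia.
rewrite e1 in h3.
have := @ones3_sum w 2 j alpha (fun t ta => eqP (hK t ta)).
by rewrite /zs /ze; move: h1 h3; clear; case: (w (j + alpha)) => /=; lia.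
Qed.

Let next j := j + alpha.-1 + L.

Let enter_next j : enter j -> enter (next j).
Proof. by move=> /enterP[_ [_ /leaveP[]]]. Qed.

Let excursion_sum j : enter j -> zs (next j) + ze j + 3 * O = L + 3.
Proof.
move=> ej; have [[h1 h2 hK] [a0 lv]] := enterP ej.
have [w1 h3 hL en hO] := leaveP lv.
have [[h4 _ _] _] := enterP en; rewrite -/(next j) in h4.
have e1 : (j + alpha.-1).+1 = j + alpha by poslia.
have e2 : j + alpha + L.-1 = next j by rewrite /next; poslia.
rewrite e1 in h3.
have H t : t < L.-1 -> ones w (j + alpha + t) 3 = 1.
  by move=> tL; apply: nK; rewrite -e1 addSnnS hL //; poslia.
have := ones3_sum H; rewrite e2.
have : ones w (j + alpha.-1) L = w (j + alpha.-1) + ones w (j + alpha) L.-1.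
  by rewrite -e1 -onesS prednK // ltnW.
rewrite hO w1 /zs /ze; move: h3 h4 L_gt1; clear.
by case: (w (j + alpha)) => /=; lia.
Qed.

(** Both ze j + zs j and zs (next j) + ze j are independent of j, the first because it is at most 2
    and fixed modulo 3. So zs changes by a constant at each passage, and two equal nonzero changes
    would leave {0, 1}. *)
Let zs_next j : enter j -> zs (next j) = zs j.
Proof.
move=> e1; have e2 := enter_next e1; have e3 := enter_next e2.
have := interval_sum e1; have := interval_sum e2.
have := excursion_sum e1; have := excursion_sum e2.
rewrite /zs /ze; case: (w j); case: (w (next j)); case: (w (next (next j)));
  case: (w (j + alpha)); case: (w (next j + alpha)) => //=; lia.
Qed.

Let enter_before b i : K b = false -> b < i -> K i ->
  exists j, [/\ b < j <= i, enter j & forall t, j <= t <= i -> K t].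
Proof.
move=> nb bi ki; have [|q [qi nq hq]] := @last_one (fun k => ~~ K k) b i _ bi; first by rewrite nb.
have kq t : q.+1 <= t <= i -> K t.
  move=> ht; have [->//|ne] := eqVneq t i.
  by apply: negbFE; apply: hq; poslia.
exists q.+1; split=> //.
by rewrite /enter /= nq /=; apply: kq; poslia.
Qed.

Let after_interval j : enter j -> K (j + alpha) = false.
Proof.
by move=> /enterP[_ [a0 /andP[_ /negbTE]]]; rewrite -addnS prednK.
Qed.

Hypothesis thick : exists i, [/\ B < i, K i, K i.+1 & K i.+2].

Let alpha_gt2 : 2 < alpha.
Proof.
have [i [Bi k0 k1 k2]] := thick.
have [j [/andP[_ ji] ej hj]] := enter_before B_out (leqW (leqW Bi)) k2.
have nj : j <= i.
  have /andP[/andP[j0 nk] _] := ej.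
  rewrite leqNgt; apply/negP => lt; move: nk; have [->|->] : j = i.+1 \/ j = i.+2.
  - by move: ji lt; clear; lia.
  - by rewrite k0.
  - by rewrite k1.
rewrite ltnNge; apply/negP => a2; have := hj (j + alpha).
rewrite after_interval // => H; have := H _.
by move: nj a2; clear; lia.
Qed.

(** Cut into 11 and q triples of weight at most 2: the maximum is reached by 11(011)^q only, as 111
    does not occur. *)
Let full q i : ones w i (3 * q + 2) <= 2 * q + 2 /\
  (ones w i (3 * q + 2) = 2 * q + 2 ->
    [/\ w i, w i.+1, w (i + 3 * q), w (i + 3 * q).+1 & forall t, t <= 3 * q -> K (i + t)]).
Proof.
elim: q => [|q [IH1 IH2]].
  rewrite muln0 /= !addn0; split; first by case: (w i); case: (w i.+1).
  move=> h; have [w0 w1] : w i /\ w i.+1 by move: h; case: (w i); case: (w i.+1).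
  split=> // -[|t] // _; rewrite addn0 /K ones3 w0 w1.
  by have := no_triple i hw hs; rewrite w0 w1; case: (w i.+2).
have E : 3 * q.+1 + 2 = 3 * q + 2 + 3 by lia.
have le3 : ones w (i + (3 * q + 2)) 3 <= 2.
  by case k : (K (i + (3 * q + 2))); [rewrite (eqP k) | rewrite nK].
rewrite E ones_cat; split; first by lia.
move=> h; have [|w0 w1 w2 w3 hK] := IH2; first by lia.
have k2 : K (i + (3 * q + 2)) by rewrite /K; apply/eqP; lia.
set j := i + 3 * q in w2 w3 *.
have ej : i + (3 * q + 2) = j.+2 by rewrite /j; clear; lia.
rewrite ej in k2.
have w4 : w j.+2 = false by have := no_triple j hw hs; rewrite w2 w3; case: (w j.+2).
have [w5 w6] : w j.+3 /\ w j.+4.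
  by move: k2; rewrite /K ones3 w4; case: (w j.+3); case: (w j.+4).
have w7 : w j.+4.+1 = false by have := no_triple j.+3 hw hs; rewrite w5 w6; case: (w j.+4.+1).
have ej3 : i + 3 * q.+1 = j.+3 by rewrite /j; clear; lia.
rewrite ej3; split=> // t t3.
have [tq|tq] := leqP t (3 * q); first exact: hK.
have [->|[->|->]] : t = (3 * q).+1 \/ (t = (3 * q).+2 \/ t = (3 * q).+3) by move: t3 tq; clear; lia.
- by rewrite addnS /K ones3 w3 w4 w5.
- by rewrite !addnS.
- by rewrite !addnS /K ones3 w5 w6 w7.
Qed.

Let full_conv q i : w i -> w i.+1 -> (forall t, t <= 3 * q -> K (i + t)) ->
  ones w i (3 * q + 2) = 2 * q + 2.
Proof.
move=> w0 w1; elim: q => [|q IH] hK; first by rewrite muln0 /= w0 w1.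
have -> : 3 * q.+1 + 2 = 3 * q + 2 + 3 by lia.
rewrite ones_cat IH; last by move=> t tq; apply: hK; lia.
by rewrite (eqP (hK (3 * q + 2) _)); lia.
Qed.

(* The windows 11(011)^q form a class with a single return type. *)
Lemma majority_absurd : False.
Proof.
have [j0 ej0] : exists j, enter j.
  have [i Bi ki] := inf_K true B.+1.
  by have [j [_ ej _]] := enter_before B_out Bi ki; exists j.
pose A := ze j0 + zs j0.
have endsA j : enter j -> ze j + zs j = A.
  move=> ej; have := interval_sum ej; have := interval_sum ej0.
  have : ze j + zs j <= 2 by rewrite /ze /zs; case: (w _); case: (w _).
  have : A <= 2 by rewrite /A /ze /zs; case: (w _); case: (w _).
  by rewrite -/A; lia.
have A2 : A <= 2 by rewrite /A /ze /zs; case: (w _); case: (w _).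
(* By [interval_sum] modulo 3 the division is exact; 11(011)^q then fits into an interval at one
   place only. *)
pose q := (alpha - 2 - A) %/ 3.
have hq : alpha = 3 * q + 2 + A.
  by have := interval_sum ej0; rewrite -/A /q; move: alpha_gt2 A2; clear; lia.
(* The first 11 of the interval, which opens with 011 or with 1011. *)
pose top j := j + 1 + zs j.
have topP j : enter j -> [/\ w (top j), w (top j).+1,
    ones w (top j) (3 * q + 2) = 2 * q + 2 &
    forall i, j <= i < j + alpha -> ones w i (3 * q + 2) = 2 * q + 2 -> i = top j].
  move=> ej; have [[h1 w2 hK] _] := enterP ej; have eA := endsA j ej.
  have [wt wt1 below] : [/\ w (top j), w (top j).+1 &
      forall i, j <= i < top j -> w i && w i.+1 = false].
    rewrite /top /zs; case E : (w j) h1 => h1.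
      have {}h1 : w j.+1 = false by move: h1; case: (w j.+1).
      have := hK 1 (ltnW alpha_gt2); rewrite addn1 /K ones3 h1 w2 => w3.
      rewrite /= !addn1; split=> //; first by move: w3; case: (w j.+3).
      by move=> i hi; have [->|->] : i = j \/ i = j.+1 by [lia]; rewrite ?h1 ?andbF.
    have {}h1 : w j.+1 by move: h1; case: (w j.+1).
    rewrite /= addn0 addn1; split=> // i hi.
    by have -> : i = j; [lia | rewrite E].
  split=> //.
    apply: full_conv => // t tq; rewrite /top -!addnA; apply: hK.
    by move: eA hq tq; clear; lia.
  move=> i ij /(proj2 (full q i))[wi wi1 _ _ hKi].
  have lt : i + 3 * q < j + alpha.
    rewrite ltnNge; apply/negP => ge; have := hKi (j + alpha - i).
    rewrite subnKC; last by move: ij; clear; lia.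
    by rewrite after_interval // => H; have := H _; move: ge; clear; lia.
  have ge : top j <= i.
    by rewrite leqNgt; apply/negP => lt'; have := below i; rewrite wi wi1 => H; have := H _;
      move: ij lt'; clear; lia.
  have le : i <= (top j).+1.
    have : ze j <= 1 by rewrite /ze; case: (w _).
    by move: lt eA hq; rewrite /top; clear; lia.
  have [e|ne] := eqVneq i (top j).+1; last by move: ge le ne; clear; lia.
  by have := no_triple (top j) hw hs; rewrite wt wt1 -e wi1.
have inside i : B < i -> K i -> exists2 j, enter j & j <= i < j + alpha.
  move=> Bi ki; have [j [/andP[_ ji] ej hj]] := enter_before B_out Bi ki.
  exists j => //; rewrite ji ltnNge; apply/negP => ge.
  by have := hj (j + alpha); rewrite leq_addr ge after_interval // => /(_ isT).
have [_ _ t0 _] := topP j0 ej0.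
(* Along one return the windows of length 3 add up to 2 * alpha + (L - 1). This is three times the
   number of ones, as 11 is read at both ends. *)
apply: (@not_single_return w _ _ _ B.+1 (alpha.-1 + L) ((2 * (alpha.-1 + L) - L.-1) %/ 3) hw t0).
move=> i i' Bi [ii hi hi' hn].
have inK k : ones w k (3 * q + 2) = 2 * q + 2 -> K k.
  by move=> /(proj2 (full q k))[_ _ _ _ /(_ 0 isT)]; rewrite addn0.
have [j ej ij] := inside i Bi (inK i hi).
have [wt wt1 _ uniq_j] := topP j ej.
have ei := uniq_j i ij hi.
have ej2 := enter_next ej; have [wt2 wt21 ht2 uniq_j2] := topP _ ej2.
have zsn := zs_next ej.
have zs1 : zs j <= 1 by rewrite /zs; case: (w j).
have et2 : top (next j) = i + (alpha.-1 + L).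
  by rewrite ei /top zsn /next; clear; lia.
have [[_ _ hK] [a0 lv]] := enterP ej.
have [_ _ hL _ _] := leaveP lv.
have [[_ _ hK2] _] := enterP ej2.
have le : i' <= top (next j).
  rewrite leqNgt; apply/negP => lt; apply: (hn (top (next j))) => //.
  by rewrite lt andbT et2; move: L_gt1; clear; lia.
have ge : next j <= i'.
  have kk := inK i' hi'.
  rewrite leqNgt; apply/negP => lt.
  have [lt1|ge1] := ltnP i' (j + alpha).
    have := uniq_j i' _ hi'; rewrite -ei lt1 andbT => H.
    by have := H _; move: ii ij; clear; lia.
  have := hL (i' - (j + alpha.-1)); rewrite subnKC; last by move: ge1; clear; lia.
  rewrite kk => H; have := H _.
  by move: lt ge1 a0; rewrite /next; clear; lia.
have ei' : i' = top (next j).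
  apply: uniq_j2 => //; rewrite ge /=; apply: leq_ltn_trans le _.
  by rewrite /top zsn; move: zs1 alpha_gt2; clear; lia.
have eD : i' - i = alpha.-1 + L by rewrite ei' et2; clear; lia.
rewrite eD; split=> //.
pose n1 := j + alpha - i; pose n3 := 1 + zs j.
have s1 : 2 * n1 + 2 * w i + w i.+1 = 3 * ones w i n1 + 2 * w (j + alpha) + w (j + alpha).+1.
  have e1 : i + n1 = j + alpha by rewrite /n1; move: ij; clear; lia.
  have := @ones3_sum w 2 i n1; rewrite e1; apply=> t tn; apply/eqP.
  have -> : i + t = j + (i + t - j) by move: ij; clear; lia.
  by apply: hK; move: ij tn; rewrite /n1; clear; lia.
have s2 : L.-1 + 2 * w (j + alpha) + w (j + alpha).+1 =
    3 * ones w (j + alpha) L.-1 + 2 * w (next j) + w (next j).+1.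
  have e2 : j + alpha + L.-1 = next j by rewrite /next; move: a0 L_gt1; clear; lia.
  have := @ones3_sum w 1 (j + alpha) L.-1; rewrite e2 mul1n; apply=> t tL.
  apply: nK; have -> : j + alpha + t = j + alpha.-1 + t.+1 by move: a0; clear; lia.
  by apply: hL; move: tL; clear; lia.
have s3 : 2 * n3 + 2 * w (next j) + w (next j).+1 = 3 * ones w (next j) n3 + 3.
  have e3 : next j + n3 = top (next j) by rewrite /top zsn /n3 addnA.
  have := @ones3_sum w 2 (next j) n3; rewrite e3 wt2 wt21 => -> //; first by clear; lia.
  by move=> t tn; apply/eqP/hK2; move: tn zs1 alpha_gt2; rewrite /n3; clear; lia.
have eo : ones w i (alpha.-1 + L) =
    ones w i n1 + ones w (j + alpha) L.-1 + ones w (next j) n3.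
  have -> : alpha.-1 + L = n1 + L.-1 + n3.
    by move: ei ij a0 L_gt1; rewrite /n1 /n3 /top; clear; lia.
  have p1 : i + n1 = j + alpha by rewrite /n1; move: ij; clear; lia.
  have p2 : i + (n1 + L.-1) = next j.
    by rewrite /n1 /next; move: ij a0 L_gt1; clear; lia.
  by rewrite !ones_cat p1 p2.
have en : n1 + n3 = alpha by rewrite /n1 /n3; move: ei ij; rewrite /top; clear; lia.
have w11 : (w i = true) * (w i.+1 = true) by rewrite ei.
rewrite !w11 in s1.
rewrite eo; move: s1 s2 s3 en a0 L_gt1; clear.
by move: (ones w i n1) (ones w (j + alpha) L.-1) (ones w (next j) n3) => x y z /=; lia.
Qed.

End Majority.

Lemma short_runs_absurd w : two_or_three w -> short_runs w -> False.
Proof.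
move=> hw hs.
have [L [O [L1 jumps]]] := unique_jump hw hs.
have [L' [O' [L1' jumps']]] := unique_jump (two_or_three_negw hw) (short_runs_negw hs).
have [rec _ _] := hw; have [[_ g _] _] := hs.
have intervals i j : consecutive w 3 1 i j -> j = i.+1 \/ j = i + L'.-1.+1.
  move=> cij; have /jumps' : consecutive (negw w) 3 2 i j.
    by rewrite -[2]/(3 - 1); apply/consecutive_negw.
  by have [ij _ _ _] := cij; case=> [->|[e _]]; [left | right; poslia].
have [B _ /run_gapP[_ wB _ hB]] := run_gap_recurs 0 rec g.
have B_out : (ones w B.+1 3 == 2) = false.
  have := hB 1 isT; have := hB 2 isT; rewrite addn1 addn2 ones3 => -> ->.
  by case: (w _).
apply: (majority_absurd hw hs L1 jumps intervals B_out).
(* A factor 1xy1 with x != y lies in 01101 or in 10110, as 111 does not occur; either one holds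
   three successive positions of K. *)
have [i0 [n0 n3 n12]] := mixed_zeros (two_or_three_negw hw) (short_runs_negw hs).
have [[//|i] Bi hi] := rec i0 4 B.+3.
have w0 : w i.+1 by have := hi 0 isT; rewrite !addn0 => ->; apply: negbFE.
have w3 : w i.+4 by have := hi 3 isT; rewrite !addn3 => ->; apply: negbFE.
have w12 : w i.+2 != w i.+3.
  have := hi 1 isT; have := hi 2 isT; rewrite !addn1 !addn2 => -> ->.
  by move: n12; rewrite /negw; case: (w i0.+1); case: (w i0.+2).
have := no_triple i hw hs; have := no_triple i.+3 hw hs; rewrite w0 w3.
case w1 : (w i.+2) w12; case w2 : (w i.+3) => // _ /= t1 t2.
- exists i; split; [by poslia | | |]; rewrite ?w0 ?w1 ?w2 ?w3 //.
  by move: t2; case: (w i).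
- exists i.+1; split; [by poslia | | |]; rewrite ?w0 ?w1 ?w2 ?w3 //.
  by move: t1; case: (w i.+4.+1).
Qed.

(** For the class of 01 and 10, a run of x zeros gives (x, 1) and a run of y ones gives (y, y - 1).
    Two runs of each letter force a coincidence, so 2 is a run length of both. By [long_ones_run]
    for w and its complement the other length is 1 or 4, and both cases have the form c, 2c. *)
Lemma double_square_absurd w : two_or_three w -> run_gap w 1 -> run_gap (negw w) 1 -> False.
Proof.
move=> hw g1 g1'; have [rec few _] := hw; have hw' := two_or_three_negw hw.
have [rec' _ _] := hw'.
have long u : two_or_three u -> run_gap u 1 -> run_gap (negw u) 1 -> exists2 l, 2 < l & run_gap u l.
  move=> [recu _ _] [i /run_gapP[_ ui _ _]] [j /run_gapP[_ uj uj1 _]].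
  apply: (@zeros_gap u j 2 recu); first by exists i.
  move: uj uj1; rewrite /negw => /negbTE u0 /negbTE u1.
  by case=> [|[|t]] //; rewrite ?addn0.
have [l l2 gl] := long _ hw g1 g1'.
have [|l' l2' gl'] := long _ hw' g1'; first by rewrite (funext (@negwK w)).
have [a [b [a0 b0 ab Zw]]] := two_zero_runs hw g1 l2 gl.
have [p [q [p0 q0 pq Zn]]] := two_zero_runs hw' g1' l2' gl'.
have RZ x : 0 < x -> run_gap w x.+1 -> return_type w 2 1 x 1 by case: x => // x _; apply: run_gap2.
have RN x : 0 < x -> run_gap (negw w) x.+1 -> return_type w 2 1 x x.-1.
  by case: x => // x _; apply: run_gap2_neg.
have {b b0 ab q q0 pq Zw Zn a a0 p p0} [b [q [b0 q0 [b2 q2] [Zw Zn]]]] :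
    exists b q, [/\ 0 < b, 0 < q, b != 2 /\ q != 2 & zero_runs_in w 2 b /\ zero_runs_in (negw w) 2 q].
  have [ga gb _] := Zw; have [gp gq _] := Zn.
  have := four_returns few (RZ _ a0 ga) (RZ _ b0 gb) (RN _ p0 gp) (RN _ q0 gq).
  have {ab}ab : a <> b by apply/eqP.
  have {pq}pq : p <> q by apply/eqP.
  have Zw' := zero_runs_inC Zw; have Zn' := zero_runs_inC Zn.
  move=> H.
  have [[ea ep]|[[ea ep]|[[ea ep]|[ea ep]]]] :
      (a = 2 /\ p = 2) \/ ((a = 2 /\ q = 2) \/ ((b = 2 /\ p = 2) \/ (b = 2 /\ q = 2))).
    by move: H ab pq a0 b0 p0 q0; clear; lia.
  - by subst a p; exists b, q; split=> //; split; apply/eqP => e; subst.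
  - by subst a q; exists b, p; split=> //; split; apply/eqP => e; subst.
  - by subst b p; exists a, q; split=> //; split; apply/eqP => e; subst.
  - by subst b q; exists a, p; split=> //; split; apply/eqP => e; subst.
have [h2 hb _] := Zw; have [n2 nq _] := Zn.
have q14 : q = 1 \/ q = 4.
  have [q3|q3] := ltnP 2 q; last by left; lia.
  by right; apply: (@long_ones_run w q b).
have b14 : b = 1 \/ b = 4.
  have [b3|b3] := ltnP 2 b; last by left; lia.
  right; apply: (@long_ones_run (negw w) b q) => //.
  by rewrite (funext (@negwK w)).
have dbl u x : x = 1 \/ x = 4 -> zero_runs_in u 2 x ->
    exists2 c, 0 < c & zero_runs_in u c c.*2.
  by case=> -> Zu; [exists 1; rewrite //; apply: zero_runs_inC | exists 2].
have [c c0 Zc] := dbl _ _ b14 Zw; have [e e0 Ze] := dbl _ _ q14 Zn.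
have [v [hv r0 r1]] := halving hw c0 e0 Zc Ze.
exact: (short_runs_absurd hv).
Qed.

(** If p is a power of 0, the windows 1p1 and 0p0 give the gap m + 1 and a gap above m + 2. No gap
    is shorter than m + 1, for it would be unbalanced against a block of 0p0. *)
Lemma imbalance_isolated_absurd w m a b : two_or_three w ->
  (forall i, w i -> w i.+1 = false) -> 0 < m ->
  (forall k, k < m.+2 -> balanced_at w k) ->
  ones w b m.+2 + 2 <= ones w a m.+2 -> False.
Proof.
move=> hw iso m0 bal im; have [rec _ _] := hw.
have [[t tm pt]|none] := pselect (exists2 t, t < m & w (b.+1 + t)).
  by apply: (bispecial_absurd hw iso bal im); exists t.
have p0 t : t < m -> w (b.+1 + t) = false.
  by move=> tm; apply/negP => pt; apply: none; exists t.
have [wa wa' wb wb' inner] := imbalance_inner bal im.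
have zb t : t < m.+2 -> w (b + t) = false.
  case: t => [|t] tm; first by rewrite addn0.
  have [->//|ne] := eqVneq t m.
  by rewrite -addSnnS p0 //; lia.
apply: (@isolated_ones_absurd w m hw iso m0).
- exists a; apply/run_gapP; split=> // -[|k] // km.
  by rewrite -addSnnS inner ?p0 //; lia.
- move=> i l ci; rewrite ltnNge; apply/negP => lm.
  have /run_gapP[l0 wi wl _] := ci.
  have h0 : ones w b l.+1 = 0 by apply/ones0P => t tl; apply: zb; lia.
  have h2 : 2 <= ones w i l.+1.
    by rewrite -(prednK l0) onesS onesSr addSnnS prednK // wi wl; lia.
  by have := bal l.+1 _ i b; rewrite h0; lia.
- by apply: (@zeros_gap w b m.+2 rec) => //; exists a.
Qed.

Lemma two_or_three_balanced w n : two_or_three w -> balanced_at w n.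
Proof.
move=> hw; have [rec _ _] := hw; elim/ltn_ind: n => n bal a b.
rewrite leqNgt; apply/negP => im.
have {}im : ones w b n + 2 <= ones w a n by lia.
have [e|[e|[m em]]] : n = 0 \/ (n = 1 \/ exists m, n = m.+2).
  by case: n {bal im} => [|[|m]]; [left | right; left | right; right; exists m].
- by move: im; rewrite e /=; lia.
- by move: im; have := ones_le w a n; rewrite e; lia.
subst n; have [wa wa' wb wb' inner] := imbalance_inner bal im.
have [m0|m0] := posnP m.
  subst m; apply: (double_square_absurd hw).
    by exists a; apply/run_gapP; split=> // -[|k].
  by exists b; apply/run_gapP; split=> //; rewrite /negw ?wb ?wb' // => -[|k].
have bal2 : balanced_at w 2 by apply: bal; lia.
have [[i [wi wi1]]|no11] := pselect (exists i, w i /\ w i.+1).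
  have hn : forall k, k < m.+2 -> balanced_at (negw w) k.
    move=> k km i1 i2; have := bal k km i2 i1.
    by have := ones_negw w i1 k; have := ones_negw w i2 k; lia.
  apply: (@imbalance_isolated_absurd (negw w) m b a) => //.
  - exact: two_or_three_negw.
  - move=> j; rewrite /negw => /negbTE wj; apply/negbTE/negPn.
    apply: contraT => /negbTE wj1; have := bal2 i j.
    by rewrite /= wi wi1 wj wj1.
  - by have := ones_negw w a m.+2; have := ones_negw w b m.+2; lia.
apply: (@imbalance_isolated_absurd w m a b) => // i wi.
by apply/negP => wi1; apply: no11; exists i.
Qed.

(** * Nonconstant window sums *)

(** The returns to the empty word are the letters, so a letter that ceases to occur leaves a single
    return. *)
Lemma letter_recurs w b B : two_or_three w -> exists2 i, B <= i & w i = b.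
Proof.
move=> hw; apply: contrapT => no.
have {}no i : B <= i -> w i = ~~ b.
  move=> Bi; have : w i <> b by move=> e; apply: no; exists i.
  by case: (w i); case: (b).
apply: (@not_single_return w 0 0 0 B 1 (~~ b) hw) => // i j Bi [ij _ _ h].
have e : j = i.+1.
  by apply/eqP; rewrite eqn_leq ij andbT leqNgt; apply/negP => lt; case: (h i.+1) => //; lia.
by rewrite e subSnn /= no // addn0.
Qed.

(* In a balanced word the sets of positions where the windows of a given
   length are heavy form a chain. *)
Lemma balanced_chain w i j m n : (forall k, balanced_at w k) ->
  ones w j m < ones w i m -> ones w j n <= ones w i n.
Proof.
move=> bal hm; rewrite leqNgt; apply/negP => hn.
have [mn|nm] := leqP m n.
  have := bal (n - m) (j + m) (i + m).
  have := ones_cat w i m (n - m); have := ones_cat w j m (n - m); rewrite subnKC //.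
  by lia.
have := bal (m - n) (i + n) (j + n).
have := ones_cat w i n (m - n); have := ones_cat w j n (m - n); rewrite subnKC ?(ltnW nm) //.
by lia.
Qed.

Lemma ones_ext_letters w i j : (forall n, ones w i n = ones w j n) ->
  forall t, w (i + t) = w (j + t).
Proof.
by move=> h t; have := h t.+1; rewrite !onesSr h => /addnI; case: (w _); case: (w _).
Qed.

(** By the chain property the smallest heavy set modulo the least period p lies in all the others.
    Windows of equal length at two of its elements therefore have equal weight, so w reads the same
    from both and their distance is a period. The set has one element per period. *)
Lemma two_or_three_nonconstant w n : two_or_three w -> 0 < n ->
  exists i j, ones w i n < ones w j n.
Proof.
move=> hw n0; have bal k := @two_or_three_balanced w k hw.
apply: contrapT => no.
pose period p := forall i, w (i + p) = w i.
have const_period p : (forall i j, ~ ones w i p < ones w j p) -> period p.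
  move=> h i; have := ones_slide w i p; have := h i i.+1; have := h i.+1 i.
  by case: (w i); case: (w (i + p)) => //=; lia.
have ex : exists p, (0 < p) && `[< period p >].
  by exists n; rewrite n0; apply/asboolP/const_period => i j ij; apply: no; exists i, j.
case: (ex_minnP ex) => p /andP[p0 /asboolP per] pmin.
have ones_per i m : ones w (i + p) m = ones w i m.
  by apply: eq_ones => t _; rewrite addnAC per.
have per_mul i k : w (i + k * p) = w i.
  by elim: k => [|k IH]; [rewrite addn0 | rewrite mulSnr addnA per].
pose heavy m i := `[< exists j, ones w j m < ones w i m >].
have heavyP m i j : heavy m i -> ~~ heavy m j -> ones w i m = (ones w j m).+1.
  move=> /asboolP[k hk] /asboolP nh; have := bal m i j; have := bal m i k.
  have jk : ones w j m <= ones w k m by rewrite leqNgt; apply/negP => lt; apply: nh; exists k.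
  by lia.
have heavy_eq m i j : heavy m i -> heavy m j -> ones w i m = ones w j m.
  move=> /asboolP[k hk] /asboolP[k' hk']; have := bal m i k'; have := bal m j k.
  by lia.
have light_eq m i j : ~~ heavy m i -> ~~ heavy m j -> ones w i m = ones w j m.
  move=> /asboolP n1 /asboolP n2; apply/eqP; rewrite eqn_leq.
  by apply/andP; split; rewrite leqNgt; apply/negP => lt; [apply: n1; exists j | apply: n2; exists i].
have heavy_per m i : heavy m (i + p) = heavy m i.
  by apply: asbool_equiv_eq; rewrite ones_per.
have heavy_ex m : 0 < m < p -> exists i, heavy m i.
  move=> /andP[m0 mp]; apply: contrapT => noh.
  have : p <= m.
    apply: pmin; rewrite m0; apply/asboolP/const_period => i j ij.
    by apply: noh; exists j; apply/asboolP; exists i.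
  by lia.
have p1 : 1 < p.
  rewrite ltn_neqAle p0 andbT; apply/eqP => e1.
  have all0 i : w i = w 0.
    by elim: i => // i <-; have := per i; rewrite -e1 addn1.
  by have [i _ wi] := letter_recurs (~~ w 0) 0 hw; move: wi; rewrite all0; case: (w 0).
pose S m := [set i : 'I_p | heavy m i].
have [m0 m0p] : exists m, 0 < m < p by exists 1.
pose good m := [exists m' : 'I_p, (0 < m') && (m == #|S m'|)].
have exg : exists m, good m.
  exists #|S m0|; apply/existsP; have mp : m0 < p by case/andP: m0p.
  by exists (Ordinal mp); rewrite /= eqxx andbT; case/andP: m0p.
case: (ex_minnP exg) => sz /existsP[[m mp] /andP[/= mpos /eqP esz]] szmin.
have heavy_mod r i : heavy r (i %% p) = heavy r i.
  rewrite [in RHS](divn_eq i p) addnC.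
  by elim: (i %/ p) => [|k IH]; [rewrite addn0 | rewrite mulSnr addnA heavy_per].
(* If i were not in S r, the chain property would place S r properly inside the smallest set S m. *)
have sub r i : 0 < r < p -> heavy m i -> heavy r i.
  move=> /andP[r0 rp] hi; apply: contraT => nr.
  have : sz <= #|S r|.
    by apply: szmin; apply/existsP; exists (Ordinal rp); rewrite /= r0 eqxx.
  rewrite esz leqNgt => /negP[]; apply: proper_card; apply/properP; split.
    apply/fintype.subsetP => j; rewrite !finset.in_set => hj; apply: contraT => nj.
    have := heavyP _ _ _ hi nj; have := heavyP _ _ _ hj nr => e1 e2.
    by have := @balanced_chain w i j m r bal; rewrite e1 e2 => /(_ (ltnSn _)); rewrite ltnn.
  have ip : i %% p < p by rewrite ltn_mod.
  by exists (Ordinal ip); rewrite !finset.in_set /= heavy_mod.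
have same i j k : heavy m i -> heavy m j -> ones w i k = ones w j k.
  move=> hi hj.
  have hp a b : ones w a p = ones w b p.
    have E a' : ones w a' p = ones w 0 p.
      elim: a' => // a' <-; have := ones_slide w a' p; rewrite per; lia.
    by rewrite (E a) (E b).
  have hr : ones w i (k %% p) = ones w j (k %% p).
    have [->//|kn] := eqVneq (k %% p) 0.
    have kp : 0 < k %% p < p by rewrite lt0n kn ltn_mod.
    by apply: heavy_eq; apply: sub.
  rewrite (divn_eq k p) addnC; elim: (k %/ p) => [|q IH]; first by rewrite addn0.
  by rewrite mulSnr addnA !(ones_cat _ _ (k %% p + q * p)) IH (hp (i + _) (j + (k %% p + q * p))).
have dist i j : i < j -> heavy m i -> heavy m j -> p <= j - i.
  move=> ij hi hj; apply: pmin; rewrite subn_gt0 ij; apply/asboolP => x.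
  have eq := ones_ext_letters (fun k => same i j k hi hj).
  rewrite -(per_mul (x + (j - i)) i) -(per_mul x i).
  have := eq (x + i * p - i); rewrite subnKC; last by nia.
  by move=> ->; congr w; nia.
have [|i0 hi0] := heavy_ex m; first by rewrite mpos mp.
have cls i : ones w i m = ones w i0 m -> heavy m i.
  by move=> e; apply: contraT => ni; have := heavyP _ _ _ hi0 ni; lia.
have onesp i : ones w i p = ones w 0 p.
  by elim: i => // i <-; have := ones_slide w i p; rewrite per; lia.
apply: (@not_single_return w m (ones w i0 m) i0 0 p (ones w 0 p) hw erefl).
move=> i j _ [ij hi hj hn].
have -> : j - i = p; last by rewrite onesp.
apply/eqP; rewrite eqn_leq dist ?(cls _ hi) ?(cls _ hj) // andbT leqNgt.
by apply/negP => lt; apply: (hn (i + p)); [lia | rewrite ones_per].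
Qed.

(** * Returns in balanced words *)

Definition nonconstant_at (w : nat -> bool) (n : nat) : Prop :=
  exists i j, ones w i n < ones w j n.

Definition three_gaps (w : nat -> bool) (n c : nat) : Prop :=
  exists l1 o1 l2 o2,
    [/\ (l1, o1) <> (l2, o2), return_type w n c l1 o1, return_type w n c l2 o2 &
        forall l o, return_type w n c l o ->
          [\/ (l, o) = (l1, o1), (l, o) = (l2, o2) | (l, o) = (l1 + l2, o1 + o2)]].

Lemma balanced_min w n : balanced_at w n -> nonconstant_at w n ->
  exists k, [/\ forall i, k <= ones w i n <= k.+1,
    exists i, ones w i n = k & exists i, ones w i n = k.+1].
Proof.
move=> bal [i [j ij]]; exists (ones w i n).
have ej : ones w j n = (ones w i n).+1 by have := bal j i; lia.
split; [move=> l | by exists i | by exists j].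
by have := bal l i; have := bal j l; lia.
Qed.

(* A is the class of the heavy windows of length n. With p the least distance
   of two elements of A separated by a heavy window and q the least one for a
   light window, the elements of A are p, q or p + q apart. *)
Section Heavy.

Variables (w : nat -> bool) (n K : nat) (low : nat -> nat).
Hypothesis rec : uniformly_recurring w.
Hypothesis bal : forall r, balanced_at w r.
Hypothesis n0 : 0 < n.
Hypothesis lowP : forall r, 0 < r ->
  [/\ forall i, low r <= ones w i r <= (low r).+1,
    exists i, ones w i r = low r & exists i, ones w i r = (low r).+1].
Hypothesis lown : low n = K.

Let range r i : 0 < r -> low r <= ones w i r <= (low r).+1.
Proof. by case/lowP. Qed.

Let low_add r s : 0 < r -> 0 < s -> low r + low s <= low (r + s) <= (low r + low s).+1.
Proof.
move=> r0 s0; have rs0 : 0 < r + s by lia.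
have [_ [i hi] _] := lowP rs0; have := range i r0; have := range (i + r) s0.
move: hi; rewrite ones_cat; have [_ [j hj] _] := lowP r0.
have := range j rs0; have := range (j + r) s0; rewrite ones_cat hj; lia.
Qed.

Let A i := ones w i n == K.+1.

(** In [ones_shift] a minimal weight of the block of length r forces the window at i + r to be at
    least as heavy as the one at i, which is maximal. *)
Let low_return r i : 0 < r -> A i -> ones w i r = low r -> A (i + r).
Proof.
move=> r0 /eqP Ai hi; apply/eqP; have := ones_shift w i n r; have := range (i + r) n0.
by have := range (i + n) r0; rewrite lown; lia.
Qed.

Let high_origin r i : 0 < r -> A (i + r) -> ones w i r = (low r).+1 -> A i.
Proof.
move=> r0 /eqP Ai hi; apply/eqP; have := ones_shift w i n r; have := range i n0.
by have := range (i + n) r0; rewrite lown; lia.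
Qed.

Let skipped_high r i : 0 < r -> A i -> ~~ A (i + r) -> ones w i r = (low r).+1.
Proof.
move=> r0 Ai nA; have := range i r0.
have [hl|] := eqVneq (ones w i r) (low r); last by lia.
by rewrite low_return in nA.
Qed.

Let class_above r i j : 0 < r -> A i -> ones w i r < ones w j r -> A j.
Proof.
move=> r0 /eqP Ai h; apply/eqP; have := balanced_chain n bal h.
by have := range j n0; rewrite lown; lia.
Qed.

Let A_recurs i B : A i -> exists2 a, B <= a & A a.
Proof.
move=> /eqP Ai; have [a Ba ha] := rec i n B; exists a => //.
by apply/eqP; rewrite -Ai; apply: eq_ones.
Qed.

Let high_pair r := 0 < r /\ exists i, [/\ A i, A (i + r) & ones w i r = (low r).+1].
Let low_start r := 0 < r /\ exists2 i, A i & ones w i r = low r.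

(** A heavy block of length r can start only in A, by [class_above]. Shifting such a start j against
    a later light start a in A makes the block from j to a heavy. *)
Let low_high r : low_start r -> exists r', high_pair r'.
Proof.
move=> [r0 [i Ai hi]]; have [_ _ [j hj]] := lowP r0.
have Aj : A j by apply: (class_above r0 Ai); rewrite hj hi.
have [a ja Aa] : exists2 a, j < a & A a /\ ones w a r = low r.
  have [a ja ha] := rec i (n + r) j.+1; exists a => //; split.
    by rewrite /A (_ : ones w a n = ones w i n) //; apply: eq_ones => t tn; apply: ha; lia.
  by rewrite -hi; apply: eq_ones => t tn; apply: ha; lia.
case: Aa => Aa har; exists (a - j); split; first by lia.
exists j; rewrite subnKC; last by lia.
split=> //; have := ones_shift w j r (a - j); rewrite subnKC; last by lia.
by have := @range (a - j) j; have := @range (a - j) (j + r); rewrite subn_gt0; lia.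
Qed.

Let high_low r : high_pair r -> exists r', low_start r'.
Proof.
move=> [r0 [a [Aa Aar ha]]]; have [_ [j0 hj0] _] := lowP r0.
have [j aj hj] : exists2 j, a < j & ones w j r = low r.
  by have [j aj hj] := rec j0 r a.+1; exists j => //; rewrite -hj0; apply: eq_ones.
exists (j - a); split; [by rewrite subn_gt0|].
exists (a + r) => //; have := ones_shift w a r (j - a); rewrite subnKC; last by lia.
by have := @range (j - a) a; have := @range (j - a) (a + r); rewrite subn_gt0; lia.
Qed.

Lemma three_gaps_heavy : three_gaps w n K.+1.
Proof.
have [_ _ [i0 /eqP Ai0]] := lowP n0; rewrite lown -/(A i0) in Ai0.
have exH : exists r, `[< high_pair r >].
  have [a ia Aa] := A_recurs i0.+1 Ai0.
  have d0 : 0 < a - i0 by lia.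
  have : (exists r, high_pair r); last by case=> r hr; exists r; apply/asboolP.
  have := range i0 d0; have [e|ne _] := eqVneq (ones w i0 (a - i0)) (low (a - i0)).
    by move=> _; apply: (@low_high (a - i0)); split=> //; exists i0.
  exists (a - i0); split=> //; exists i0; rewrite subnKC; last by lia.
  by split=> //; have := range i0 d0; lia.
have exL : exists r, `[< low_start r >].
  by have [r /asboolP hr] := exH; have [r' ?] := high_low hr; exists r'; apply/asboolP.
case: (ex_minnP exH) => p /asboolP[p0 [x [Ax Axp hx]]] pmin.
case: (ex_minnP exL) => q /asboolP[q0 [y Ay hy]] qmin {exH exL}.
have high_ge r i : 0 < r -> A i -> A (i + r) -> ones w i r = (low r).+1 -> p <= r.
  by move=> r0 *; apply: pmin; apply/asboolP; split=> //; exists i.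
have low_ge r i : 0 < r -> A i -> ones w i r = low r -> q <= r.
  by move=> r0 *; apply: qmin; apply/asboolP; split=> //; exists i.
have ret i l : 0 < l -> A i -> A (i + l) -> (forall r, 0 < r < l -> ~~ A (i + r)) ->
    consecutive w n K.+1 i (i + l).
  move=> l0 /eqP ? /eqP ? h; apply: consecutiveI => // r /h /eqP; exact.
exists p, (low p).+1, q, (low q); split.
- by case=> epq; rewrite epq; lia.
- exists x; split=> //; apply: ret => // r /andP[r0 rp]; apply/negP => Axr.
  have s0 : 0 < p - r by lia.
  have := low_add r0 s0; have := ones_cat w x r (p - r); rewrite subnKC ?hx; last by lia.
  have := range x r0; have := range (x + r) s0.
  have := high_ge r x r0 Ax Axr; have := high_ge (p - r) (x + r) s0 Axr.
  by rewrite -addnA subnKC ?Axp; last (by lia); lia.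
- exists y; split=> //; apply: ret => //; first exact: low_return.
  move=> r /andP[r0 rq]; apply/negP => Ayr.
  have s0 : 0 < q - r by lia.
  have := low_add r0 s0; have := ones_cat w y r (q - r); rewrite subnKC ?hy; last by lia.
  have := range y r0; have := range (y + r) s0.
  have := low_ge r y r0 Ay; have := low_ge (q - r) (y + r) s0 Ayr; lia.
move=> l o [i [[il /eqP Ai /eqP Ail hn] <-]]; rewrite -/(A i) -/(A (i + l)) in Ai Ail.
have l0 : 0 < l by lia.
have skip r : 0 < r < l -> ~~ A (i + r).
  by move=> hr; apply/eqP; apply: hn; lia.
have highr r : 0 < r < l -> ones w i r = (low r).+1.
  by move=> hr; apply: skipped_high => //; [lia | apply: skip].
(* As i + p is skipped, the block of length q there is light like the one at y. Hence the block of
   length p at i + q is light, and balance against the heavy pair at x makes the window after it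
   heavy. *)
have key : p < l -> q < l -> A (i + (p + q)) /\ ones w i (p + q) = (low p).+1 + low q.
  move=> pl ql; have hp := highr p; have hq := highr q.
  have lq : ones w (i + p) q = low q.
    have := range (i + p) q0; have := @class_above q y (i + p) q0 Ay.
    by have := skip p; rewrite hy p0 pl => /(_ isT) /negbTE ->; lia.
  have e := ones_cat w i p q; rewrite lq hp in e; last by lia.
  split=> //; apply/eqP; have := ones_cat w i q p; rewrite addnC e hq; last by lia.
  have := @bal (p + n) x (i + q); rewrite !ones_cat hx (eqP Axp).
  have := range (i + (p + q)) n0; rewrite lown -addnA (addnC q p); lia.
have done_ : p + q <= l -> (l, ones w i l) = (p + q, (low p).+1 + low q).
  move=> pql; have [Apq e] : A (i + (p + q)) /\ ones w i (p + q) = (low p).+1 + low q.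
    by apply: key; lia.
  have -> : l = p + q; last by rewrite e.
  apply/eqP; rewrite eqn_leq pql andbT leqNgt; apply/negP => lt.
  by have := skip (p + q); rewrite Apq => /(_ _) H; apply: notF; rewrite -[false]/(~~ true) H; lia.
(* It remains to see that l is at least p + q unless it is p or q. The rest of l beyond q is a heavy
   pair starting at y + q; in the other case, the rest beyond p is a light start at x + p. *)
have [lowl|] := eqVneq (ones w i l) (low l).
  have ql := low_ge l i l0 Ai lowl.
  have [eq|ne] := eqVneq l q; first by apply: Or32; rewrite eq -eq lowl eq.
  apply: Or33; apply: done_.
  have r0 : 0 < l - q by lia.
  have e := subnKC ql.
  have := low_add q0 r0; have := ones_cat w y q (l - q); have := ones_cat w i (l - q) q.
  rewrite subnK // e hy => e1 e2 e3.
  have hr := highr (l - q); have rq := range (i + (l - q)) q0.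
  have ry := range (y + q) r0; have rl := range y l0.
  have Ayq := low_return q0 Ay hy.
  have Ayl : A (y + q + (l - q)).
    rewrite -addnA e; apply: low_return => //; lia.
  have := high_ge (l - q) (y + q) r0 Ayq Ayl; lia.
move=> nl; have highl : ones w i l = (low l).+1 by have := range i l0; lia.
have pl := high_ge l i l0 Ai Ail highl.
have [ep|ne] := eqVneq l p; first by apply: Or31; rewrite highl ep.
apply: Or33; apply: done_.
have r0 : 0 < l - p by lia.
have e := subnKC pl.
have lowr : ones w (i + p) (l - p) = low (l - p).
  have := range (i + p) r0; have := @high_origin (l - p) (i + p) r0.
  have := skip p; rewrite -addnA e; lia.
have := ones_cat w i p (l - p); rewrite e highl (highr p) ?lowr; last by lia.
have := ones_cat w x p (l - p); rewrite e hx.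
have := range x l0; have := range (x + p) r0; have := low_ge (l - p) (x + p) r0 Axp.
lia.
Qed.

End Heavy.

Lemma three_gaps_negw w n c : c <= n -> three_gaps (negw w) n (n - c) -> three_gaps w n c.
Proof.
move=> cn [l1 [o1 [l2 [o2 [ne r1 r2 all]]]]].
have [_ ol1] := return_type_le r1; have [_ ol2] := return_type_le r2.
exists l1, (l1 - o1), l2, (l2 - o2); rewrite -(subKn cn); split.
- by case=> *; apply: ne; congr (_, _); lia.
- by apply: return_type_negw; rewrite ?leq_subr.
- by apply: return_type_negw; rewrite ?leq_subr.
move=> l o r; have [_ ol] := return_type_le r.
have r' : return_type (negw w) n (n - c) l (l - o).
  case: r => i [hc ho]; exists i; split; last by have := ones_negw w i l; lia.
  by rewrite subKn // in hc; apply/consecutive_negw.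
by case: (all _ _ r') => -[? ?]; [apply: Or31 | apply: Or32 | apply: Or33]; congr (_, _); lia.
Qed.

Lemma three_gaps_letter w : uniformly_recurring w -> nonconstant_at w 1 ->
  three_gaps w 0 0.
Proof.
move=> rec [a [b h]].
have [wa wb] : w a = false /\ w b = true by move: h; rewrite /=; case: (w a); case: (w b).
have C i : consecutive w 0 0 i (i + 1) by split=> //; [lia | move=> k; lia].
exists 1, 0, 1, 1; split=> //.
- by exists a; rewrite /= wa.
- by exists b; rewrite /= wb.
move=> l o [i [hc <-]]; have := consecutive_inj hc (C i) => /addnI ->.
by rewrite /=; case: (w i); [apply: Or32 | apply: Or31].
Qed.

Lemma balanced_three_gaps w n i : uniformly_recurring w ->
  (forall r, balanced_at w r) -> (forall r, 0 < r -> nonconstant_at w r) ->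
  three_gaps w n (ones w i n).
Proof.
move=> rec bal nonc; case: n => [|n]; first exact: three_gaps_letter (nonc 1 isT).
have main v : uniformly_recurring v ->
  (forall r, balanced_at v r) -> (forall r, 0 < r -> nonconstant_at v r) ->
  forall j k, ones v j n.+1 < ones v k n.+1 -> three_gaps v n.+1 (ones v k n.+1).
  move=> vrec vbal vnonc j k jk.
  have H r : exists l, 0 < r -> [/\ forall i, l <= ones v i r <= l.+1,
      exists i, ones v i r = l & exists i, ones v i r = l.+1].
    have [->|r0] := posnP r; first by exists 0.
    by have [l hl] := balanced_min (vbal r) (vnonc r r0); exists l.
  have [low lowP] := choice H.
  have [range _ _] := lowP n.+1 isT.
  have -> : ones v k n.+1 = (low n.+1).+1 by have := range j; have := range k; lia.
  by apply: (@three_gaps_heavy v n.+1 _ low).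
have [j [k jk]] := nonc n.+1 isT.
have [/(main w rec bal nonc)//|ij] := ltnP (ones w j n.+1) (ones w i n.+1).
have E r l := ones_negw w l r.
apply: three_gaps_negw; first exact: ones_le.
have -> : n.+1 - ones w i n.+1 = ones (negw w) i n.+1 by have := E n.+1 i; lia.
apply: (main (negw w) _ _ _ k).
- by move=> a L B; have [b ? h] := rec a L B; exists b => // t tL; rewrite /negw h.
- by move=> r a b; have := bal r b a; have := E r a; have := E r b; lia.
- by move=> r /nonc[a [b ?]]; exists b, a; have := E r a; have := E r b; lia.
by have := E n.+1 i; have := E n.+1 k; lia.
Qed.

(** * Right special words *)

Definition agree (w : nat -> bool) (n i j : nat) : Prop :=
  forall t, t < n -> w (i + t) = w (j + t).

(** Two occurrences witnessing that the block of length n at i is right special. *)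
Definition special (w : nat -> bool) (n i j : nat) : Prop :=
  [/\ agree w n i j, w (i + n) = false & w (j + n) = true].

Definition one_special (w : nat -> bool) (n : nat) : Prop :=
  (exists i j, special w n i j) /\
  (forall i j i' j', special w n i j -> special w n i' j' -> agree w n i i').

Lemma agree_pigeonhole (w : nat -> bool) n B :
  exists i j, [/\ B <= i, i < j & agree w n i j].
Proof.
pose f (k : 'I_(2 ^ n).+1) := [ffun t : 'I_n => w (B + k + t)].
have : ~~ injectiveb f.
  by apply/injectiveP => /leq_card; rewrite card_ffun card_bool !card_ord ltnn.
case/injectivePn => x [y ne /ffunP e].
have H (x' y' : 'I_(2 ^ n).+1) : f x' =1 f y' -> agree w n (B + x') (B + y').
  by move=> h t tn; have := h (Ordinal tn); rewrite !ffunE.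
have [xy|xy] := ltnP x y.
  by exists (B + x), (B + y); split; [lia | lia | apply: H].
exists (B + y), (B + x); split; [lia | | by apply: H => t; rewrite e].
have : (x : nat) != y by []. lia.
Qed.

(* Two right special words of the same length, aligned from their last
   disagreement on, would yield the windows 0p0 and 1p1. *)
Lemma balanced_special_agree w n i j i' j' : (forall r, balanced_at w r) ->
  special w n i j -> special w n i' j' -> agree w n i i'.
Proof.
move=> bal [h hi hj] [h' hi' hj'].
have clash a b s : s <= n -> w (a + (n - s)) = false -> w (b + (n - s)) = true ->
    (forall t, n - s < t < n -> w (a + t) = w (b + t)) ->
    w (a + n) = false -> w (b + n) = true -> s = 0.
  move=> sn wa wb E wa' wb'; case: s sn wa wb E => // s sn wa wb E.
  have := @bal s.+2 (b + (n - s.+1)) (a + (n - s.+1)).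
  rewrite !(onesS _ _ s.+1) wa wb !(onesSr _ _ s).
  have idx x : (x + (n - s.+1)).+1 + s = x + n by move: sn; clear; lia.
  rewrite !idx wa' wb'.
  have -> : ones w (a + (n - s.+1)).+1 s = ones w (b + (n - s.+1)).+1 s.
    by apply: eq_ones => t ts; rewrite !addSnnS -!addnA E //; lia.
  lia.
have all s : s <= n -> forall t, n - s <= t < n -> w (i + t) = w (i' + t).
  elim: s => [|s IH] sn t ht; first by lia.
  have [?|e] := ltnP (n - s.+1) t; first by apply: IH; lia.
  have {ht e} -> : t = n - s.+1 by lia.
  have IHs u : n - s.+1 < u < n -> w (i + u) = w (i' + u) by move=> ?; apply: IH; lia.
  case e: (w (i + (n - s.+1))); case e': (w (i' + (n - s.+1))) => //.
    suff : s.+1 = 0 by [].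
    apply: (@clash i' j s.+1) => //; first by rewrite -h //; lia.
    by move=> u hu; rewrite -IHs // h //; lia.
  suff : s.+1 = 0 by [].
  apply: (@clash i j' s.+1) => //; first by rewrite -h' //; lia.
  by move=> u hu; rewrite IHs // h' //; lia.
by move=> t tn; apply: (all n) => //; lia.
Qed.

Lemma agree_period w n i j : (forall a b, ~ special w n a b) -> agree w n i j ->
  forall t, agree w n (i + t) (j + t).
Proof.
move=> no ij; elim=> [|t IH]; first by rewrite !addn0.
have next : w (i + t + n) = w (j + t + n).
  case e: (w (i + t + n)); case e': (w (j + t + n)) => //.
    by case: (no (j + t) (i + t)); split=> // u un; rewrite IH.
  by case: (no (i + t) (j + t)).
move=> u un; rewrite !addnS !addSnnS; have [<-//|ne] := eqVneq n u.+1.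
by apply: IH; lia.
Qed.

(** Without special words, two agreeing windows agree forever after. Then w is periodic from there
    on, and recurrence makes the window sums over that period constant everywhere. *)
Lemma special_exists w n : uniformly_recurring w ->
  (forall r, 0 < r -> nonconstant_at w r) -> exists i j, special w n i j.
Proof.
move=> rec nonc; apply: contrapT => no.
have {}no a b : ~ special w n a b by move=> h; apply: no; exists a, b.
have [i [j [_ ij h]]] := agree_pigeonhole w n.+1 0.
have per t : w (i + t + (j - i)) = w (i + t).
  rewrite addnAC subnKC ?(ltnW ij) //.
  have hn : agree w n i j by move=> u un; apply: h; lia.
  have [n0|n0] := posnP n; last by have := agree_period no hn t n0; rewrite !addn0.
  suff H x y : w x = w y by apply: H.
  have := no x y; have := no y x; rewrite /special n0 !addn0.
  by case: (w x); case: (w y) => // h1 h2; [case: h1 | case: h2].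
have const t : ones w (i + t) (j - i) = ones w i (j - i).
  elim: t => [|t <-]; first by rewrite addn0.
  have := ones_slide w (i + t) (j - i); rewrite per addnS; lia.
have far x : ones w x (j - i) = ones w i (j - i).
  have [y iy hy] := rec x (j - i) i.
  by rewrite -(eq_ones hy) -(subnKC iy) const.
have [|x [y]] := nonc (j - i); first by lia.
by rewrite !far ltnn.
Qed.

Lemma two_or_three_one_special w n : two_or_three w -> one_special w n.
Proof.
move=> hw; have bal r := @two_or_three_balanced w r hw; split.
  apply: special_exists => [|r]; [by case: hw | exact: two_or_three_nonconstant].
by move=> i j i' j'; apply: balanced_special_agree.
Qed.

(** Having at most n + 1 factors of length n, in the pigeonhole form in which it is applied. *)
Definition few_blocks (w : nat -> bool) (n : nat) : Prop :=
  forall f : nat -> nat, exists i j, i < j <= n.+1 /\ agree w n (f i) (f j).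

(** Let u and v be the prefix and the suffix of p of length l. Balance of 1u against v0, and of v1
    against 0u, gives them the same number of ones, for every l. *)
Lemma imbalance_palindrome w m a b :
  (forall k, k < m.+2 -> balanced_at w k) ->
  ones w b m.+2 + 2 <= ones w a m.+2 ->
  forall t, t < m -> w (a.+1 + (m - t.+1)) = w (a.+1 + t).
Proof.
move=> bal im; have [wa wa' wb wb' p] := imbalance_inner bal im.
have E l : l <= m -> ones w (a.+1 + (m - l)) l = ones w a.+1 l.
  move=> lm; have e1 : ones w b.+1 l = ones w a.+1 l.
    by apply: eq_ones => t tl; rewrite p //; lia.
  have e2 : ones w (b.+1 + (m - l)) l = ones w (a.+1 + (m - l)) l.
    by apply: eq_ones => t tl; rewrite -!addnA p //; lia.
  have idx x : x.+1 + (m - l) + l = x + m.+1 by move: lm; clear; lia.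
  have := bal l.+1 _ a (b.+1 + (m - l)); have := bal l.+1 _ (a.+1 + (m - l)) b.
  rewrite !(onesSr _ (_ + (m - l))) !idx wa' wb' e2 !onesS wa wb e1; lia.
move=> t tm; have := E t (ltnW tm); have := E t.+1 tm.
have idx : (a.+1 + (m - t.+1)).+1 = a.+1 + (m - t) by move: tm; clear; lia.
rewrite onesS onesSr idx; case: (w _); case: (w _) => //=; clear; lia.
Qed.

(* At a first imbalance 0p0, 1p1 the palindrome p is the special word of its
   length, and the special word of the next length is xp for a letter x. With
   y the other letter, xp occurs nowhere in the windows starting inside ypy;
   these are more numerous than the remaining words, so that w is periodic
   from there on and never meets xp again. *)
Lemma one_special_balanced w n : uniformly_recurring w ->
  (forall r, one_special w r) -> (forall r, few_blocks w r) -> balanced_at w n.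
Proof.
move=> rec sp few; elim/ltn_ind: n => n bal a b; rewrite leqNgt; apply/negP => im.
case: n bal im => [|[|m]] bal im; [by [] | by move: im; rewrite /=; lia |].
have {}im : ones w b m.+2 + 2 <= ones w a m.+2 by lia.
have pal := imbalance_palindrome bal im.
have [wa wa' wb wb' p] := imbalance_inner bal im.
have pS : special w m b.+1 a.+1.
  by split; [move=> t tm; rewrite p | rewrite addSnnS | rewrite addSnnS].
have [[i [j ij]] uniq] := sp m.+1.
have ip t : t < m -> w (i.+1 + t) = w (a.+1 + t).
  move=> tm; rewrite p //; case: ij => hij wi wj; have [_ uq] := sp m.
  apply: (uq i.+1 j.+1 b.+1 a.+1) => //; split; rewrite ?addSnnS //.
  by move=> u um; rewrite !addSnnS hij.
have [c [wc wc' cp]] : exists c, [/\ w c = ~~ w i, w (c + m.+1) = ~~ w i &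
    forall t, t < m -> w (c.+1 + t) = w (a.+1 + t)].
  case: (w i); first by exists b; split=> // t tm; rewrite p.
  by exists a.
(* An occurrence of xp at distance 0 < s <= m would make letter s - 1 of p equal to x and letter m -
   s equal to y, against the palindrome. *)
have avoid s : s <= m.+1 -> ~ agree w m.+1 i (c + s).
  move=> sm h; have := h 0; rewrite !addn0 => /(_ isT).
  have [->|s0] := posnP s; first by rewrite addn0 wc; case: (w i).
  have [->|sn] := eqVneq s m.+1; first by rewrite wc'; case: (w i).
  have lt : m.+1 - s < m.+1 by move: s0; clear; lia.
  have := h _ lt; rewrite -addnA subnKC // wc'.
  have -> : i + (m.+1 - s) = i.+1 + (m - s) by move: s0 sm sn; clear; lia.
  have -> : c + s = c.+1 + s.-1 by move: s0; clear; lia.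
  rewrite ip ?cp; [|by move: s0 sm sn; clear; lia|by move: s0 sm sn; clear; lia].
  rewrite -[in w (a.+1 + s.-1)]pal; last by move: s0 sm sn; clear; lia.
  have -> : m - s.-1.+1 = m - s by move: s0; clear; lia.
  by move=> -> ; case: (w i).
(* There are m + 3 positions, namely i and the m + 2 starts inside ypy, but only m + 2 factors of
   length m + 1. *)
have [k [l [kl akl]]] := few m.+1 (fun k => if k is k'.+1 then c + k' else i).
case: k l kl akl => [|k] [|l] //= kl akl; first by apply: (avoid l) akl; lia.
have next x y : agree w m.+1 x y -> ~ agree w m.+1 i x -> agree w m.+1 x.+1 y.+1.
  move=> xy nx t tm; rewrite !addSnnS; have [lt|ge] := ltnP t.+1 m.+1; first exact: xy.
  have -> : t.+1 = m.+1 by lia.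
  case ex : (w (x + m.+1)); case ey : (w (y + m.+1)) => //.
    have yx : special w m.+1 y x by split=> // u um; rewrite xy.
    by case: nx => u um; rewrite xy //; apply: (uniq i j y x).
  have xy' : special w m.+1 x y by [].
  by case: nx; apply: (uniq i j x y).
have forever t : agree w m.+1 (c + k + t) (c + l + t) /\ ~ agree w m.+1 i (c + k + t).
  elim/ltn_ind: t => t IH.
  have cyc : agree w m.+1 (c + k + t) (c + l + t).
    case: t IH => [|t] IH; first by rewrite !addn0.
    by have [? ?] := IH t (ltnSn t); rewrite !addnS; apply: next.
  split=> //; have [lt|ge] := ltnP t (l - k).
    by rewrite -addnA; apply: avoid; lia.
  have lt : t - (l - k) < t by lia.
  have [h nh] := IH _ lt; move=> bad; apply: nh => u um; rewrite bad //.
  have -> : c + k + t = c + l + (t - (l - k)) by lia.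
  by rewrite h.
have [x cx hx] := rec i m.+1 (c + k).
have [_ []] := forever (x - (c + k)); rewrite subnKC // => t tm; by rewrite hx.
Qed.

Lemma one_special_nonconstant w n : (forall r, one_special w r) -> 0 < n ->
  nonconstant_at w n.
Proof.
move=> sp n0; apply: contrapT => no.
have eq i j : ones w i n = ones w j n.
  by apply/eqP; rewrite eqn_leq; apply/andP; split; rewrite leqNgt; apply/negP => lt;
    apply: no; [exists j, i | exists i, j].
have per i : w (i + n) = w i.
  have := ones_slide w i n; rewrite (eq i i.+1).
  by case: (w i); case: (w (i + n)) => //=; clear; lia.
have [[i [j [h wi wj]]] _] := sp n.
by have := h 0 n0; rewrite !addn0 -(per i) -(per j) wi wj.
Qed.

(** * Factors and abelian returns *)

Local Open Scope classical_set_scope.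
Local Open Scope card_scope.

Lemma card_eq_seqP (T : choiceType) (A : set T) n :
  A #= `I_n <-> exists s : seq T, [/\ uniq s, size s = n & forall x, A x <-> x \in s].
Proof.
split=> [hA|[s [us <- hs]]].
  have /finite_fsetP[X eA] : finite_set A by apply/finite_setP; exists n.
  move: hA; rewrite eA => /card_eq_fsetP hX.
  by exists (enum_fset X); split=> //; exact: fset_uniq.
have -> : A = [set` [fset x in s]%fset].
  by apply/seteqP; split=> x; rewrite /= inE; case: (hs x).
by apply/card_eq_fsetP; rewrite card_fseq undup_id.
Qed.

Lemma size_block (w : infword bool) i n : size (block w i n) = n.
Proof. by rewrite size_map size_iota. Qed.

Lemma nth_block (w : infword bool) i n t : t < n -> nth false (block w i n) t = w (i + t).
Proof. by move=> tn; rewrite (nth_map 0) ?size_iota // nth_iota. Qed.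

Lemma eq_blockP (w : infword bool) i j n : block w i n = block w j n <-> agree w n i j.
Proof.
split=> [e t tn|h]; first by rewrite -!(@nth_block w _ n) // e.
by apply: (@eq_from_nth _ false); rewrite !size_block // => t tn; rewrite !nth_block // h.
Qed.

Lemma block_rcons (w : infword bool) i n : block w i n.+1 = rcons (block w i n) (w (i + n)).
Proof. by rewrite /block -addn1 iotaD map_cat cats1. Qed.

Lemma count_block (w : infword bool) i n : count_mem true (block w i n) = ones w i n.
Proof. by elim: n i => //= n IH i; rewrite -IH; case: (w i). Qed.

Lemma recurrentP (w : infword bool) : recurrent w -> uniformly_recurring w.
Proof.
move=> rec i L B; apply: contrapT => no.
have f : factor w (block w i L) by exists i; rewrite /occurs_at size_block.
apply: (rec _ f); apply: (@sub_finite_set _ _ `I_B); last exact: finite_II.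
move=> j /=; rewrite /occurs_at size_block => /eq_blockP h.
by rewrite ltnNge; apply/negP => Bj; apply: no; exists j.
Qed.

(** Grown on the right, so that the two halves of [words n.+1] are the right extensions by 0 and by
    1. *)
Fixpoint words (n : nat) : seq (seq bool) :=
  if n is m.+1 then [seq rcons u false | u <- words m] ++ [seq rcons u true | u <- words m]
  else [:: [::]].

Lemma mem_words n u : (u \in words n) = (size u == n).
Proof.
elim: n u => [|n IH] u; first by case: u.
rewrite /= mem_cat; case/lastP: u => [|u b].
  by apply/negbTE; rewrite negb_or; apply/andP; split; apply/mapP => -[[]].
have inj c : injective (rcons^~ c : seq bool -> seq bool) by move=> x y /rcons_inj [].
have neq c d v : c != d -> (rcons v c \in [seq rcons u d | u <- words n]) = false.
  by move=> cd; apply/mapP => -[x _ /rcons_inj [_ e]]; rewrite e eqxx in cd.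
rewrite size_rcons eqSS -IH.
by case: b; rewrite (mem_map (inj _)) neq // orbF.
Qed.

Lemma words_uniq n : uniq (words n).
Proof.
elim: n => //= n IH.
have inj c : injective (rcons^~ c : seq bool -> seq bool) by move=> x y /rcons_inj [].
rewrite cat_uniq !map_inj_uniq // IH andbT /=.
by apply/hasPn => _ /mapP[x _ ->]; apply/mapP => -[y _ /rcons_inj []].
Qed.

Section Complexity.

Variable w : infword bool.

Let fac u := `[< factor w u >].

Definition factors (n : nat) : seq (seq bool) := [seq u <- words n | fac u].

Let right_special u := fac (rcons u false) && fac (rcons u true).

Lemma mem_factors n u : u \in factors n <-> factor w u /\ size u = n.
Proof.
rewrite mem_filter mem_words; split=> [/andP[/asboolP ? /eqP]//|[? ->]].
by rewrite eqxx andbT; apply/asboolP.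
Qed.

Let facP u : fac u = fac (rcons u false) || fac (rcons u true).
Proof.
have E b : fac (rcons u b) -> fac u.
  move=> /asboolP[i]; rewrite /occurs_at size_rcons block_rcons => /rcons_inj [h _].
  by apply/asboolP; exists i.
apply/idP/orP => [/asboolP[i h]|[]]; try exact: E.
have : fac (rcons u (w (i + size u))).
  by apply/asboolP; exists i; rewrite /occurs_at size_rcons block_rcons h.
by case: (w _); [right | left].
Qed.

(** Every factor has a right extension, and a second one exactly when it is right special. *)
Lemma size_factorsS n :
  size (factors n.+1) = size (factors n) + count right_special (words n).
Proof.
rewrite !size_filter /= count_cat !count_map -count_predUI; congr (_ + _).
by apply: eq_count => u; rewrite /= [RHS]facP.
Qed.

Lemma sturmian_factors : sturmian w <-> forall n, size (factors n) = n.+1.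
Proof.
split=> h n; have := h n.
  move=> /card_eq_seqP[s [us <- hs]]; apply: perm_size.
  apply: uniq_perm; rewrite ?filter_uniq ?words_uniq // => u.
  by apply/idP/idP => [/mem_factors/hs|/hs/mem_factors].
move=> e; apply/card_eq_seqP; exists (factors n); split=> //.
  by rewrite filter_uniq ?words_uniq.
by move=> u; rewrite mem_factors.
Qed.

Lemma right_specialP n i : right_special (block w i n) <->
  exists j k, agree w n i j /\ special w n j k.
Proof.
have F b : fac (rcons (block w i n) b) <-> exists2 j, agree w n i j & w (j + n) = b.
  split=> [/asboolP[j]|[j h <-]].
    rewrite /occurs_at size_rcons size_block block_rcons => /rcons_inj [h ?].
    by exists j => //; apply/eq_blockP.
  apply/asboolP; exists j; rewrite /occurs_at size_rcons size_block block_rcons.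
  by congr rcons; apply/eq_blockP => t tn; rewrite h.
split=> [/andP[/F[j hj wj] /F[k hk wk]]|[j [k [ij [jk wj wk]]]]].
  by exists j, k; split=> //; split=> // t tn; rewrite -hj // hk.
by apply/andP; split; apply/F; [exists j | exists k] => // t tn; rewrite ij // jk.
Qed.

Lemma count_right_special n : count right_special (words n) = 1 <-> one_special w n.
Proof.
have memF u : u \in filter right_special (words n) ->
    exists i, u = block w i n /\ right_special (block w i n).
  rewrite mem_filter mem_words => /andP[ru /eqP su].
  have /asboolP[i] : fac u by rewrite facP; case/andP: ru => ->.
  by rewrite /occurs_at su => e; exists i; rewrite e.
have blF i : right_special (block w i n) -> block w i n \in filter right_special (words n).
  by move=> ri; rewrite mem_filter ri mem_words size_block /=.
rewrite -size_filter; split=> [|[[i [j ij]] uniq1]].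
  case e: (filter _ _) => [|u [|]] // _.
  have [|i [_ /right_specialP[j [k [_ jk]]]]] := memF u; first by rewrite e inE.
  split; first by exists j, k.
  have one a b : special w n a b -> block w a n = u.
    move=> ab; have := @blF a; rewrite e inE => H; apply/eqP/H/right_specialP.
    by exists a, b.
  by move=> a b a' b' /one ea /one ea'; apply/eq_blockP; rewrite ea.
have ri : right_special (block w i n) by apply/right_specialP; exists i, j.
rewrite -[RHS]/(size [:: block w i n]); apply: perm_size; apply: uniq_perm => //.
  by rewrite filter_uniq ?words_uniq.
move=> u; rewrite inE; apply/idP/eqP => [/memF[a [-> /right_specialP]]|->]; last exact: blF.
by move=> [b [c [ab bc]]]; apply/eq_blockP => t tn; rewrite ab // (uniq1 _ _ _ _ bc ij).
Qed.

Lemma one_special_sturmian : (forall n, one_special w n) -> sturmian w.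
Proof.
move=> h; apply/sturmian_factors; elim=> [|n IH].
  rewrite size_filter /= /fac asboolT //; exists 0; exact: erefl.
by rewrite size_factorsS IH (proj2 (count_right_special n)) // addn1.
Qed.

Lemma sturmian_one_special n : sturmian w -> one_special w n.
Proof.
move=> /sturmian_factors h; apply/count_right_special.
by have := size_factorsS n; rewrite !h -[n.+2]addn1 => /addnI.
Qed.

Lemma sturmian_few_blocks n : sturmian w -> few_blocks w n.
Proof.
move=> /sturmian_factors h f; pose s := [seq block w (f k) n | k <- iota 0 n.+2].
have : ~~ uniq s.
  apply/negP => us; suff : n.+2 <= n.+1 by rewrite ltnn.
  rewrite -{1}(size_iota 0 n.+2) -[X in _ <= X]h -(size_map (fun k => block w (f k) n)).
  apply: uniq_leq_size => // _ /mapP[k _ ->]; apply/mem_factors.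
  by rewrite size_block; split=> //; exists (f k); rewrite /occurs_at size_block.
case/(uniqPn [::]) => i [j [ij js e]]; rewrite size_map size_iota in js.
exists i, j; rewrite ij /=; split=> //; apply/eq_blockP.
by move: e; rewrite !(nth_map 0) ?size_iota ?nth_iota //; lia.
Qed.

Lemma abelian_eqP (u v : seq bool) : abelian_eq u v <->
  size u = size v /\ count_mem true u = count_mem true v.
Proof.
have S (s : seq bool) : size s = count_mem true s + count_mem false s.
  by elim: s => //= -[] s ->; lia.
split=> [h|[s t] [] //]; first by rewrite !S !h.
by move: s; rewrite !S t => /addnI.
Qed.

(** Over two letters an abelian class amounts to a length and a number of ones. *)
Lemma card_abelian_returns u k : abelian_returns w u #= `I_k <->
  exists s : seq (nat * nat), [/\ uniq s, size s = k & forall x,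
    return_type w (size u) (count_mem true u) x.1 x.2 <-> x \in s].
Proof.
pose P := [set x | return_type w (size u) (count_mem true u) x.1 x.2].
pose cls (x : nat * nat) := [set v : seq bool | size v = x.1 /\ count_mem true v = x.2].
have occ i : abelian_occurs_at w u i <-> ones w i (size u) = count_mem true u.
  by rewrite /abelian_occurs_at abelian_eqP size_block count_block; split=> [[]|].
have cons i j : consecutive_abelian_occurrences w u i j <->
    consecutive w (size u) (count_mem true u) i j.
  by split=> -[ij /occ hi /occ hj h]; split=> // l /h hl /occ.
have clsE i l : abelian_class (block w i l) = cls (l, ones w i l).
  apply/seteqP; split=> v /=; rewrite /abelian_class /= abelian_eqP size_block count_block.
  by move=> [/= -> ->].
  by case=> h1 h2; split; rewrite ?h1 ?h2.
have -> : abelian_returns w u = cls @` P.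
  apply/seteqP; split=> C /=.
    move=> [i [j [/cons h ->]]]; exists (j - i, ones w i (j - i)); last by rewrite clsE.
    exact: return_typeI.
  move=> [[l o] [i [h /= <-]] <-]; exists i, (i + l); split; first exact/cons.
  by rewrite addKn clsE.
have inj : {in P &, injective cls}.
  move=> [l o] [l' o'] /set_mem/return_type_le /= [_ ol] _ e.
  (* The class of (l, o) has a member because o <= l, and any member gives back the pair. *)
  set v := nseq o true ++ nseq (l - o) false.
  have [sv cv] : size v = l /\ count_mem true v = o.
    by rewrite size_cat count_cat !size_nseq !count_nseq /=; lia.
  have : cls (l, o) v by [].
  by rewrite e => -[/= <- <-]; rewrite sv cv.
rewrite (card_eql (inj_card_eq inj)).
exact: card_eq_seqP.
Qed.

End Complexity.

(* The letters 0 and 1 are [false] and [true]. *)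
Theorem theorem2 (w : infword bool) (hrec : recurrent w) :
  sturmian w <->
  (forall u : seq bool, factor w u ->
     abelian_returns w u #= `I_2 \/ abelian_returns w u #= `I_3).
Proof.
have rec := recurrentP hrec; split=> [st u [i hu]|ret].
  have sp n := sturmian_one_special n st.
  have bal n : balanced_at w n.
    by apply: one_special_balanced => // r; apply: sturmian_few_blocks.
  have nonc n n0 := @one_special_nonconstant w n sp n0.
  have := balanced_three_gaps (size u) i rec bal nonc.
  rewrite -count_block hu => -[l1 [o1 [l2 [o2 [ne r1 r2 all]]]]].
  pose x3 := (l1 + l2, o1 + o2).
  have ne' : (l1, o1) \notin [:: (l2, o2)] by rewrite inE; apply/eqP.
  (* The sum counts as a third return only if it differs from the first two and occurs. *)
  have two : (x3 \in [:: (l1, o1); (l2, o2)]) ||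
      ~~ `[< return_type w (size u) (count_mem true u) x3.1 x3.2 >] ->
      abelian_returns w u #= `I_2.
    move=> h; apply/card_abelian_returns; exists [:: (l1, o1); (l2, o2)].
    split; rewrite /= ?ne' // => -[l o]; split; last by rewrite !inE => /orP[] /eqP[-> ->].
    move=> r; have := all _ _ r; rewrite !inE => -[->|->|e]; rewrite ?eqxx ?orbT //.
    move: r; rewrite /= => r; case: e => el eo; rewrite el eo in r *.
    by case/orP: h => [|/asboolPn //]; rewrite !inE.
  set third := _ || _ in two; have [/two|] := boolP third; first by left.
  rewrite negb_or negbK => /andP[nx /asboolP r3].
  right; apply/card_abelian_returns; exists [:: x3; (l1, o1); (l2, o2)].
  split; rewrite /= ?nx ?ne' // => -[l o]; split=> [r|].
    by rewrite !inE; case: (all _ _ r) => ->; rewrite eqxx ?orbT.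
  by rewrite !inE => /or3P[] /eqP[-> ->].
apply: one_special_sturmian => n; apply: two_or_three_one_special.
have types m i : exists s : seq (nat * nat), [/\ uniq s, 1 < size s <= 3 &
    forall x, return_type w m (ones w i m) x.1 x.2 <-> x \in s].
  have f : factor w (block w i m) by exists i; rewrite /occurs_at size_block.
  by have [] := ret _ f => /card_abelian_returns[s [us ss hs]]; exists s;
    rewrite ss; split=> // x; rewrite -hs size_block count_block.
split=> //.
- move=> m c [//|x s] us hs.
  have [i [[_ hi _ _] _]] := hs x (mem_head _ _).
  have [s' [_ /andP[_ ss'] hs']] := types m i; apply: leq_trans ss'.
  by apply: uniq_leq_size => // y /hs r; apply/hs'; rewrite hi.
move=> m c i hi l o; have [[|x [|y s]] [us //_ hs]] := types m i.
have [ex|nx] := eqVneq x (l, o).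
  exists y.1, y.2; rewrite -hi; split; first by apply/hs; rewrite !inE eqxx orbT.
  rewrite -surjective_pairing -ex => e; move: us; rewrite /= e inE eqxx //.
exists x.1, x.2; rewrite -hi; split; first by apply/hs; rewrite !inE eqxx.
by rewrite -surjective_pairing; apply/eqP.
Qed.
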